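(* For every family in prenormal form $(x^2-\epsilon)y'=B(\epsilon,x)y$, with $r$ and then $\rho$ sufficiently small, the auto-intersection relation is satisfied by its unfolded Stokes matrices: there exist nonsingular diagonal matrices $\bar Q_U$ and $\bar Q_D$ depending analytically on $\bar\epsilon\in S_\cap$, with a nonsingular limit at $\epsilon=0$, such that $|\bar Q_s-I|<c_s|\bar\epsilon|$ for some $c_s\in\mathbb{R}$, for $\bar\epsilon\in S_\cap$, $s=D,U$, and $$\bar Q_D\,\bar D_R\bar T_R^{-1}\bar T_L\bar D_R^{-1}=\tilde T_L^{-1}\tilde T_R\,\bar Q_U,$$ equivalently $\bar Q_D\bar N_l=\tilde N_l\bar Q_U$ for $l=L,R$.
   Context: Systems. A family in prenormal form is a family $(x^2-\epsilon)y'=B(\epsilon,x)y$, $y\in\mathbb{C}^n$, $n\ge2$, $'=d/dx$, with $B=\Lambda(\epsilon,x)+(x^2-\epsilon)R(\epsilon,x)$, $\Lambda(\epsilon,x)=\mathrm{diag}\{\lambda_1(\epsilon,x),\dots,\lambda_n(\epsilon,x)\}=\Lambda_0(\epsilon)+\Lambda_1(\epsilon)x$, $\Lambda_0,\Lambda_1$ diagonal and analytic in $\epsilon$ near $0$, $R$ a matrix of germs of analytic functions of $(\epsilon,x)$ at the origin, and $\Re(\lambda_q(0,0)-\lambda_j(0,0))>0$ for $q<j$. Model system: $(x^2-\epsilon)z'=\Lambda(\epsilon,x)z$. Parameter sector. Let $\theta_0$ be the largest angle (supremum) in $(0,\frac\pi2)$ with $\Re(e^{\pm i\theta_0}(\lambda_q(0,0)-\lambda_j(0,0)))\ge0$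 for $q<j$. Fix $\gamma>0$ with $\gamma(1+\frac{2\gamma}{\pi})<\theta_0$ and let $S=\{\hat\epsilon:0<|\hat\epsilon|<\rho,\ \arg\hat\epsilon\in(\pi-2\gamma,3\pi+2\gamma)\}$ (on the universal covering of $\mathbb{C}^*$; $\epsilon$ is the projection of $\hat\epsilon$). Put $\arg\sqrt{\hat\epsilon}=\frac12\arg\hat\epsilon$, $\hat x_L=\sqrt{\hat\epsilon}$, $\hat x_R=-\sqrt{\hat\epsilon}$. The radius $\rho>0$ is small, in particular so that for some $C>0$, $\Re(e^{\pm i\gamma(1+2\gamma/\pi)}(\lambda_q(\epsilon,\hat x_l)-\lambda_j(\epsilon,\hat x_l)))>C$ for $q<j$, $l=L,R$, $\hat\epsilon\in S$. $S_\cap$ is the auto-intersection of $S$: it consists of the pairs $\bar\epsilon$, $\tilde\epsilon=\bar\epsilon e^{2\pi i}$ both in $S$. For a quantity depending on $\hat\epsilon$ (marked by a hat), a bar (resp. tilde) denotes its value at $\bar\epsilon$ (resp. $\tilde\epsilon$). Sectorial domains. Fix $r>0$ small, $\mathbb{D}_r=\{|x|<r\}$, $\delta>0$ small, $\Omega_D=\{|x|<r,\,-(\pi+\delta)<\arg x<\delta\}$, $\Omega_U=\{|x|<r,\,-\delta<\arg x<\pi+\delta\}$, such that the closure of $\Omega_D$ (resp. $\Omega_U$) contains no ray $\Re((\lambda_q(0,0)-\lambda_j(0,0))/x)=0$, $q\ne j$, of the upper (resp. lower) half-plane. Use the time $t$ of $\dot x=x^2-\epsilon$: $x(t)=-\sqrt{\hat\epsilon}\coth(\sqrt{\hat\epsilon}\,t)$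 if $\epsilon\neq0$ (period $\pi i/\sqrt{\hat\epsilon}$), $x(t)=-1/t$ if $\epsilon=0$. Fix small constants $c_0>0$, $h\in(0,1/r)$, $\kappa\in(0,\frac12)$ independent of $\hat\epsilon$. Let $N_{\hat\epsilon}$ be the connected component containing $t=0$ of $\{t:|x(t)|\ge r\}$, $P=-\pi i/\sqrt{\hat\epsilon}$, $\hat\theta=\frac{2\gamma}{\pi}(\pi-\arg\sqrt{\hat\epsilon})$, and $\sigma(u)=0$ if $|u|\le c_0/\sqrt{|\epsilon|}$, $\sigma(u)=(u-\mathrm{sgn}(u)c_0/\sqrt{|\epsilon|})\tan\hat\theta$ otherwise. $\Gamma_D^{\hat\epsilon}$ is the set of $t\notin N_{\hat\epsilon}$ with $\Im t<h+\sigma(\Re t)$ lying above the line $-(\frac12+\kappa)P+\mathbb{R}e^{i\hat\theta}$; $\Gamma_U^{\hat\epsilon}$ is the set of $t\notin N_{\hat\epsilon}$ with $\Im t>-h+\sigma(\Re t)$ lying below the line $(\frac12+\kappa)P+\mathbb{R}e^{i\hat\theta}$. $\Omega_s^{\hat\epsilon}=x(\Gamma_s^{\hat\epsilon})$, $s=D,U$. $\Omega_D^{\hat\epsilon}\cap\Omega_U^{\hat\epsilon}$ has three connected components $\Omega_L^{\hat\epsilon},\Omega_R^{\hat\epsilon},\Omega_C^{\hat\epsilon}$, images of the right and left components of $\Gamma_D^{\hat\epsilon}\cap\Gamma_U^{\hat\epsilon}$ and of $\Gamma_D^{\hat\epsilon}\cap(\Gamma_U^{\hat\epsilon}-P)$;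 their closures contain respectively $\hat x_L$, $\hat x_R$, and both; $0\in\Omega_C^{\hat\epsilon}$. Model solutions. For $l=L,R$, $\mathcal U_l=\frac1{2\hat x_l}\Lambda(\epsilon,\hat x_l)$, $\hat D_R=e^{-2\pi i\,\mathcal U_R}$, $\hat D_L=e^{2\pi i\,\mathcal U_L}$. $F(\epsilon,x)=(x-\hat x_R)^{\mathcal U_R}(x-\hat x_L)^{\mathcal U_L}$ is a fundamental matrix of the model. $F_D(\hat\epsilon,\cdot)$ is its branch on $\Omega_D^{\hat\epsilon}$ (namely $e^{t\Lambda_0}(x^2-\epsilon)^{\Lambda_1/2}$ with $x=x(t)$, $t\in\Gamma_D^{\hat\epsilon}$, converging as $\hat\epsilon\to0$ to $x^{\Lambda_1(0)}e^{-\Lambda_0(0)/x}$ with $-(\pi+\delta)<\arg x<\delta$), and $F_U(\hat\epsilon,\cdot)$ is the analytic continuation of $F_D$ to $\Omega_U^{\hat\epsilon}$ through $\Omega_R^{\hat\epsilon}$. Unfolded Stokes matrices. $H_s(\hat\epsilon,x)$, $s=D,U$, are matrices, analytic for $\hat\epsilon\in S$, $x\in\Omega_s^{\hat\epsilon}$, such that $W_s=H_sF_s$ is a fundamental matrix of solutions of the family on $\Omega_s^{\hat\epsilon}$; $\lim_{x\to\hat x_l,x\in\Omega_s^{\hat\epsilon}}H_s(\hat\epsilon,x)$ ($l=L,R$) is an invertible diagonal matrix independent of $s$, analytic in $\hat\epsilon\in S$ with nonsingular limit at $\epsilon=0$; $|H_s(\bar\epsilon,0)-H_s(\tilde\epsilon,0)|\le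 c|\bar\epsilon|$ on $S_\cap$ for some $c\ge0$; and $|H_s(\hat\epsilon,0)|$, $|H_s(\hat\epsilon,0)^{-1}|$ are bounded on $S_\cap$. The unfolded Stokes matrices $\hat C_R$ (upper triangular unipotent) and $\hat C_L$ (lower triangular unipotent) are defined by $H_D^{-1}H_U=F_D\hat C_RF_D^{-1}$ on $\Omega_R^{\hat\epsilon}$, $H_D^{-1}H_U=F_D\hat C_LF_D^{-1}$ on $\Omega_L^{\hat\epsilon}$ (and $H_D^{-1}H_U=I$ on $\Omega_C^{\hat\epsilon}$). Matrices on $S_\cap$. For $\hat\epsilon\in S_\cap$ the diagonal entries of $\hat D_l$ are distinct; $\hat T_R$ (upper triangular unipotent) and $\hat T_L$ (lower triangular unipotent) are determined by $\hat T_l^{-1}\hat C_l\hat D_l\hat T_l=\hat D_l$. The transition invariants are $\tilde N_L=\tilde D_L\tilde T_L^{-1}\tilde T_R\tilde D_L^{-1}$, $\tilde N_R=\tilde T_L^{-1}\tilde T_R$, $\bar N_L=\bar T_R^{-1}\bar T_L$, $\bar N_R=\bar D_R\bar T_R^{-1}\bar T_L\bar D_R^{-1}$. *)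

(* Defs.v *)
From HB Require Import structures.
From mathcomp Require Import all_boot all_order all_algebra.
From mathcomp Require Import all_classical all_reals all_analysis.
From mathcomp.real_closed Require Import complex.

Set Implicit Arguments.
Unset Strict Implicit.
Unset Printing Implicit Defensive.

Import Order.TTheory GRing.Theory Num.Theory.
Import numFieldNormedType.Exports.
Local Open Scope classical_set_scope.
Local Open Scope ring_scope.

(* R[i] also carries an R-module structure; the alias selects the
   numClosedFieldType one, hence the C-normed module (and topology) used for
   complex differentiability. *)
Definition Cplx (R : realType) : numClosedFieldType := R[i].

Section ComplexFunctions.
Variable R : realType.
Notation C := (Cplx R).

Definition re (z : C) : R := complex.Re z.
Definition im (z : C) : R := complex.Im z.
Definition ofR (a : R) : C := Complex a 0.
Definition iC : C := Complex 0 1.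

Definition cexp (z : C) : C :=
  Complex (expR (re z) * cos (im z)) (expR (re z) * sin (im z)).
Definition ccosh (z : C) : C := (cexp z + cexp (- z)) / 2.
Definition csinh (z : C) : C := (cexp z - cexp (- z)) / 2.

(* Holomorphy; for matrices it is required of every entry. *)
Definition analytic_at (m n : nat) (f : C -> 'M[C]_(m, n)) (z : C) : Prop :=
  forall i j, \forall u \near z, derivable (fun v => f v i j) u 1.

Definition analytic2_at (m n : nat) (f : C -> C -> 'M[C]_(m, n)) (z x : C) :
    Prop :=
  forall i j, \forall p \near ((z, x) : C * C),
    differentiable (fun q : C * C => f q.1 q.2 i j) p.

Definition mx_deriv (m n : nat) (f : C -> 'M[C]_(m, n)) (x : C) :
    'M[C]_(m, n) :=
  \matrix_(i, j) 'D_1 (fun y => f y i j) x.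

Definition expdiag (n : nat) (v : 'rV[C]_n) : 'M[C]_n := diag_mx (map_mx cexp v).

End ComplexFunctions.

Arguments iC {R}.

Section Triangular.
Variables (K : pzRingType) (n : nat).

Definition lower_unipotent (A : 'M[K]_n) : Prop :=
  is_trig_mx A /\ forall i, A i i = 1.
Definition upper_unipotent (A : 'M[K]_n) : Prop := lower_unipotent A^T.

End Triangular.

(* s = D, U indexes the sectorial domains, l = L, R the singular points. *)
Inductive side := sD | sU.
Inductive sing := pL | pR.

(* Data of (x^2 - eps) y' = B(eps, x) y with
   B = diag(pf_L0 + x pf_L1) + (x^2 - eps) pf_R. *)
Record prenormal_family (R : realType) (n : nat) := PrenormalFamily {
  pf_L0 : Cplx R -> 'rV[Cplx R]_n;
  pf_L1 : Cplx R -> 'rV[Cplx R]_n;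
  pf_R : Cplx R -> Cplx R -> 'M[Cplx R]_n;
  pf_L0_analytic : analytic_at pf_L0 0;
  pf_L1_analytic : analytic_at pf_L1 0;
  pf_R_analytic : analytic2_at pf_R 0 0;
  pf_order : forall q j : 'I_n, (q < j)%N ->
    0 < re (pf_L0 0 ord0 q - pf_L0 0 ord0 j)
}.

Record geometry (R : realType) := Geometry {
  g_gamma : R;
  g_r : R;
  g_c0 : R;
  g_h : R;
  g_kappa : R
}.

Section Covering.
Variable R : realType.
Notation C := (Cplx R).

(* The universal covering of C^* is exp : C -> C^*.  A point of it is given by
   its logarithm w, with Im w its argument; analyticity in the point is
   analyticity in w. *)
Definition eps (w : C) : C := cexp w.
Definition sqrt_eps (w : C) : C := cexp (w / 2).
Definition arg_sqrt (w : C) : R := im w / 2.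
(* From bar-epsilon to tilde-epsilon. *)
Definition turn (w : C) : C := w + ofR (2 * pi) * iC.

Definition hatx (l : sing) (w : C) : C :=
  match l with pL => sqrt_eps w | pR => - sqrt_eps w end.

Definition sectorS (gamma rho : R) : set C :=
  [set w | `|eps w| < ofR rho /\
           pi - 2 * gamma < im w < 3 * pi + 2 * gamma].

(* The auto-intersection, parametrised by bar-epsilon. *)
Definition capS (gamma rho : R) : set C :=
  [set w | sectorS gamma rho w /\ sectorS gamma rho (turn w)].

(* The filter "eps -> 0 within A". *)
Definition eps_to0 (A : set C) : set_system C :=
  filter_from [set eta : R | 0 < eta]
              (fun eta => A `&` [set w | `|eps w| < ofR eta]).

#[global] Instance eps_to0_filter (A : set C) : Filter (eps_to0 A).
Proof.
apply: filter_from_filter; first by exists 1 => /=; exact: ltr01.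
move=> a b /= a0 b0; exists (Num.min a b); first by rewrite /= lt_min a0 b0.
have ofR_le (x y : R) : x <= y -> ofR x <= ofR y :> C by rewrite /ofR lecE /= eqxx.
move=> w [Aw /= wab]; split; split=> //=; apply: (lt_le_trans wab); apply: ofR_le.
  by rewrite ge_min lexx.
by rewrite ge_min lexx orbT.
Qed.

End Covering.

Section Domains.
Variables (R : realType) (g : geometry R).
Notation C := (Cplx R).

Definition xt (w t : C) : C :=
  - sqrt_eps w * (ccosh (sqrt_eps w * t) / csinh (sqrt_eps w * t)).

(* A zero of sinh is a pole of x(t), where |x(t)| = oo (whereas division by
   zero makes xt vanish there). *)
Definition Nset (w : C) : set C :=
  connected_component
    [set t : C | csinh (sqrt_eps w * t) = 0 \/ ofR (g_r g) <= `|xt w t|] 0.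

Definition Pper (w : C) : C := - (ofR pi * iC) / sqrt_eps w.

Definition theta (w : C) : R := 2 * g_gamma g / pi * (pi - arg_sqrt w).

Definition sigma (w : C) (u : R) : R :=
  let a := g_c0 g / Num.sqrt (re `|eps w|) in
  if `|u| <= a then 0 else (u - Num.sg u * a) * tan (theta w).

(* Height at abscissa u of the line a + R e^{i th}, |th| < pi/2. *)
Definition line_height (a : C) (th u : R) : R := im a + (u - re a) * tan th.

Definition Gamma (s : side) (w : C) : set C :=
  match s with
  | sD => [set t | [/\ ~ Nset w t,
      im t < g_h g + sigma w (re t) &
      line_height (- (ofR (2^-1 + g_kappa g) * Pper w)) (theta w) (re t) < im t]]
  | sU => [set t | [/\ ~ Nset w t,
      - g_h g + sigma w (re t) < im t &
      im t < line_height (ofR (2^-1 + g_kappa g) * Pper w) (theta w) (re t)]]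
  end.

Definition Omega (s : side) (w : C) : set C := xt w @` Gamma s w.

(* Union of the connected components of A extending to Re t = +oo
   (resp. -oo). *)
Definition right_component (A : set C) : set C :=
  [set t | forall M : R, exists2 u, connected_component A t u & M < re u].
Definition left_component (A : set C) : set C :=
  [set t | forall M : R, exists2 u, connected_component A t u & re u < M].

Definition OmegaLR (l : sing) (w : C) : set C :=
  let A := Gamma sD w `&` Gamma sU w in
  xt w @` (match l with pL => right_component A | pR => left_component A end).

Definition OmegaC (w : C) : set C :=
  xt w @` [set t | Gamma sD w t /\ Gamma sU w (t + Pper w)].

End Domains.

Section Family.
Variables (R : realType) (n : nat) (f : prenormal_family R n).
Notation C := (Cplx R).

Definition lam (e x : C) : 'rV[C]_n := pf_L0 f e + x *: pf_L1 f e.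

Definition Bmx (e x : C) : 'M[C]_n :=
  diag_mx (lam e x) + (x ^+ 2 - e) *: pf_R f e x.

Definition gap (q j : 'I_n) (e x : C) : C := lam e x ord0 q - lam e x ord0 j.

Definition theta0 : R :=
  sup [set th : R | 0 < th < pi / 2 /\
    forall q j : 'I_n, (q < j)%N ->
      0 <= re (cexp (ofR th * iC) * gap q j 0 0) /\
      0 <= re (cexp (- (ofR th * iC)) * gap q j 0 0)].

Definition gap_on_sector (gamma rho : R) : Prop :=
  let a := gamma * (1 + 2 * gamma / pi) in
  exists2 c : R, 0 < c & forall (w : C) (l : sing) (q j : 'I_n),
    sectorS gamma rho w -> (q < j)%N ->
    c < re (cexp (ofR a * iC) * gap q j (eps w) (hatx l w)) /\
    c < re (cexp (- (ofR a * iC)) * gap q j (eps w) (hatx l w)).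

Definition sector0 (s : side) (r delta : R) : set C :=
  match s with
  | sD => [set x | exists2 z : C, x = cexp z /\ `|x| < ofR r &
                    - (pi + delta) < im z < delta]
  | sU => [set x | exists2 z : C, x = cexp z /\ `|x| < ofR r &
                    - delta < im z < pi + delta]
  end.

Definition delta_ok (r delta : R) : Prop :=
  forall (q j : 'I_n) (x : C), q != j -> re (gap q j 0 0 / x) = 0 ->
    (closure (sector0 sD r delta) x -> ~ 0 < im x) /\
    (closure (sector0 sU r delta) x -> ~ im x < 0).

Definition Uexp (l : sing) (w : C) : 'rV[C]_n :=
  (2 * hatx l w)^-1 *: lam (eps w) (hatx l w).

Definition Dmx (l : sing) (w : C) : 'M[C]_n :=
  match l with
  | pR => expdiag (- (ofR (2 * pi) * iC) *: Uexp pR w)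
  | pL => expdiag ((ofR (2 * pi) * iC) *: Uexp pL w)
  end.

(* lg is the branch of log (x^2 - eps), x = x(t), on Gamma_D; it is pinned down
   by its limit 2 z when eps -> 0, where z is the logarithm of x = -1/t with
   -(pi + delta) < arg x < delta, t ranging over Gamma_D at eps = 0, that is
   |t| > 1/r and Im t < h. *)
Record model_solutions (g : geometry R) (delta rho : R)
    (F : side -> C -> C -> 'M[C]_n) : Prop := ModelSolutions {
  FD_branch : exists lg : C -> C -> C,
    [/\ {within [set p : C * C | sectorS (g_gamma g) rho p.1 /\
                                 Gamma g sD p.1 p.2],
          continuous (fun p : C * C => lg p.1 p.2)},
        forall w t, sectorS (g_gamma g) rho w -> Gamma g sD w t ->
          cexp (lg w t) = xt w t ^+ 2 - eps w,
        forall z t : C, cexp z = - t^-1 -> (`|t| > ofR (g_r g)^-1) ->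
          im t < g_h g -> - (pi + delta) < im z < delta ->
          lg w t @[w --> eps_to0 (sectorS (g_gamma g) rho `&`
                                  [set w | Gamma g sD w t])] --> 2 * z &
        forall w t, sectorS (g_gamma g) rho w -> Gamma g sD w t ->
          F sD w (xt w t) =
            expdiag (t *: pf_L0 f (eps w) + (lg w t / 2) *: pf_L1 f (eps w))];
  FU_analytic : forall w x, sectorS (g_gamma g) rho w -> Omega g sU w x ->
    analytic_at (F sU w) x;
  FU_continuation : forall w x, sectorS (g_gamma g) rho w ->
    OmegaLR g pR w x -> F sU w x = F sD w x
}.

Definition fundamental_at (w x : C) (W : C -> 'M[C]_n) : Prop :=
  [/\ analytic_at W x,
      (x ^+ 2 - eps w) *: mx_deriv W x = Bmx (eps w) x *m W x &
      W x \in unitmx].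

Record unfolded_transformations (g : geometry R) (rho : R)
    (F H : side -> C -> C -> 'M[C]_n) : Prop := UnfoldedTransformations {
  H_analytic : forall s w x, sectorS (g_gamma g) rho w -> Omega g s w x ->
    analytic2_at (H s) w x;
  H_solution : forall s w x, sectorS (g_gamma g) rho w -> Omega g s w x ->
    fundamental_at w x (fun y => H s w y *m F s w y);
  H_limit : forall l : sing, exists K : C -> 'M[C]_n,
    [/\ forall w, sectorS (g_gamma g) rho w ->
          [/\ is_diag_mx (K w), K w \in unitmx & analytic_at K w],
        exists2 K0 : 'M[C]_n, K0 \in unitmx &
          K w @[w --> eps_to0 (sectorS (g_gamma g) rho)] --> K0 &
        forall s w, sectorS (g_gamma g) rho w ->
          H s w x @[x --> within (Omega g s w) (nbhs (hatx l w))] --> K w];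
  H_close : forall s, exists2 c : R, 0 <= c &
    forall w, capS (g_gamma g) rho w ->
      `|H s w 0 - H s (turn w) 0| <= ofR c * `|eps w|;
  H_bounded : forall s, exists M : R, forall w, capS (g_gamma g) rho w ->
    [/\ `|H s w 0| <= ofR M, `|invmx (H s w 0)| <= ofR M,
        `|H s (turn w) 0| <= ofR M & `|invmx (H s (turn w) 0)| <= ofR M]
}.

Definition unipotent_at (l : sing) (A : 'M[C]_n) : Prop :=
  match l with pL => lower_unipotent A | pR => upper_unipotent A end.

Record unfolded_Stokes_matrices (g : geometry R) (rho : R)
    (F H : side -> C -> C -> 'M[C]_n) (S : sing -> C -> 'M[C]_n) : Prop :=
    UnfoldedStokesMatrices {
  Stokes_unipotent : forall l w, sectorS (g_gamma g) rho w ->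
    unipotent_at l (S l w);
  Stokes_LR : forall l w x, sectorS (g_gamma g) rho w -> OmegaLR g l w x ->
    invmx (H sD w x) *m H sU w x =
      F sD w x *m S l w *m invmx (F sD w x);
  Stokes_C : forall w x, sectorS (g_gamma g) rho w -> OmegaC g w x ->
    invmx (H sD w x) *m H sU w x = 1%:M
}.

Definition diagonalizes (l : sing) (S T : sing -> C -> 'M[C]_n) (w : C) : Prop :=
  unipotent_at l (T l w) /\
  invmx (T l w) *m S l w *m Dmx l w *m T l w = Dmx l w.

(* Transition invariants: Nbar at w = bar-epsilon, Ntilde at the same w through
   tilde-epsilon = turn w. *)
Definition Nbar (T : sing -> C -> 'M[C]_n) (l : sing) (w : C) : 'M[C]_n :=
  match l with
  | pL => invmx (T pR w) *m T pL w
  | pR => Dmx pR w *m invmx (T pR w) *m T pL w *m invmx (Dmx pR w)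
  end.

Definition Ntilde (T : sing -> C -> 'M[C]_n) (l : sing) (w : C) : 'M[C]_n :=
  let w' := turn w in
  match l with
  | pL => Dmx pL w' *m invmx (T pL w') *m T pR w' *m invmx (Dmx pL w')
  | pR => invmx (T pL w') *m T pR w'
  end.

Definition auto_intersection_relation (gamma rho : R)
    (T : sing -> C -> 'M[C]_n) : Prop :=
  exists Q : side -> C -> 'M[C]_n,
    (forall s : side,
      [/\ forall w, capS gamma rho w ->
            [/\ is_diag_mx (Q s w), Q s w \in unitmx & analytic_at (Q s) w],
          exists2 Q0 : 'M[C]_n, Q0 \in unitmx &
            Q s w @[w --> eps_to0 (capS gamma rho)] --> Q0 &
          exists c : R, forall w, capS gamma rho w ->
            `|Q s w - 1%:M| < ofR c * `|eps w|]) /\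
    (forall w, capS gamma rho w ->
      Q sD w *m (Dmx pR w *m invmx (T pR w) *m T pL w *m invmx (Dmx pR w)) =
        invmx (T pL (turn w)) *m T pR (turn w) *m Q sU w /\
      forall l : sing, Q sD w *m Nbar T l w = Ntilde T l w *m Q sU w).

End Family.

(* Main.v *)
(* Write t for the time of x' = x^2 - eps. For eps in the auto-intersection the
   lines bounding the domains at bar-eps and at tilde-eps have slopes of opposite
   signs, and a polygonal path from t = - P/2 to t = P/2 crosses Omega_L of
   bar-eps and Omega_R of tilde-eps. Comparing along it the solutions
   W_s = H_s F_s shows that the connection matrix
   A = W_D(tilde, 0)^-1 W_D(bar, 0) satisfies
   A = C~_R D~_R A C_L D_L, and the opposite path gives C~_L D~_L A C_R D_R = A.
   As D~_R = D_L^-1 and D~_L = D_R^-1 have distinct entries, T~_R^-1 A T_L and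
   T~_L^-1 A T_R are diagonal; up to the factor D_R^-1 they are Q_U and Q_D.
   Moreover F_D(tilde, 0)^-1 G F_D(tilde, 0) = A D_R^-1, where
   G = H_D(tilde, 0)^-1 H_D(bar, 0) = I + O(eps), is upper * Q_U * lower and
   lower * Q_D * upper with unipotent triangular factors, so the entries of Q_U
   and Q_D are quotients of minors of G; this makes them analytic and close to 1.
   The minors of G are bounded away from 0 for all eps and not only for small
   ones because two transformations H differ by a diagonal factor at x = 0:
   the radius may therefore be chosen for a single H. *)
Require Import Defs.
From HB Require Import structures.
From mathcomp Require Import all_boot all_order all_algebra.
From mathcomp Require Import all_classical all_reals all_analysis.
From mathcomp.real_closed Require Import complex.
From mathcomp Require Import perm ring lra.

Set Implicit Arguments.
Unset Strict Implicit.
Unset Printing Implicit Defensive.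

Import Order.TTheory GRing.Theory Num.Theory.
Import numFieldNormedType.Exports.
Local Open Scope classical_set_scope.
Local Open Scope ring_scope.

(** * Complex numbers *)

(** The scale of the t-plane is 1/|sqrt eps|: after multiplication by sqrt eps the poles of x(t)
    become the integer multiples of pi i, and the slopes and distances that matter are bounded in
    terms of gamma alone. The paths therefore keep |sinh (sqrt eps t)| above a constant, |x(t)| is
    of order sqrt |eps| on them, and a small radius places them in the disc of radius r. The margin
    behind these bounds is 2 gamma^2 / pi, the least angle between sqrt eps e^{i theta} and the
    imaginary axis; its sine also limits c0. F_U is given only as the continuation of F_D through
    Omega_R, and analytic means complex differentiable near a point. Its values elsewhere therefore
    rest on an identity theorem, which is derived from Goursat's lemma, primitives and a maximum
    principle, without power series. At x = 0 the entries of F may be exponentially large or small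
    in 1/|sqrt eps|. They leave the estimates because F is diagonal there: conjugation by a diagonal
    matrix does not change principal minors. *)

Section ComplexNumbers.
Variable R : realType.
Notation C := (Cplx R).
Implicit Types (z w : C) (a b : R).

Lemma Cplx_eq z w : re z = re w -> im z = im w -> z = w.
Proof. by case: z w => [a b] [c d]; rewrite /re /im /= => -> ->. Qed.

Lemma reD z w : re (z + w) = re z + re w. Proof. by case: z w => [? ?] [? ?]. Qed.
Lemma imD z w : im (z + w) = im z + im w. Proof. by case: z w => [? ?] [? ?]. Qed.
Lemma reN z : re (- z) = - re z. Proof. by case: z. Qed.
Lemma imN z : im (- z) = - im z. Proof. by case: z. Qed.
Lemma reB z w : re (z - w) = re z - re w. Proof. by rewrite reD reN. Qed.
Lemma imB z w : im (z - w) = im z - im w. Proof. by rewrite imD imN. Qed.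
Lemma reM z w : re (z * w) = re z * re w - im z * im w.
Proof. by case: z w => [? ?] [? ?]. Qed.
Lemma imM z w : im (z * w) = re z * im w + im z * re w.
Proof. by case: z w => [? ?] [? ?]. Qed.
Lemma re_ofR a : re (ofR a) = a. Proof. by []. Qed.
Lemma im_ofR a : im (ofR a) = 0. Proof. by []. Qed.
Lemma re_iC : re (@iC R) = 0. Proof. by []. Qed.
Lemma im_iC : im (@iC R) = 1. Proof. by []. Qed.
Lemma re0 : re (0 : C) = 0. Proof. by []. Qed.
Lemma im0 : im (0 : C) = 0. Proof. by []. Qed.
Lemma re1 : re (1 : C) = 1. Proof. by []. Qed.
Lemma im1 : im (1 : C) = 0. Proof. by []. Qed.

Lemma ofRD a b : ofR (a + b) = ofR a + ofR b :> C.
Proof. by apply: Cplx_eq; rewrite ?reD ?imD ?re_ofR ?im_ofR ?addr0. Qed.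
Lemma ofRN a : ofR (- a) = - ofR a :> C.
Proof. by apply: Cplx_eq; rewrite ?reN ?imN ?re_ofR ?im_ofR ?oppr0. Qed.
Lemma ofRB a b : ofR (a - b) = ofR a - ofR b :> C.
Proof. by rewrite ofRD ofRN. Qed.
Lemma ofRM a b : ofR (a * b) = ofR a * ofR b :> C.
Proof.
by apply: Cplx_eq; rewrite ?reM ?imM ?re_ofR ?im_ofR ?mulr0 ?mul0r ?subr0 ?addr0.
Qed.
Lemma ofR0 : ofR 0 = 0 :> C. Proof. by []. Qed.
Lemma ofR1 : ofR 1 = 1 :> C. Proof. by []. Qed.
Lemma ofR_nat n : ofR n%:R = n%:R :> C.
Proof. by elim: n => // n IH; rewrite -addn1 !natrD ofRD IH. Qed.
Lemma ofR_le a b : (ofR a <= ofR b :> C) = (a <= b).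
Proof. by rewrite /ofR lecE /= eqxx. Qed.
Lemma ofR_lt a b : (ofR a < ofR b :> C) = (a < b).
Proof. by rewrite /ofR ltcE /= eqxx. Qed.
Lemma ofR_eq a b : (ofR a == ofR b :> C) = (a == b).
Proof. by rewrite eq_le !ofR_le -eq_le. Qed.
Lemma ofR_eq0 a : (ofR a == 0 :> C) = (a == 0).
Proof. exact: ofR_eq. Qed.
Lemma ofRV a : ofR a^-1 = (ofR a)^-1 :> C.
Proof.
have [->|a0] := eqVneq a 0; first by rewrite invr0 ofR0 invr0.
have a0' : ofR a != 0 :> C by rewrite ofR_eq0.
by apply: (mulfI a0'); rewrite -ofRM !divff.
Qed.
Lemma iC2 : iC * iC = -1 :> C.
Proof. by apply: Cplx_eq; rewrite ?reM ?imM ?reN ?imN ?re_iC ?im_iC ?re1 ?im1; ring. Qed.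
Lemma Cplx_rect z : z = ofR (re z) + ofR (im z) * iC.
Proof.
by apply: Cplx_eq; rewrite ?reD ?imD ?reM ?imM ?re_ofR ?im_ofR ?re_iC ?im_iC; ring.
Qed.
Lemma reMofR a z : re (ofR a * z) = a * re z.
Proof. by rewrite reM re_ofR im_ofR; ring. Qed.
Lemma imMofR a z : im (ofR a * z) = a * im z.
Proof. by rewrite imM re_ofR im_ofR; ring. Qed.

(** The modulus [|z|] is itself an element of C; as a real number it is open to linear arithmetic
    and to the order of R. *)
Definition nm z : R := Num.sqrt (re z ^+ 2 + im z ^+ 2).

Lemma norm_nm z : `|z| = ofR (nm z). Proof. exact: normc_def. Qed.
Lemma nm_ge0 z : 0 <= nm z. Proof. exact: sqrtr_ge0. Qed.
Lemma nm2 z : nm z ^+ 2 = re z ^+ 2 + im z ^+ 2.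
Proof. by rewrite sqr_sqrtr // addr_ge0 // sqr_ge0. Qed.
Lemma nmM z w : nm (z * w) = nm z * nm w.
Proof.
have /eqP : `|z * w| = `|z| * `|w| by rewrite normrM.
by rewrite !norm_nm -ofRM ofR_eq => /eqP.
Qed.
Lemma nmD z w : nm (z + w) <= nm z + nm w.
Proof. by have := ler_normD z w; rewrite !norm_nm -ofRD ofR_le. Qed.
Lemma nmN z : nm (- z) = nm z.
Proof. by rewrite /nm reN imN !sqrrN. Qed.
Lemma nmB z w : nm (z - w) <= nm z + nm w.
Proof. by apply: le_trans (nmD _ _) _; rewrite nmN. Qed.
Lemma nm_eq0 z : (nm z == 0) = (z == 0).
Proof. by rewrite -ofR_eq0 -norm_nm normr_eq0. Qed.
Lemma nm0 : nm 0 = 0. Proof. by apply/eqP; rewrite nm_eq0. Qed.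
Lemma nm_gt0 z : (0 < nm z) = (z != 0).
Proof. by rewrite lt0r nm_eq0 nm_ge0 andbT. Qed.
Lemma nm_ofR a : nm (ofR a) = `|a|.
Proof. by rewrite /nm re_ofR im_ofR expr0n /= addr0 sqrtr_sqr. Qed.
Lemma nm1 : nm 1 = 1. Proof. by rewrite -ofR1 nm_ofR normr1. Qed.
Lemma nmX z n : nm (z ^+ n) = nm z ^+ n.
Proof. by elim: n => [|n IH]; rewrite ?expr0 ?nm1 // !exprS nmM IH. Qed.
Lemma nmV z : nm z^-1 = (nm z)^-1.
Proof.
have [->|z0] := eqVneq z 0; first by rewrite invr0 nm0 invr0.
have z0' : nm z != 0 by rewrite nm_eq0.
by apply: (mulfI z0'); rewrite -nmM !divff ?nm1.
Qed.
Lemma re_nm z : `|re z| <= nm z.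
Proof. by rewrite -sqrtr_sqr ler_wsqrtr // lerDl sqr_ge0. Qed.
Lemma im_nm z : `|im z| <= nm z.
Proof. by rewrite -sqrtr_sqr ler_wsqrtr // lerDr sqr_ge0. Qed.
Lemma nm_iC : nm iC = 1.
Proof. by rewrite /nm re_iC im_iC expr0n expr1n add0r sqrtr1. Qed.
Lemma nm_le z : nm z <= `|re z| + `|im z|.
Proof.
by rewrite {1}(Cplx_rect z); apply: le_trans (nmD _ _) _; rewrite nmM nm_iC mulr1 !nm_ofR.
Qed.
Lemma nmC z w : nm (z - w) = nm (w - z).
Proof. by rewrite -nmN opprB. Qed.
Lemma nmBl z w : nm z - nm w <= nm (z - w).
Proof. by rewrite lerBlDr; apply: le_trans (nmD _ _); rewrite subrK. Qed.

Lemma cexpD z w : cexp (z + w) = cexp z * cexp w.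
Proof.
apply: Cplx_eq; rewrite ?reM ?imM /cexp /re /im /=; case: z w => [a b] [c d] /=.
- by rewrite expRD cosD; ring.
- by rewrite expRD sinD; ring.
Qed.
Lemma re_cexp z : re (cexp z) = expR (re z) * cos (im z). Proof. by []. Qed.
Lemma im_cexp z : im (cexp z) = expR (re z) * sin (im z). Proof. by []. Qed.
Lemma cexp0 : cexp 0 = 1 :> C.
Proof.
by apply: Cplx_eq; rewrite ?re_cexp ?im_cexp re0 im0 expR0 ?cos0 ?sin0 ?mulr1 ?mulr0.
Qed.
Lemma nm_cexp z : nm (cexp z) = expR (re z).
Proof.
rewrite /nm re_cexp im_cexp !exprMn -mulrDr cos2Dsin2 mulr1 sqrtr_sqr ger0_norm //.
Qed.
Lemma cexp_neq0 z : cexp z != 0.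
Proof. by rewrite -nm_eq0 nm_cexp gt_eqF // expR_gt0. Qed.
Lemma cexpN z : cexp (- z) = (cexp z)^-1.
Proof.
by apply: (mulfI (cexp_neq0 z)); rewrite -cexpD subrr cexp0 divff // cexp_neq0.
Qed.
Lemma cexpB z w : cexp (z - w) = cexp z / cexp w.
Proof. by rewrite cexpD cexpN. Qed.
Lemma cexp_ofR a : cexp (ofR a) = ofR (expR a).
Proof.
by apply: Cplx_eq; rewrite ?re_cexp ?im_cexp ?re_ofR ?im_ofR ?cos0 ?sin0 ?mulr1 ?mulr0.
Qed.
Lemma cexp_pi : cexp (ofR pi * iC) = -1 :> C.
Proof.
apply: Cplx_eq; rewrite ?re_cexp ?im_cexp ?reM ?imM ?re_ofR ?im_ofR ?re_iC ?im_iC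
  ?reN ?imN ?re1 ?im1 ?mulr0 ?mulr1 ?mul0r ?subr0 ?addr0 expR0 mul1r ?cospi ?sinpi //.
by rewrite oppr0.
Qed.
Lemma cexp_2pi : cexp (ofR (2 * pi) * iC) = 1 :> C.
Proof.
have -> : ofR (2 * pi) * iC = ofR pi * iC + ofR pi * iC :> C by rewrite ofRM ofR_nat; ring.
by rewrite cexpD cexp_pi mulrNN mulr1.
Qed.

End ComplexNumbers.

(** * Complex limits, derivatives and mean value inequalities *)

Section Derivatives.
Variable R : realType.
Notation C := (Cplx R).
Implicit Types (z w : C) (a b : R).

#[global] Instance Cplx_nbhs_filter (z : C) : ProperFilter (nbhs z) := nbhs_pfilter z.
#[global] Instance Cplx_dnbhs_filter (z : C) : ProperFilter (dnbhs z) := Proper_dnbhs_numFieldType z.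

Lemma ofR_re_gt0 (e : C) : 0 < e -> e = ofR (re e) /\ 0 < re e.
Proof.
case: e => a b; rewrite ltcE /= => /andP[/eqP b0 a0]; split => //.
by rewrite b0.
Qed.

Lemma near_nmP z (P : set C) :
  (\forall u \near z, P u) <-> exists2 r : R, 0 < r & forall u, nm (u - z) < r -> P u.
Proof.
rewrite -nbhs_nearE; split => [/nbhs_ballP[e /= e0 he]|[r r0 hr]].
  have [ee re0] := ofR_re_gt0 e0; exists (re e) => // u hu; apply: he.
  by rewrite /ball /= ee norm_nm ofR_lt nmC.
apply/nbhs_ballP; exists (ofR r) => /=; first by rewrite -ofR0 ofR_lt.
by move=> u; rewrite /ball /= norm_nm ofR_lt nmC => /hr.
Qed.

Lemma cvg_nmP (T : Type) (F : set_system T) (FF : Filter F) (f : T -> C) (l : C) :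
  f x @[x --> F] --> l <-> forall e : R, 0 < e -> \forall x \near F, nm (f x - l) < e.
Proof.
rewrite cvgrPdist_lt; split => h e e0.
  have := h (ofR e); rewrite -ofR0 ofR_lt => /(_ e0).
  by apply: filterS => x; rewrite norm_nm ofR_lt nmC.
have [ee re0] := ofR_re_gt0 e0; move: (h _ re0).
by apply: filterS => x; rewrite norm_nm nmC {2}ee ofR_lt.
Qed.

Section Limits.
Variables (T : Type) (F : set_system T).
(* An inductive wrapper rather than a definition: otherwise failing
   unification problems unfold the filters involved and diverge. *)
Variant clim (f : T -> C) (l : C) : Prop := Clim of f x @[x --> F] --> l.

Context {FF : Filter F}.
Implicit Types f g : T -> C.
Lemma clim_cst c : clim (fun _ => c) c.
Proof. by split; exact: cvg_cst. Qed.
Lemma climD f g (a b : C) : clim f a -> clim g b -> clim (fun x => f x + g x) (a + b).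
Proof. by move=> [ha] [hb]; split; exact: (cvgD ha hb). Qed.
Lemma climN f (a : C) : clim f a -> clim (fun x => - f x) (- a).
Proof. by move=> [ha]; split; exact: (cvgN ha). Qed.
Lemma climM f g (a b : C) : clim f a -> clim g b -> clim (fun x => f x * g x) (a * b).
Proof. by move=> [ha] [hb]; split; exact: (cvgM ha hb). Qed.
Lemma climV f (a : C) : a != 0 -> clim f a -> clim (fun x => (f x)^-1) a^-1.
Proof. by move=> a0 [ha]; split; exact: (cvgV a0 ha). Qed.
Lemma clim_sum (I : Type) (r : seq I) (P : pred I) (h : I -> T -> C) (l : I -> C) :
  (forall i, P i -> clim (h i) (l i)) ->
  clim (fun x => \sum_(i <- r | P i) h i x) (\sum_(i <- r | P i) l i).
Proof.
move=> H; elim: r => [|i r IH].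
  rewrite big_nil; under eq_fun do rewrite big_nil; exact: clim_cst.
rewrite big_cons; under eq_fun do rewrite big_cons.
by case: ifP => Pi; [exact: (climD (H _ Pi) IH)|exact: IH].
Qed.
Lemma clim_prod (I : Type) (r : seq I) (P : pred I) (h : I -> T -> C) (l : I -> C) :
  (forall i, P i -> clim (h i) (l i)) ->
  clim (fun x => \prod_(i <- r | P i) h i x) (\prod_(i <- r | P i) l i).
Proof.
move=> H; elim: r => [|i r IH].
  rewrite big_nil; under eq_fun do rewrite big_nil; exact: clim_cst.
rewrite big_cons; under eq_fun do rewrite big_cons.
by case: ifP => Pi; [exact: (climM (H _ Pi) IH)|exact: IH].
Qed.
End Limits.

Variant ccont (f : C -> C) z : Prop := Ccont of clim (nbhs z) f (f z).

Lemma ccontP f z : ccont f z <-> forall e : R, 0 < e ->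
  exists2 r : R, 0 < r & forall u, nm (u - z) < r -> nm (f u - f z) < e.
Proof.
have H := @cvg_nmP C (nbhs z) (nbhs_filter z) f (f z).
split=> [[[h]] e e0|h].
  by move: h => /H /(_ _ e0) /near_nmP.
by split; split; apply/H => e /h hr; exact/near_nmP.
Qed.

Lemma ccont_cst c z : ccont (fun _ => c) z.
Proof. by split; exact: clim_cst. Qed.
Lemma ccont_id z : ccont (fun u => u) z.
Proof. by apply/ccontP => e e0; exists e. Qed.
Lemma ccontD f g z : ccont f z -> ccont g z -> ccont (fun u => f u + g u) z.
Proof. by move=> [cf] [cg]; split; exact: (climD cf cg). Qed.
Lemma ccontN f z : ccont f z -> ccont (fun u => - f u) z.
Proof. by move=> [cf]; split; exact: (climN cf). Qed.
Lemma ccontB f g z : ccont f z -> ccont g z -> ccont (fun u => f u - g u) z.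
Proof. by move=> cf cg; exact: (ccontD cf (ccontN cg)). Qed.
Lemma ccontM f g z : ccont f z -> ccont g z -> ccont (fun u => f u * g u) z.
Proof. by move=> [cf] [cg]; split; exact: (climM cf cg). Qed.
Lemma ccontV f z : f z != 0 -> ccont f z -> ccont (fun u => (f u)^-1) z.
Proof. by move=> z0 [cf]; split; exact: (climV z0 cf). Qed.
Lemma ccont_comp f g z : ccont g z -> ccont f (g z) -> ccont (fun u => f (g u)) z.
Proof.
move=> /ccontP cg /ccontP cf; apply/ccontP => e /cf[r r0 hr].
by have [s s0 hs] := cg _ r0; exists s => // u /hs /hr.
Qed.

(* Caratheodory's form of complex differentiability. *)
Variant cderiv (f : C -> C) z (d : C) : Prop := Cderiv (phi : C -> C) of
  ccont phi z & phi z = d & forall u, f u - f z = phi u * (u - z).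

Lemma cderivP f z d : cderiv f z d <-> forall e : R, 0 < e ->
  exists2 r : R, 0 < r & forall u, nm (u - z) < r ->
    nm (f u - f z - d * (u - z)) <= e * nm (u - z).
Proof.
split.
  move=> [phi /ccontP cphi phiz h] e e0; have [r r0 hr] := cphi _ e0.
  exists r => // u hu; rewrite h -phiz -mulrBl nmM ler_wpM2r ?nm_ge0 //.
  exact/ltW/hr.
move=> h; apply: (@Cderiv _ _ _ (fun u => if u == z then d else (f u - f z) / (u - z))).
- apply/ccontP => e e0; rewrite eqxx.
  have e20 : 0 < e / 2 by rewrite divr_gt0.
  have [r r0 hr] := h _ e20; exists r => // u hu.
  case: eqVneq => [_|uz]; first by rewrite subrr nm0.
  have uz0 : u - z != 0 by rewrite subr_eq0.
  have n0 : 0 < nm (u - z) by rewrite nm_gt0.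
  rewrite -(ltr_pM2r n0) -nmM mulrBl divfK //.
  by apply: le_lt_trans (hr _ hu) _; rewrite ltr_pM2r // ltr_pdivrMr // ltr_pMr // ltr1n.
- by rewrite eqxx.
- move=> u; case: eqVneq => [->|uz]; first by rewrite !subrr mulr0.
  by rewrite divfK // subr_eq0.
Qed.

Lemma cderiv_ccont f z d : cderiv f z d -> ccont f z.
Proof.
move=> [phi cphi phiz h].
have -> : f = (fun u => f z + phi u * (u - z)).
  by apply/funext => u; rewrite -h addrC subrK.
apply: ccontD; first exact: ccont_cst.
apply: ccontM => //; apply: ccontB; [exact: ccont_id|exact: ccont_cst].
Qed.

Lemma cderiv_unique f z d d' : cderiv f z d -> cderiv f z d' -> d = d'.
Proof.
move=> /cderivP h /cderivP h'; apply/eqP; rewrite -subr_eq0 -nm_eq0.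
rewrite eq_le nm_ge0 andbT; apply/ler_addgt0Pr => e e0; rewrite add0r.
have e20 : 0 < e / 2 by rewrite divr_gt0.
have [r r0 hr] := h _ e20; have [s s0 hs] := h' _ e20.
pose t := Num.min r s / 2.
have m0 : 0 < Num.min r s by rewrite lt_min r0.
have t0 : 0 < t by rewrite divr_gt0.
have tm : t < Num.min r s by rewrite /t ltr_pdivrMr // ltr_pMr // ltr1n.
have nt : nm (z + ofR t - z) = t by rewrite addrC addKr nm_ofR gtr0_norm.
have /hr hr1 : nm (z + ofR t - z) < r by rewrite nt; move: tm; rewrite lt_min => /andP[].
have /hs hs1 : nm (z + ofR t - z) < s by rewrite nt; move: tm; rewrite lt_min => /andP[].
rewrite nt in hr1 hs1; rewrite -(ler_pM2r t0) -{1}nt -nmM.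
have -> : (d - d') * (z + ofR t - z) =
  (f (z + ofR t) - f z - d' * (z + ofR t - z)) - (f (z + ofR t) - f z - d * (z + ofR t - z)).
  by ring.
by apply: le_trans (nmB _ _) _; apply: le_trans (lerD hs1 hr1) _; lra.
Qed.

Lemma derivable_cderiv (f : C -> C) z : derivable f z 1 -> cderiv f z ('D_1 f z).
Proof.
move=> /cvg_ex[l hl].
have -> : 'D_1 f z = l by apply: cvg_lim.
apply: (@Cderiv _ _ _ (fun u => if u == z then l else (f u - f z) / (u - z))).
- apply/ccontP => e e0; rewrite eqxx.
  move/cvg_nmP: hl => /(_ _ e0); rewrite near_withinE => /near_nmP[r r0 hr].
  exists r => // u hu; case: eqVneq => [_|uz]; first by rewrite subrr nm0.
  have := hr (u - z); rewrite subr0 => /(_ hu); rewrite subr_eq0 => /(_ uz) /=.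
  by rewrite /GRing.scale /= mulr1 subrK mulrC.
- by rewrite eqxx.
- move=> u; case: eqVneq => [->|uz]; first by rewrite !subrr mulr0.
  by rewrite divfK // subr_eq0.
Qed.

Lemma cderiv_cvg f z d : cderiv f z d ->
  h^-1 *: ((f \o shift z) (h *: (1 : C)) - f z) @[h --> 0^'] --> d.
Proof.
move=> [phi /ccontP cphi phiz h]; apply/cvg_nmP => e e0.
have [r r0 hr] := cphi _ e0; rewrite near_withinE; apply/near_nmP.
exists r => // u; rewrite subr0 => hu u0 /=.
rewrite h addrK /GRing.scale /= mulr1 mulrCA mulVf // mulr1 -phiz; apply: hr.
by rewrite addrK.
Qed.

Lemma cderiv_derivable f z d : cderiv f z d -> derivable f z 1.
Proof. by move=> /cderiv_cvg h; apply/cvg_ex; exists d. Qed.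

Lemma cderiv_near f g z d : (\forall u \near z, f u = g u) -> cderiv f z d -> cderiv g z d.
Proof.
move=> /near_nmP[r r0 hr] /cderivP h; apply/cderivP => e e0.
have [s s0 hs] := h _ e0; exists (Num.min r s); first by rewrite lt_min r0.
move=> u; rewrite lt_min => /andP[ur us]; rewrite -!hr ?subrr ?nm0 //; exact: hs.
Qed.

Lemma cderiv_cst c z : cderiv (fun _ => c) z 0.
Proof.
apply: (@Cderiv _ _ _ (fun _ => 0)) => //; first exact: ccont_cst.
by move=> u; rewrite subrr mul0r.
Qed.
Lemma cderiv_id z : cderiv (fun u => u) z 1.
Proof.
apply: (@Cderiv _ _ _ (fun _ => 1)) => //; first exact: ccont_cst.
by move=> u; rewrite mul1r.
Qed.
Lemma cderivD f g z d e : cderiv f z d -> cderiv g z e ->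
  cderiv (fun u => f u + g u) z (d + e).
Proof.
move=> [p cp pz hp] [q cq qz hq]; apply: (@Cderiv _ _ _ (fun u => p u + q u)).
- exact: ccontD.
- by rewrite pz qz.
- by move=> u; rewrite mulrDl -hp -hq; ring.
Qed.
Lemma cderivM f g z d e : cderiv f z d -> cderiv g z e ->
  cderiv (fun u => f u * g u) z (d * g z + f z * e).
Proof.
move=> [p cp pz hp] hg; have cg := cderiv_ccont hg.
move: hg => [q cq qz hq]; apply: (@Cderiv _ _ _ (fun u => p u * g u + f z * q u)).
- by apply: ccontD; apply: ccontM => //; exact: ccont_cst.
- by rewrite pz qz.
- by move=> u; rewrite mulrDl mulrAC -hp -mulrA -hq; ring.
Qed.
Lemma cderivZ c f z d : cderiv f z d -> cderiv (fun u => c * f u) z (c * d).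
Proof. by move=> h; have := cderivM (cderiv_cst c z) h; rewrite mul0r add0r. Qed.
Lemma cderivN f z d : cderiv f z d -> cderiv (fun u => - f u) z (- d).
Proof.
move=> /(cderivZ (-1)); rewrite mulN1r.
by under eq_fun do rewrite mulN1r.
Qed.
Lemma cderivB f g z d e : cderiv f z d -> cderiv g z e ->
  cderiv (fun u => f u - g u) z (d - e).
Proof. by move=> hf /cderivN; exact: cderivD. Qed.
Lemma cderivV f z d : f z != 0 -> cderiv f z d ->
  cderiv (fun u => (f u)^-1) z (- d / f z ^+ 2).
Proof.
move=> fz hf; have cf := cderiv_ccont hf; move/cderivP: (hf) => hf'.
move: hf => [p cp pz hp].
have cq : ccont (fun u => - p u / (f u * f z)) z.
  apply: ccontM; first exact: ccontN.
  by apply: ccontV; rewrite ?mulf_neq0 //; apply: ccontM => //; exact: ccont_cst.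
have := cq => /ccontP cq'.
have near0 : \forall u \near z, f u != 0.
  have := cf => /ccontP /(_ (nm (f z))); rewrite nm_gt0 => /(_ fz) [r r0 hr].
  apply/near_nmP; exists r => // u /hr; apply: contraTneq => ->.
  by rewrite sub0r nmN ltxx.
(* Caratheodory's identity has to hold for every u. Where f vanishes the inverse is replaced by the
   value that the identity prescribes; near z this changes nothing. *)
apply: (@cderiv_near (fun u => if f u == 0 then (f z)^-1 - p u / (f u * f z) * (u - z) else (f u)^-1)).
  by move: near0; apply: filterS => u /negPf ->.
apply: (@Cderiv _ _ _ (fun u => - p u / (f u * f z))) => //.
- by rewrite pz expr2.
- move=> u; rewrite (negPf fz); case: eqVneq => [_|fu]; first by ring.
  have -> : - p u / (f u * f z) * (u - z) = - (p u * (u - z)) / (f u * f z) by ring.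
  by rewrite -hp; field; rewrite ?fu ?fz.
Qed.
Lemma cderiv_div f g z d e : g z != 0 -> cderiv f z d -> cderiv g z e ->
  cderiv (fun u => f u / g u) z (d / g z - f z * e / g z ^+ 2).
Proof.
move=> gz hf hg; have := cderivM hf (cderivV gz hg).
by rewrite mulNr mulrN mulrA.
Qed.
Lemma cderiv_comp f g z d e : cderiv g z e -> cderiv f (g z) d ->
  cderiv (fun u => f (g u)) z (d * e).
Proof.
move=> hg; have cg := cderiv_ccont hg; move: hg => [q cq qz hq] [p cp pz hp].
apply: (@Cderiv _ _ _ (fun u => p (g u) * q u)).
- by apply: ccontM => //; apply: ccont_comp.
- by rewrite pz qz.
- by move=> u; rewrite -mulrA -hq -hp.
Qed.
Lemma cderiv_sum (I : Type) (r : seq I) (P : pred I) (f : I -> C -> C) (d : I -> C) z :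
  (forall i, P i -> cderiv (f i) z (d i)) ->
  cderiv (fun u => \sum_(i <- r | P i) f i u) z (\sum_(i <- r | P i) d i).
Proof.
move=> h; elim: r => [|i r IH].
  rewrite big_nil; under eq_fun do rewrite big_nil; exact: cderiv_cst.
rewrite big_cons; under eq_fun do rewrite big_cons.
by case: ifP => Pi; [exact: (cderivD (h _ Pi) IH)|exact: IH].
Qed.
Lemma cderiv_prod (I : Type) (r : seq I) (P : pred I) (f : I -> C -> C) z :
  (forall i, P i -> exists d, cderiv (f i) z d) ->
  exists d, cderiv (fun u => \prod_(i <- r | P i) f i u) z d.
Proof.
move=> h; elim: r => [|i r [d IH]].
  by exists 0; under eq_fun do rewrite big_nil; exact: cderiv_cst.
case Pi: (P i); last by exists d; under eq_fun do rewrite big_cons Pi; exact: IH.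
have [e he] := h _ Pi; exists (e * \prod_(j <- r | P j) f j z + f i z * d).
by under eq_fun do rewrite big_cons Pi; exact: (cderivM he IH).
Qed.

Lemma is_derive_real (f : R -> R) (x d : R) :
  (forall e, 0 < e -> exists2 r, 0 < r & forall h, `|h| < r ->
     `|f (x + h) - f x - d * h| <= e * `|h|) -> is_derive x 1 f d.
Proof.
move=> H.
have hc : h^-1 *: ((f \o shift x) (h *: (1 : R)) - f x) @[h --> 0^'] --> d.
  apply/cvgrPdist_le => e e0; have [r r0 hr] := H _ e0.
  rewrite near_withinE; apply/nbhs_ballP; exists r => //= h.
  rewrite /ball /= sub0r normrN => /hr hh h0.
  rewrite /GRing.scale /= mulr1 [h + x]addrC.
  have h0' : 0 < `|h| by rewrite normr_gt0.
  have E : (d - h^-1 * (f (x + h) - f x)) * h = - (f (x + h) - f x - d * h).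
    by rewrite mulrBl [h^-1 * _]mulrC divfK //; ring.
  by rewrite -(ler_pM2r h0') -normrM E normrN.
by apply: DeriveDef; [apply/cvg_ex; exists d|exact: cvg_lim].
Qed.

Lemma real_of_cderiv (f : C -> C) (p v : C) (s : R) (d : C) :
  cderiv f (p + ofR s * v) d ->
  is_derive s 1 (fun t : R => re (f (p + ofR t * v))) (re (d * v)) /\
  is_derive s 1 (fun t : R => im (f (p + ofR t * v))) (im (d * v)).
Proof.
move=> h; have h1 : cderiv (fun u => f (p + u * v)) (ofR s) (d * v).
  apply: (cderiv_comp (e := v)) => //.
  have := cderivD (cderiv_cst p (ofR s)) (cderivM (cderiv_id (ofR s)) (cderiv_cst v (ofR s))).
  by rewrite mulr0 addr0 mul1r add0r.
move/cderivP: h1 => h1; split; apply: is_derive_real => e e0.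
  have [r r0 hr] := h1 _ e0; exists r => // h0 hh.
  have := hr (ofR (s + h0)); rewrite -ofRB [s + h0]addrC addrK nm_ofR => /(_ hh).
  by move/(le_trans (re_nm _)); rewrite !reB [d * v * _]mulrC reMofR [h0 * _]mulrC.
have [r r0 hr] := h1 _ e0; exists r => // h0 hh.
have := hr (ofR (s + h0)); rewrite -ofRB [s + h0]addrC addrK nm_ofR => /(_ hh).
by move/(le_trans (im_nm _)); rewrite !imB [d * v * _]mulrC imMofR [h0 * _]mulrC.
Qed.

Lemma is_derive_within (f df : R -> R) (a b : R) :
  (forall s, a <= s <= b -> is_derive s 1 f (df s)) -> {within `[a, b], continuous f}.
Proof.
move=> h; apply: derivable_within_continuous => s; rewrite in_itv /= => hs.
by have [] := h s hs.
Qed.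

Definition rderiv (Phi : R -> C) (s : R) (d : C) :=
  is_derive s 1 (fun t => re (Phi t)) (re d) /\ is_derive s 1 (fun t => im (Phi t)) (im d).

(** The real mean value theorem is applied to the real and to the imaginary part, at two different
    points; this is the origin of the factor 2. *)
Lemma rmvt (Phi D : R -> C) (c : C) (M : R) :
  (forall s : R, 0 <= s <= 1 -> rderiv Phi s (D s)) ->
  (forall s : R, 0 <= s <= 1 -> nm (D s - c) <= M) ->
  nm (Phi 1 - Phi 0 - c) <= 2 * M.
Proof.
move=> hd hM.
have mv (f df : R -> R) : (forall s : R, 0 <= s <= 1 -> is_derive s 1 f (df s)) ->
    exists2 s, 0 <= s <= 1 & f 1 - f 0 = df s.
  move=> h; have [|s] := @MVT_segment R f df 0 1 ler01 _ (is_derive_within h).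
    by move=> x; rewrite in_itv /= => /andP[x0 x1]; apply: h; rewrite !ltW.
  by rewrite in_itv /= subr0 mulr1; exists s.
have [s1 hs1 e1] := mv _ _ (fun s hs => (hd s hs).1).
have [s2 hs2 e2] := mv _ _ (fun s hs => (hd s hs).2).
apply: le_trans (nm_le _) _; rewrite !reB !imB e1 e2 -reB -imB.
have := le_trans (re_nm _) (hM _ hs1); have := le_trans (im_nm _) (hM _ hs2); lra.
Qed.

Lemma cmvt (f : C -> C) (d : R -> C) (p v c : C) (M : R) :
  (forall s : R, 0 <= s <= 1 -> cderiv f (p + ofR s * v) (d s)) ->
  (forall s : R, 0 <= s <= 1 -> nm (d s - c) <= M) ->
  nm (f (p + v) - f p - c * v) <= 2 * M * nm v.
Proof.
move=> hd hM; rewrite -mulrA.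
have := @rmvt (fun s => f (p + ofR s * v)) (fun s => d s * v) (c * v) (M * nm v).
rewrite ofR1 ofR0 mul1r mul0r addr0; apply=> s hs.
  exact: real_of_cderiv (hd _ hs).
by rewrite -mulrBl nmM ler_wpM2r ?nm_ge0 ?hM.
Qed.

Lemma cderiv0_const (f : C -> C) (p v : C) :
  (forall s, 0 <= s <= 1 -> cderiv f (p + ofR s * v) 0) -> f (p + v) = f p.
Proof.
move=> h; have h0 (s : R) : 0 <= s <= 1 -> nm (0 - 0 : C) <= 0.
  by move=> _; rewrite subr0 nm0.
have := cmvt h h0; rewrite mulr0 !mul0r subr0 => h1.
by apply/eqP; rewrite -subr_eq0 -nm_eq0 eq_le nm_ge0 h1.
Qed.

End Derivatives.

(** * Goursat's lemma and the identity theorem *)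

Section Goursat.
Variable R : realType.
Notation C := (Cplx R).
Implicit Types (z w : C) (a b c : C) (f g : C -> C).

Lemma real_primitive (g : R -> R) : continuous g ->
  exists Phi : R -> R, forall s : R, 0 <= s <= 1 -> is_derive s 1 Phi (g s).
Proof.
move=> cg; exists (fun x => \int[lebesgue_measure]_(t in `[-1, x]) g t).
move=> s /andP[s0 s1].
have s2 : s < 2 by apply: le_lt_trans s1 _; rewrite ltr1n.
have m1 : (BLeft (-1 : R) < BRight s)%O by rewrite bnd_simp; lra.
have ig : lebesgue_measure.-integrable `[-1, (2 : R)] (EFin \o g).
  apply: continuous_compact_integrable; first exact: segment_compact.
  by apply: continuous_subspaceT => x; exact: cg.
have [||d e] := @continuous_FTC1 R g (BLeft (-1)) s 2 s2 ig.
- by rewrite /= lte_fin; lra.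
- exact: cg.
by apply: DeriveDef; [exact: d|rewrite -derive1E; exact: e].
Qed.

Lemma rderiv_affine (Phi : R -> C) (al be s : R) d :
  rderiv Phi (al * s + be) d -> rderiv (fun t => Phi (al * t + be)) s (ofR al * d).
Proof.
move=> [h1 h2].
have ha : is_derive s 1 (fun t : R => al * t + be) al.
  apply: is_derive_real => e e0; exists 1 => // h _.
  by rewrite (_ : _ - _ - _ = 0) ?normr0 ?mulr_ge0 // ?ltW //; ring.
split; rewrite ?reMofR ?imMofR mulrC.
  exact: (@is_derive1_comp R (fun u => re (Phi u)) (fun t => al * t + be) s _ _ h1 ha).
exact: (@is_derive1_comp R (fun u => im (Phi u)) (fun t => al * t + be) s _ _ h2 ha).
Qed.

(** The integral of f along the segment from a to b, encoded as the increment of a primitive of the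
    pulled-back integrand. Differences, reversal and bisection of paths then reduce to rules for
    derivatives. *)
Variant segint f a b (v : C) : Prop := Segint (Phi : R -> C) of
  (forall s, 0 <= s <= 1 -> rderiv Phi s (f (a + ofR s * (b - a)) * (b - a)))
  & v = Phi 1 - Phi 0.

Lemma segint_exists f a b : (forall s, 0 <= s <= 1 -> ccont f (a + ofR s * (b - a))) ->
  exists v, segint f a b v.
Proof.
move=> cf.
(* f is continuous only on the segment; clamping the parameter to [0, 1] gives an integrand that is
   continuous on all of R. *)
pose cl (s : R) := Num.max 0 (Num.min 1 s).
have cl01 s : 0 <= cl s <= 1 by rewrite /cl le_max lexx /= ge_max ler01 ge_min lexx.
have clE s : 0 <= s <= 1 -> cl s = s.
  by move=> /andP[s0 s1]; rewrite /cl (min_idPr s1) (max_idPr s0).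
have cl_lip (s t : R) : `|cl s - cl t| <= `|s - t|.
  have n1 := ler_norm (s - t); have n2 := ler_norm (t - s); rewrite distrC in n2.
  rewrite /cl !minEle !maxEle ler_norml.
  by case: (leP 1 s) => ?; case: (leP 1 t) => ?; rewrite ?ler01;
    case: (leP 0 s) => ?; case: (leP 0 t) => ?; apply/andP; split; lra.
pose h s := f (a + ofR (cl s) * (b - a)) * (b - a).
have ch (s : R) : forall e, 0 < e -> exists2 r, 0 < r & forall t, `|s - t| < r -> nm (h s - h t) < e.
  move=> e e0; have := ccontM (cf _ (cl01 s)) (ccont_cst (b - a) _).
  move=> /ccontP /(_ _ e0) [r r0 hr]; pose K := nm (b - a) + 1.
  have K0 : 0 < K by rewrite ltr_wpDl ?nm_ge0.
  exists (r / K); first by rewrite divr_gt0.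
  move=> t ht; rewrite nmC; apply: hr.
  rewrite (_ : _ - _ = ofR (cl t - cl s) * (b - a)); last by rewrite ofRB; ring.
  rewrite nmM nm_ofR distrC.
  apply: le_lt_trans (_ : `|s - t| * K < r); last by rewrite -ltr_pdivlMr.
  by apply: ler_pM; rewrite ?nm_ge0 // /K lerDl.
have cre : continuous (fun s => re (h s) : R).
  move=> s; apply/cvgrPdist_lt => e /(ch s)[r r0 hr].
  apply/nbhs_ballP; exists r => // t /hr; rewrite -reB.
  by apply: le_lt_trans; exact: re_nm.
have cim : continuous (fun s => im (h s) : R).
  move=> s; apply/cvgrPdist_lt => e /(ch s)[r r0 hr].
  apply/nbhs_ballP; exists r => // t /hr; rewrite -imB.
  by apply: le_lt_trans; exact: im_nm.
have [P1 hP1] := real_primitive cre; have [P2 hP2] := real_primitive cim.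
pose Phi s : C := ofR (P1 s) + ofR (P2 s) * iC.
have rePhi s : re (Phi s) = P1 s by rewrite reD reMofR re_iC mulr0 addr0.
have imPhi s : im (Phi s) = P2 s by rewrite imD imMofR im_iC mulr1 im_ofR add0r.
exists (Phi 1 - Phi 0); apply: (@Segint _ _ _ _ Phi) => // s hs.
split.
  by under eq_fun do rewrite rePhi; have := hP1 _ hs; rewrite /h clE.
by under eq_fun do rewrite imPhi; have := hP2 _ hs; rewrite /h clE.
Qed.

Lemma segint_bound f a b v c (M : R) : segint f a b v ->
  (forall s, 0 <= s <= 1 -> nm (f (a + ofR s * (b - a)) - c) <= M) ->
  nm (v - c * (b - a)) <= 2 * M * nm (b - a).
Proof.
move=> [Phi hPhi ->] hM; rewrite -mulrA.
apply: (rmvt hPhi) => s hs; rewrite -mulrBl nmM ler_wpM2r ?nm_ge0 //; exact: hM.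
Qed.

Lemma segint_primitive f F a b :
  (forall s, 0 <= s <= 1 -> cderiv F (a + ofR s * (b - a)) (f (a + ofR s * (b - a)))) ->
  segint f a b (F b - F a).
Proof.
move=> h; apply: (@Segint _ _ _ _ (fun s => F (a + ofR s * (b - a)))).
  by move=> s /h; exact: real_of_cderiv.
by rewrite ofR1 ofR0 mul1r mul0r addr0; congr (F _ - _); ring.
Qed.

Lemma segint_sub f g a b v w : segint f a b v -> segint g a b w ->
  segint (fun z => f z - g z) a b (v - w).
Proof.
move=> [P hP ->] [Q hQ ->]; apply: (@Segint _ _ _ _ (fun s => P s - Q s)); last by ring.
move=> s hs; have [p1 p2] := hP _ hs; have [q1 q2] := hQ _ hs.
rewrite mulrBl; split; rewrite ?reB ?imB.
  by under eq_fun do rewrite reB; exact: is_deriveB.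
by under eq_fun do rewrite imB; exact: is_deriveB.
Qed.

Lemma segint_rev f a b v : segint f a b v -> segint f b a (- v).
Proof.
move=> [P hP ->]; apply: (@Segint _ _ _ _ (fun s => P ((-1) * s + 1))).
  move=> s /andP[s0 s1].
  have hs : 0 <= -1 * s + 1 <= 1 by apply/andP; split; lra.
  have := rderiv_affine (hP _ hs); congr rderiv.
  rewrite (_ : a + ofR (-1 * s + 1) * (b - a) = b + ofR s * (a - b)); last first.
    by rewrite ofRD ofRM ofRN ofR1; ring.
  by rewrite ofRN ofR1; ring.
by rewrite mulr1 mulr0 add0r addNr opprB.
Qed.

Lemma segint_half f a b v : segint f a b v ->
  exists v1 v2, [/\ segint f a ((a + b) / 2) v1, segint f ((a + b) / 2) b v2 & v = v1 + v2].
Proof.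
move=> [P hP ->]; exists (P 2^-1 - P 0), (P 1 - P 2^-1); split; last by ring.
- apply: (@Segint _ _ _ _ (fun s => P (2^-1 * s + 0))); last by rewrite mulr1 mulr0 !addr0.
  move=> s /andP[s0 s1].
  have hs : 0 <= 2^-1 * s + 0 <= 1 by apply/andP; split; lra.
  have := rderiv_affine (hP _ hs); congr rderiv.
  have -> : a + ofR s * ((a + b) / 2 - a) = a + ofR (2^-1 * s + 0) * (b - a).
    by rewrite addr0 ofRM ofRV ofR_nat; field.
  by rewrite ofRV ofR_nat; field.
- apply: (@Segint _ _ _ _ (fun s => P (2^-1 * s + 2^-1))); last first.
    by rewrite mulr1 mulr0 add0r; congr (P _ - _); field.
  move=> s /andP[s0 s1].
  have hs : 0 <= 2^-1 * s + 2^-1 <= 1 by apply/andP; split; lra.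
  have := rderiv_affine (hP _ hs); congr rderiv.
  have -> : (a + b) / 2 + ofR s * (b - (a + b) / 2) = a + ofR (2^-1 * s + 2^-1) * (b - a).
    by rewrite ofRD ofRM ofRV ofR_nat; field.
  by rewrite ofRV ofR_nat; field.
Qed.

Definition cdiff f z := exists d, cderiv f z d.

Lemma cdiff_ccont f z : cdiff f z -> ccont f z.
Proof. by case=> d; exact: cderiv_ccont. Qed.

(** The intervals of centre u n and radius 2 K / 2^n are nested, and the supremum of their lower
    ends lies in all of them. This gives the limit together with its rate. *)
Lemma geometric_lim (u : nat -> R) (K : R) :
  (forall n, `|u n.+1 - u n| <= K / 2 ^+ n) ->
  exists l, forall n, `|u n - l| <= 2 * K / 2 ^+ n.
Proof.
move=> hu.
have p2 n : 0 < 2 ^+ n :> R by rewrite exprn_gt0.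
have pS n : K / 2 ^+ n.+1 = K / 2 ^+ n / 2.
  by rewrite exprS; field; rewrite gt_eqF.
pose lo n := u n - 2 * K / 2 ^+ n; pose hi n := u n + 2 * K / 2 ^+ n.
have step n : lo n <= lo n.+1 /\ hi n.+1 <= hi n.
  rewrite /lo /hi -!mulrA pS; have := hu n; rewrite ler_norml => /andP[? ?].
  by split; lra.
have K0 n : 0 <= K / 2 ^+ n by exact: le_trans (hu n).
have lohi n : lo n <= hi n by rewrite /lo /hi -!mulrA; have := K0 n; lra.
have lom n k : lo n <= lo (n + k)%N.
  by elim: k => [|k IH]; rewrite ?addn0 // addnS; apply: le_trans IH (step _).1.
have him n k : hi (n + k)%N <= hi n.
  by elim: k => [|k IH]; rewrite ?addn0 // addnS; apply: le_trans (step _).2 IH.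
have cross n m : lo n <= hi m.
  by apply: le_trans (lom n m) _; apply: le_trans (lohi _) _; rewrite addnC; exact: him.
have hs : has_sup (range lo).
  by split; [exists (lo 0%N); exists 0%N|exists (hi 0%N) => _ [n _ <-]].
exists (sup (range lo)) => n.
have l1 : lo n <= sup (range lo) by apply: ub_le_sup; [exact: hs.2|exists n].
have l2 : sup (range lo) <= hi n.
  by apply: ge_sup; [exists (lo 0%N); exists 0%N|move=> _ [m _ <-]].
by rewrite ler_norml; move: l1 l2; rewrite /lo /hi => l1 l2; apply/andP; split; lra.
Qed.

Section Triangle.
Variables (f : C -> C) (z0 : C) (r : R).
Hypothesis fD : forall z, nm (z - z0) <= r -> cdiff f z.

Definition inball z := nm (z - z0) <= r.

Lemma inball_conv a b (s : R) : inball a -> inball b -> 0 <= s <= 1 ->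
  inball (a + ofR s * (b - a)).
Proof.
rewrite /inball => ha hb /andP[s0 s1].
rewrite (_ : _ - z0 = ofR (1 - s) * (a - z0) + ofR s * (b - z0)); last first.
  by rewrite ofRB ofR1; ring.
apply: le_trans (nmD _ _) _; rewrite !nmM !nm_ofR !ger0_norm ?subr_ge0 //.
have := ler_wpM2l s0 hb; have s1' : 0 <= 1 - s by rewrite subr_ge0.
have := ler_wpM2l s1' ha; lra.
Qed.

Lemma inball_mid a b : inball a -> inball b -> inball ((a + b) / 2).
Proof.
move=> ha hb; have h : 0 <= (2^-1 : R) <= 1 by rewrite invr_ge0 ler0n invf_le1 ?ler1n ?ltr0n.
have := inball_conv ha hb h; congr inball.
by rewrite ofRV ofR_nat; field.
Qed.

Lemma segint_inball a b : inball a -> inball b -> exists v, segint f a b v.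
Proof.
move=> ha hb; apply: segint_exists => s hs; apply: cdiff_ccont; apply: fD.
exact: inball_conv.
Qed.

Definition triint a b c v := exists v1 v2 v3,
  [/\ segint f a b v1, segint f b c v2, segint f c a v3 & v = v1 + v2 + v3].

Record small_triangle (D : R) a b c v : Prop := SmallTriangle {
  st_a : inball a; st_b : inball b; st_c : inball c;
  st_ab : nm (a - b) <= D; st_bc : nm (b - c) <= D; st_ca : nm (c - a) <= D;
  st_v : triint a b c v }.

Lemma nm_half z : nm (z / 2) = nm z / 2.
Proof. by rewrite nmM nmV -ofR_nat nm_ofR ger0_norm. Qed.

(** The midpoints cut the triangle into four of half the size. The inner sides are run in both
    directions and cancel, so one of the four carries at least a quarter of the integral. The bound
    on the displacement of the first vertex makes the vertices converge under iteration. *)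
Lemma triangle_step D a b c v : small_triangle D a b c v ->
  exists a' b' c' v', [/\ small_triangle (D / 2) a' b' c' v', nm v <= 4 * nm v' &
    nm (a' - a) <= D].
Proof.
move=> [ha hb hc hab hbc hca [v1 [v2 [v3 [s1 s2 s3 ->]]]]].
have [p1 [p2 [h1 h2 ->]]] := segint_half s1.
have [q1 [q2 [k1 k2 ->]]] := segint_half s2.
have [t1 [t2 [l1 l2 ->]]] := segint_half s3.
have ab := inball_mid ha hb; have bc := inball_mid hb hc; have ca := inball_mid hc ha.
have [x1 e1] := segint_inball ab ca; have [x2 e2] := segint_inball bc ab.
have [x3 e3] := segint_inball ca bc.
have D0 : 0 <= D by exact: le_trans (nm_ge0 _) hab.
have half u (d : C) : u = d / 2 -> nm d <= D -> nm u <= D / 2.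
  by move=> -> hd; rewrite nm_half ler_pM2r.
have T1 : small_triangle (D / 2) a ((a + b) / 2) ((c + a) / 2) (p1 + x1 + t2).
  split => //; last by exists p1, x1, t2.
  - by apply: half hab; field.
  - by apply: half hbc; field.
  - by apply: half hca; field.
have T2 : small_triangle (D / 2) ((a + b) / 2) b ((b + c) / 2) (p2 + q1 + x2).
  split => //; last by exists p2, q1, x2.
  - by apply: half hab; field.
  - by apply: half hbc; field.
  - by apply: half hca; field.
have T3 : small_triangle (D / 2) ((c + a) / 2) ((b + c) / 2) c (x3 + q2 + t1).
  split => //; last by exists x3, q2, t1.
  - by apply: half hab; field.
  - by apply: half hbc; field.
  - by apply: half hca; field.
have T4 : small_triangle (D / 2) ((b + c) / 2) ((c + a) / 2) ((a + b) / 2) (- x3 - x1 - x2).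
  split => //; last by exists (- x3), (- x1), (- x2); split => //; exact: segint_rev.
  - by apply: (half _ (b - a)); [field|rewrite nmC].
  - by apply: (half _ (c - b)); [field|rewrite nmC].
  - by apply: (half _ (a - c)); [field|rewrite nmC].
have E : p1 + p2 + (q1 + q2) + (t1 + t2) =
  (p1 + x1 + t2) + (p2 + q1 + x2) + (x3 + q2 + t1) + (- x3 - x1 - x2) by ring.
have B : nm (p1 + p2 + (q1 + q2) + (t1 + t2)) <=
  nm (p1 + x1 + t2) + nm (p2 + q1 + x2) + nm (x3 + q2 + t1) + nm (- x3 - x1 - x2).
  by rewrite E; do 3! (apply: le_trans (nmD _ _) _; rewrite lerD2r).
have half' u (d : C) : u = d / 2 -> nm d <= D -> nm u <= D.
  by move=> e hd; apply: le_trans (half _ _ e hd) _; lra.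
move: B; set V := nm (_ + _ + _) => B.
have [|n1] := leP V (4 * nm (p1 + x1 + t2)).
  by move=> h; do 4!eexists; split; [exact: T1|exact: h|rewrite subrr nm0].
have [|n2] := leP V (4 * nm (p2 + q1 + x2)).
  move=> h; do 4!eexists; split; [exact: T2|exact: h|].
  by apply: (half' _ (b - a)); [field|rewrite nmC].
have [|n3] := leP V (4 * nm (x3 + q2 + t1)).
  move=> h; do 4!eexists; split; [exact: T3|exact: h|].
  by apply: (half' _ (c - a)); [field|].
do 4!eexists; split; [exact: T4| |].
  by lra.
have -> : (b + c) / 2 - a = (b - a) / 2 + (c - a) / 2 by field.
by apply: le_trans (nmD _ _) _; rewrite !nm_half (nmC b); lra.
Qed.

(** An affine function has a quadratic primitive. Applied to the tangent map of f at the limit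
    point, this leaves only the error of the linear approximation to be integrated. *)
Lemma affine_triint (A d z a b c : C) :
  exists w1 w2 w3, [/\ segint (fun u => A + d * (u - z)) a b w1,
   segint (fun u => A + d * (u - z)) b c w2, segint (fun u => A + d * (u - z)) c a w3
   & w1 + w2 + w3 = 0].
Proof.
pose G u := A * u + d * ((u - z) * (u - z) / 2).
have hG u : cderiv G u (A + d * (u - z)).
  have h1 := cderivB (cderiv_id u) (cderiv_cst z u).
  have := cderivD (cderivZ A (cderiv_id u))
    (cderivZ d (cderivM (cderivM h1 h1) (cderiv_cst (2^-1) u))).
  by congr cderiv; field.
exists (G b - G a), (G c - G b), (G a - G c); split; try by ring.
all: by apply: segint_primitive => s _; exact: hG.
Qed.

Theorem goursat a b c v : inball a -> inball b -> inball c -> triint a b c v -> v = 0.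
Proof.
move=> ha hb hc hv.
pose D := nm (a - b) + nm (b - c) + nm (c - a).
have n1 := nm_ge0 (a - b); have n2 := nm_ge0 (b - c); have n3 := nm_ge0 (c - a).
have D0 : 0 <= D by rewrite !addr_ge0.
have T0 : small_triangle D a b c v by split => //; rewrite /D; lra.
(* The choice of a smaller triangle becomes a total function on tuples, so that it can be iterated;
   tuples that are no triangles get an arbitrary successor. *)
pose state := (R * C * C * C * C)%type.
pose valid (s : state) := let: (D, a, b, c, v) := s in small_triangle D a b c v.
have /choice[step hstep] : forall s : state, exists s' : state,
    valid s -> [/\ valid s', s'.1.1.1.1 = s.1.1.1.1 / 2, nm s.2 <= 4 * nm s'.2 &
      nm (s'.1.1.1.2 - s.1.1.1.2) <= s.1.1.1.1].
  move=> s; have [hs|ns] := pselect (valid s); last by exists s.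
  case: s hs => [[[[D1 a1] b1] c1] v1] /triangle_step[a' [b' [c' [v' [h1 h2 h3]]]]].
  by exists (D1 / 2, a', b', c', v') => _.
pose s n := iter n step (D, a, b, c, v).
have vs n : valid (s n) by elim: n => //= n IH; have [] := hstep _ IH.
have p2 n : 0 < 2 ^+ n :> R by rewrite exprn_gt0.
have Ds n : (s n).1.1.1.1 = D / 2 ^+ n.
  elim: n => [|n IH]; first by rewrite expr0 divr1.
  have [_ -> _ _] := hstep _ (vs n); rewrite IH exprS; field.
  by rewrite gt_eqF.
have Vs n : nm v <= 4 ^+ n * nm (s n).2.
  elim: n => [|n IH]; first by rewrite expr0 mul1r.
  have [_ _ h _] := hstep _ (vs n); apply: le_trans IH _.
  by rewrite exprSr -mulrA ler_pM2l ?exprn_gt0.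
have As n : nm ((s n.+1).1.1.1.2 - (s n).1.1.1.2) <= D / 2 ^+ n.
  by have [_ _ _] := hstep _ (vs n); rewrite Ds.
have [lx hx] := @geometric_lim (fun n => re (s n).1.1.1.2) D (fun n =>
  le_trans (eq_ind _ (fun x => `|x| <= _) (re_nm _) _ (reB _ _)) (As n)).
have [ly hy] := @geometric_lim (fun n => im (s n).1.1.1.2) D (fun n =>
  le_trans (eq_ind _ (fun x => `|x| <= _) (im_nm _) _ (imB _ _)) (As n)).
pose z : C := ofR lx + ofR ly * iC.
have rez : re z = lx by rewrite reD reMofR re_iC mulr0 addr0.
have imz : im z = ly by rewrite imD imMofR im_iC mulr1 im_ofR add0r.
have lz n : nm ((s n).1.1.1.2 - z) <= 4 * (D / 2 ^+ n).
  apply: le_trans (nm_le _) _; rewrite reB imB rez imz.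
  have := hx n; have := hy n; rewrite -!mulrA; lra.
have small e : 0 < e -> exists n, D / 2 ^+ n < e.
  move=> e0; have [n hn] : exists n : nat, D / e < n%:R.
    have de : 0 <= D / e by rewrite divr_ge0 // ltW.
    by exists (Num.Def.archi_bound (D / e)); exact: archi_boundP.
  exists n; rewrite ltr_pdivrMr // mulrC -ltr_pdivrMr //; apply: lt_trans hn _.
  by rewrite -natrX ltr_nat ltn_expl.
have inz : inball z.
  rewrite /inball leNgt; apply/negP => hr.
  have e0 : 0 < nm (z - z0) - r by rewrite subr_gt0.
  have [n hn] := small ((nm (z - z0) - r) / 4) (divr_gt0 e0 (ltr0n _ 4)).
  move: (vs n) (lz n); case: (s n) => [[[[D1 a1] b1] c1] v1] /= [h _ _ _ _ _ _] l.
  have := nmD (z - a1) (a1 - z0); rewrite addrA subrK (nmC z a1); move: h; rewrite /inball; lra.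
have [d /cderivP hd] := fD inz.
apply/eqP; rewrite -nm_eq0 eq_le nm_ge0 andbT; apply/ler_addgt0Pr => e e0; rewrite add0r.
(* Each side contributes 12 e1 (D / 2^n)^2, so after multiplication by 4^n the total is 36 e1 D^2,
   which this choice keeps below e. The points of the sides are within 6 D / 2^n of z, whence the
   bound rr / 6 on D / 2^n. *)
pose e1 := e / (60 * (D ^+ 2 + 1)).
have K0 : 0 < 60 * (D ^+ 2 + 1) by rewrite mulr_gt0 // ltr_wpDl // sqr_ge0.
have e10 : 0 < e1 by rewrite divr_gt0.
have [rr rr0 hrr] := hd _ e10.
have [n hn] := small (rr / 6) (divr_gt0 rr0 (ltr0n _ 6)).
have Dn0 : 0 <= D / 2 ^+ n by rewrite divr_ge0 // ltW.
apply: le_trans (Vs n) _.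
move: (vs n) (Ds n) (lz n); case: (s n) => [[[[D1 a1] b1] c1] v1] /=.
move=> [_ _ _ kab kbc kca [v2 [v3 [v4 [s2 s3 s4 ->]]]]] D1E l.
rewrite D1E in kab kbc kca; set Dn := D / 2 ^+ n in hn Dn0 kab kbc kca l.
have [w1 [w2 [w3 [i1 i2 i3 iE]]]] := affine_triint (f z) d z a1 b1 c1.
have key (x y : C) : nm (x - z) <= 5 * Dn -> nm (x - y) <= Dn ->
  forall v w, segint f x y v -> segint (fun u => f z + d * (u - z)) x y w ->
  nm (v - w) <= 12 * e1 * Dn ^+ 2.
  move=> xz xy v' w' hv' hw'; have := segint_sub hv' hw' => hs.
  have := @segint_bound _ _ _ _ 0 (e1 * (6 * Dn)) hs; rewrite mul0r subr0 => H.
  apply: le_trans (H _) _; last first.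
    rewrite (_ : 12 * e1 * Dn ^+ 2 = 2 * (e1 * (6 * Dn)) * Dn); last by ring.
    by rewrite (nmC y); apply: ler_wpM2l xy; do 2!(apply: mulr_ge0; first by lra); lra.
  move=> t /andP[t0 t1]; rewrite subr0.
  have hz : nm (x + ofR t * (y - x) - z) <= 6 * Dn.
    rewrite addrAC; apply: le_trans (nmD _ _) _; rewrite nmM nm_ofR ger0_norm // (nmC y).
    have : t * nm (x - y) <= 1 * Dn by rewrite ler_pM ?nm_ge0.
    by lra.
  rewrite opprD addrA; apply: le_trans (hrr _ _) _; first by lra.
  by rewrite ler_pM2l.
have bz : nm (b1 - z) <= 5 * Dn.
  have := nmD (b1 - a1) (a1 - z); rewrite addrA subrK (nmC b1); lra.
have cz : nm (c1 - z) <= 5 * Dn.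
  have := nmD (c1 - a1) (a1 - z); rewrite addrA subrK; lra.
have az : nm (a1 - z) <= 5 * Dn by lra.
have k1 := key _ _ az kab _ _ s2 i1; have k2 := key _ _ bz kbc _ _ s3 i2.
have k3 := key _ _ cz kca _ _ s4 i3.
have -> : v2 + v3 + v4 = (v2 - w1) + (v3 - w2) + (v4 - w3).
  by rewrite -[LHS]subr0 -iE; ring.
have B : nm (v2 - w1 + (v3 - w2) + (v4 - w3)) <= 36 * e1 * Dn ^+ 2.
  by apply: le_trans (nmD _ _) _; have := nmD (v2 - w1) (v3 - w2); lra.
have p4 : 0 < 4 ^+ n :> R by rewrite exprn_gt0.
apply: le_trans (ler_wpM2l (ltW p4) B) _.
have -> : 4 ^+ n * (36 * e1 * Dn ^+ 2) = 36 * e1 * D ^+ 2.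
  have -> : (4 : R) = 2 ^+ 2 by ring.
  by rewrite /Dn -exprM mulnC exprM; field; rewrite gt_eqF.
rewrite /e1; rewrite (_ : 36 * _ * _ = e * (36 * D ^+ 2 / (60 * (D ^+ 2 + 1)))); last first.
  by field; rewrite gt_eqF // ltr_wpDl // sqr_ge0.
rewrite ger_pMr // ler_pdivrMr // mul1r; have := sqr_ge0 D; lra.
Qed.

End Triangle.
End Goursat.

(** * From primitives on discs to the identity theorem along a segment *)

Section IdentityTheorem.
Variable R : realType.
Notation C := (Cplx R).
Implicit Types (z w : C) (a b c : C) (f g : C -> C).

(** F z is the integral from the centre to z. Goursat's lemma for the triangle z0, z, u turns F u -
    F z into the integral over the short segment from z to u. *)
Lemma ball_primitive f z0 (r : R) : 0 < r ->
  (forall z, nm (z - z0) <= r -> cdiff f z) ->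
  exists2 F, F z0 = 0 & forall z, nm (z - z0) < r -> cderiv F z (f z).
Proof.
move=> r0 fD.
have in0 : inball z0 r z0 by rewrite /inball subrr nm0 ltW.
have /choice[F hF] : forall z, exists v, inball z0 r z -> segint f z0 z v.
  move=> z; have [hz|nz] := pselect (inball z0 r z); last by exists 0.
  by have [v hv] := segint_inball fD in0 hz; exists v.
exists F.
  have h := hF _ in0; apply/eqP; rewrite -nm_eq0 eq_le nm_ge0 andbT.
  have := @segint_bound _ _ _ _ _ (f z0) 0 h; rewrite mulr0 mul0r subrr mulr0 subr0.
  by apply=> s _; rewrite mulr0 addr0 subrr nm0.
move=> z hz; apply/cderivP => e e0.
have e20 : 0 < e / 2 by rewrite divr_gt0.
have iz : inball z0 r z by rewrite /inball ltW.
have /ccontP /(_ _ e20)[d d0 hd] := cdiff_ccont (fD _ (ltW hz)).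
exists (Num.min d (r - nm (z - z0))); first by rewrite lt_min d0 subr_gt0.
move=> u; rewrite lt_min => /andP[ud ur].
have iu : inball z0 r u.
  rewrite /inball -(subrK z u) -addrA; apply: le_trans (nmD _ _) _; lra.
have [v hv] := segint_inball fD iz iu.
have T : triint f z0 z u (F z + v + - F u).
  by exists (F z), v, (- F u); split => //; [exact: hF|apply: segint_rev; exact: hF].
have /eqP := goursat fD in0 iz iu T; rewrite addr_eq0 opprK addrC => /eqP vE.
rewrite -vE addrK; have := @segint_bound _ _ _ _ _ (f z) (e / 2) hv.
rewrite (_ : 2 * (e / 2) = e); last by field.
apply=> s /andP[s0 s1]; apply/ltW/hd; rewrite addrC addKr nmM nm_ofR ger0_norm //.
by apply: le_lt_trans ud; rewrite ler_piMl ?nm_ge0.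
Qed.

(** The extreme value theorem is applied in R * R, where the closed disc is a closed subset of a
    product of two segments. *)
Lemma ball_max (g : C -> R) z0 (r : R) : 0 <= r ->
  (forall z, nm (z - z0) <= r -> forall e : R, 0 < e ->
    exists2 d, 0 < d & forall u, nm (u - z) < d -> `|g u - g z| < e) ->
  exists2 m, nm (m - z0) <= r & forall u, nm (u - z0) <= r -> g u <= g m.
Proof.
move=> r0 cg.
pose mk (p : R * R) : C := ofR p.1 + ofR p.2 * iC.
have remk p : re (mk p) = p.1 by rewrite reD reMofR re_iC mulr0 addr0.
have immk p : im (mk p) = p.2 by rewrite imD imMofR im_iC mulr1 im_ofR add0r.
have mkB p q : nm (mk p - mk q) <= `|p.1 - q.1| + `|p.2 - q.2|.
  by apply: le_trans (nm_le _) _; rewrite reB imB !remk !immk.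
pose A : set (R * R) := [set p | nm (mk p - z0) <= r].
have cmk (h : C -> R) p : (forall e : R, 0 < e ->
    exists2 d, 0 < d & forall u, nm (u - mk p) < d -> `|h u - h (mk p)| < e) ->
    {for p, continuous (fun p => h (mk p))}.
  move=> H; apply/cvgrPdist_lt => e /H[d d0 hd].
  have d20 : 0 < d / 2 by rewrite divr_gt0.
  exists (ball p.1 (d / 2), ball p.2 (d / 2)); first by split; exact: nbhsx_ballx.
  move=> q [/= b1 b2]; rewrite distrC; apply: hd; apply: le_lt_trans (mkB _ _) _.
  by move: b1 b2; rewrite /ball /= (distrC q.1) (distrC q.2); lra.
have cA : compact A.
  apply: (@subclosed_compact _ _ (`[re z0 - r, re z0 + r] `*` `[im z0 - r, im z0 + r])).
  - apply: (@closed_comp _ _ (fun p => nm (mk p - z0)) [set x | x <= r]); last exact: closed_le.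
    move=> p _; apply: (cmk (fun u => nm (u - z0))) => e e0; exists e => // u hu.
    apply: le_lt_trans hu; rewrite ler_norml.
    have := nmBl (u - z0) (mk p - z0); have := nmBl (mk p - z0) (u - z0).
    have -> : u - z0 - (mk p - z0) = u - mk p by ring.
    have -> : mk p - z0 - (u - z0) = mk p - u by ring.
    rewrite (nmC (mk p) u) => h1 h2; apply/andP; split; lra.
  - by apply: compact_setX; exact: segment_compact.
  - move=> p /= hp; have := le_trans (re_nm _) hp; have := le_trans (im_nm _) hp.
    rewrite reB imB remk immk !ler_norml !in_itv /= => /andP[? ?] /andP[? ?].
    by split; apply/andP; split; lra.
have mkE z : mk (re z, im z) = z by rewrite /mk -Cplx_rect.
have A0 : A !=set0 by exists (re z0, im z0); rewrite /A /= mkE subrr nm0.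
have [|p pA hp] := compact_EVT_max (f := fun p => g (mk p)) A0 cA.
  apply: continuous_in_subspaceT => p; rewrite inE => pA; apply: (cmk g); exact: cg.
exists (mk p); first by move: pA; rewrite inE.
by move=> u hu; rewrite -(mkE u); apply: hp; rewrite inE /A /= mkE.
Qed.

(* The variant of complex differentiability needed for the second-order test
   at an interior maximum; it is available for primitives. *)
Definition cdiff2 (D : C -> Prop) (G : C -> C) := exists G1 : C -> C,
  forall z, D z -> cderiv G z (G1 z) /\ cdiff G1 z.

(** This is the mean value inequality for G - d (u - z)^2 / 2: its derivative differs from G1 z by
    o(u - z), as G1 is differentiable at z. Continuity of a second derivative does not enter. *)
Lemma taylor2 (G G1 : C -> C) z d (rho : R) : 0 < rho ->
  (forall u, nm (u - z) < rho -> cderiv G u (G1 u)) -> cderiv G1 z d ->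
  forall e : R, 0 < e -> exists2 s, 0 < s & forall h, nm h < s ->
    nm (G (z + h) - G z - G1 z * h - d * h ^+ 2 / 2) <= e * nm h ^+ 2.
Proof.
move=> rho0 hG /cderivP hd e e0.
have e20 : 0 < e / 2 by rewrite divr_gt0.
have [s s0 hs] := hd _ e20.
exists (Num.min s rho); first by rewrite lt_min s0.
move=> h; rewrite lt_min => /andP[h1 h2].
pose phi u := G u - d * (u - z) ^+ 2 / 2.
have le1 (t : R) : 0 <= t <= 1 -> nm (z + ofR t * h - z) <= nm h.
  move=> /andP[t0 t1]; rewrite addrC addKr nmM nm_ofR ger0_norm //.
  by rewrite ler_piMl ?nm_ge0.
have hphi (t : R) : 0 <= t <= 1 ->
    cderiv phi (z + ofR t * h) (G1 (z + ofR t * h) - d * (z + ofR t * h - z)).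
  move=> ht; set u := z + ofR t * h.
  have k1 := cderivB (cderiv_id u) (cderiv_cst z u).
  have := cderivB (hG u (le_lt_trans (le1 _ ht) h2))
    (cderivM (cderivZ d (cderivM k1 k1)) (cderiv_cst (2^-1) u)).
  by congr cderiv; rewrite /u; field.
have hM (t : R) : 0 <= t <= 1 ->
    nm (G1 (z + ofR t * h) - d * (z + ofR t * h - z) - G1 z) <= e / 2 * nm h.
  move=> ht; rewrite addrAC; apply: le_trans (hs _ _) _.
    exact: le_lt_trans (le1 _ ht) h1.
  by rewrite ler_pM2l // le1.
have := cmvt hphi hM; rewrite /phi subrr expr0n /= mulr0 mul0r subr0.
rewrite [z + h - z]addrC addKr.
rewrite (_ : 2 * (e / 2 * nm h) * nm h = e * nm h ^+ 2); last by field.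
by congr (nm _ <= _); ring.
Qed.

(** A small multiple of |z - z0|^2 is added to Re G. At an interior maximum the increments in the
    directions t, -t, i t, -i t are summed: the first- and second-order terms of G cancel, while the
    added square leaves 4 ep t^2, more than the Taylor error 2 ep t^2. *)
Lemma max_re (G : C -> C) z0 (r r0 M : R) : 0 <= r -> r < r0 ->
  cdiff2 (fun z => nm (z - z0) < r0) G ->
  (forall z, nm (z - z0) = r -> re (G z) <= M) ->
  forall z, nm (z - z0) <= r -> re (G z) <= M.
Proof.
move=> rge rr0 [G1 hG] hM z hz.
apply/ler_addgt0Pr => e e0.
pose ep := e / (r ^+ 2 + 1).
have K0 : 0 < r ^+ 2 + 1 by rewrite ltr_wpDl // sqr_ge0.
have ep0 : 0 < ep by rewrite divr_gt0.
pose u z := re (G z) + ep * (re (z - z0) ^+ 2 + im (z - z0) ^+ 2).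
have cu w : nm (w - z0) <= r -> forall e : R, 0 < e ->
    exists2 d, 0 < d & forall v, nm (v - w) < d -> `|u v - u w| < e.
  move=> hw e' e0'.
  have cG := cderiv_ccont (hG _ (le_lt_trans hw rr0)).1.
  have e20 : 0 < e' / 2 by rewrite divr_gt0.
  have /ccontP /(_ _ e20)[d1 d10 hd1] := cG.
  pose K := ep * (2 * nm (w - z0) + 1).
  have K1 : 0 < K by rewrite mulr_gt0 // ltr_wpDl // mulr_ge0 ?nm_ge0.
  exists (Num.min d1 (Num.min 1 (e' / (2 * K)))).
    by rewrite !lt_min d10 ltr01 divr_gt0 // mulr_gt0.
  move=> v; rewrite !lt_min => /and3P[v1 v2 v3].
  have E1 : `|re (G v) - re (G w)| < e' / 2.
    by rewrite -reB; apply: le_lt_trans (re_nm _) _; exact: hd1.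
  have E2 : `|nm (v - z0) ^+ 2 - nm (w - z0) ^+ 2| <= nm (v - w) * (2 * nm (w - z0) + 1).
    rewrite subr_sqr normrM; apply: ler_pM; rewrite ?normr_ge0 //.
      have := nmBl (v - z0) (w - z0); have := nmBl (w - z0) (v - z0).
      have -> : v - z0 - (w - z0) = v - w by ring.
      have -> : w - z0 - (v - z0) = w - v by ring.
      rewrite (nmC w v) ler_norml => k1 k2; apply/andP; split; lra.
    rewrite ger0_norm ?addr_ge0 ?nm_ge0 //.
    have := nmD (v - w) (w - z0); rewrite addrA subrK; lra.
  rewrite /u -!nm2 (_ : _ - _ = (re (G v) - re (G w)) +
    ep * (nm (v - z0) ^+ 2 - nm (w - z0) ^+ 2)); last by ring.
  apply: le_lt_trans (ler_normD _ _) _; rewrite normrM (gtr0_norm ep0).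
  have E3 : ep * `|nm (v - z0) ^+ 2 - nm (w - z0) ^+ 2| <= e' / 2.
    apply: le_trans (ler_wpM2l (ltW ep0) E2) _.
    rewrite mulrCA -/K; have K2 : 0 < 2 * K by rewrite mulr_gt0.
    move: v3; rewrite (ltr_pdivlMr _ _ K2) => v3.
    by lra.
  by lra.
have [m hm umax] := ball_max rge cu.
have [mr|mr] := eqVneq (nm (m - z0)) r.
  have h1 := hM _ mr; have h2 := umax _ hz.
  have h3 : u m <= M + ep * r ^+ 2 by rewrite /u -nm2 mr lerD2r.
  have h4 : re (G z) <= u z by rewrite /u lerDl; apply: mulr_ge0; [exact: ltW|exact: addr_ge0 (sqr_ge0 _) (sqr_ge0 _)].
  have h5 : ep * r ^+ 2 <= e.
    rewrite /ep mulrAC ler_pdivrMr // ler_pM2l // lerDl ler01 //.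
  by lra.
exfalso.
have mlt : nm (m - z0) < r by rewrite lt_neqAle mr.
have mr0 := lt_trans mlt rr0.
have [_ [d hd]] := hG _ mr0.
have gap0 : 0 < r0 - nm (m - z0) by rewrite subr_gt0.
have nearG v : nm (v - m) < r0 - nm (m - z0) -> cderiv G v (G1 v).
  move=> hv; apply: (hG _ _).1; have := nmD (v - m) (m - z0); rewrite addrA subrK; lra.
have ep20 : 0 < ep / 2 by rewrite divr_gt0.
have [s s0 hs] := taylor2 gap0 nearG hd ep20.
have gap1 : 0 < r - nm (m - z0) by rewrite subr_gt0.
pose t := Num.min s (r - nm (m - z0)) / 2.
have mn0 : 0 < Num.min s (r - nm (m - z0)) by rewrite lt_min s0.
have t0 : 0 < t by rewrite divr_gt0.
have [ts tr] : t < s /\ t < r - nm (m - z0).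
  have : t < Num.min s (r - nm (m - z0)) by rewrite /t ltr_pdivrMr // ltr_pMr // ltr1n.
  by rewrite lt_min => /andP[].
have key h : nm h = t -> re (G m + G1 m * h + d * h ^+ 2 / 2) - ep / 2 * t ^+ 2
    + ep * (re (m - z0 + h) ^+ 2 + im (m - z0 + h) ^+ 2) <= u m.
  move=> ht; have hts : nm h < s by rewrite ht.
  have := hs _ hts; rewrite ht => H.
  have := le_trans (re_nm _) H; rewrite ler_norml => /andP[k1 _].
  have le := umax (m + h); have : u (m + h) <= u m.
    by apply: le; have := nmD (m - z0) h; rewrite addrAC ht; lra.
  rewrite {1}/u addrAC; move: k1; rewrite !reB !reD; lra.
have i2 : iC * iC = -1 :> C := iC2 R.
have n1 : nm (ofR t) = t by rewrite nm_ofR gtr0_norm.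
have n2 : nm (- ofR t) = t by rewrite nmN.
have n3 : nm (ofR t * iC) = t by rewrite nmM nm_iC mulr1.
have n4 : nm (- (ofR t * iC)) = t by rewrite nmN.
have k1 := key _ n1; have k2 := key _ n2; have k3 := key _ n3; have k4 := key _ n4.
have q : (ofR t * iC) ^+ 2 = - ofR t ^+ 2 :> C by rewrite exprMn [iC ^+ 2]i2 mulrN1.
have re4 : re (G m + G1 m * ofR t + d * ofR t ^+ 2 / 2)
  + re (G m + G1 m * - ofR t + d * (- ofR t) ^+ 2 / 2)
  + re (G m + G1 m * (ofR t * iC) + d * (ofR t * iC) ^+ 2 / 2)
  + re (G m + G1 m * - (ofR t * iC) + d * (- (ofR t * iC)) ^+ 2 / 2) = 4 * re (G m).
  rewrite -!reD !sqrrN q -(reMofR 4) ofR_nat; congr re; ring.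
move: k1 k2 k3 k4; rewrite /u !reD !imD !reN !imN !reMofR !imMofR re_iC im_iC
  !re_ofR !im_ofR !mulr0 !mulr1 !oppr0 !addr0.
move: re4; rewrite !reD; set X1 := re (G1 m * ofR t); set Y1 := re (d * ofR t ^+ 2 / 2).
set X2 := re (G1 m * - ofR t); set Y2 := re (d * (- ofR t) ^+ 2 / 2).
set X3 := re (_ * (_ * _)); set Y3 := re (_ * (_ * _) ^+ 2 / 2).
set X4 := re (_ * (- (_ * _))); set Y4 := re (_ * (- (_ * _)) ^+ 2 / 2).
set A := re m; set B := re z0; set A' := im m; set B' := im z0.
move=> re4 k1 k2 k3 k4.
have t2 : 0 < ep * t ^+ 2 by rewrite mulr_gt0 // exprn_gt0.
nra.
Qed.

(** After multiplication by the unimodular constant that makes G z a nonnegative real, the bound for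
    the real part applies. *)
Lemma max_nm (G : C -> C) z0 (r r0 M : R) : 0 <= r -> r < r0 ->
  cdiff2 (fun z => nm (z - z0) < r0) G ->
  (forall z, nm (z - z0) = r -> nm (G z) <= M) ->
  forall z, nm (z - z0) <= r -> nm (G z) <= M.
Proof.
move=> rge rr0 [G1 hG] hM z hz.
have [gz|gz] := eqVneq (G z) 0.
  have hr : nm (z0 + ofR r - z0) = r by rewrite addrC addKr nm_ofR ger0_norm.
  by rewrite gz nm0; apply: le_trans (nm_ge0 _) (hM _ hr).
pose c := ofR (nm (G z)) / G z.
have nc : nm c = 1 by rewrite nmM nmV nm_ofR ger0_norm ?nm_ge0 // divff // nm_eq0.
have h2 : cdiff2 (fun z => nm (z - z0) < r0) (fun z => c * G z).
  exists (fun z => c * G1 z) => w /hG[h1 [d hd]].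
  by split; [exact: cderivZ|exists (c * d); exact: cderivZ].
have := @max_re (fun z => c * G z) z0 r r0 M rge rr0 h2 _ z hz.
rewrite /c divfK // re_ofR; apply=> w /hM hw; rewrite -/c.
by apply: le_trans (ler_norm _) (le_trans (re_nm _) _); rewrite nmM nc mul1r.
Qed.

Definition vanishes_near f a := exists2 eta : R, 0 < eta & forall z, nm (z - a) < eta -> f z = 0.

Lemma cderiv_near0 f a (eta : R) z : (forall z, nm (z - a) < eta -> f z = 0) ->
  nm (z - a) < eta -> cderiv f z 0.
Proof.
move=> f0 hz; apply: cderiv_near (cderiv_cst 0 z); apply/near_nmP.
exists (eta - nm (z - a)); first by rewrite subr_gt0.
move=> u hu; rewrite f0 //; have := nmD (u - z) (z - a); rewrite addrA subrK; lra.
Qed.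

(** There is no singularity to remove: near a the quotient is identically 0, and at a itself
    division by zero yields 0 too. *)
Lemma quotient_cdiff2 (F : C -> C) a (r0 : R) :
  cdiff2 (fun z => nm (z - a) < r0) F -> vanishes_near F a ->
  cdiff2 (fun z => nm (z - a) < r0) (fun z => F z / (z - a)) /\
  vanishes_near (fun z => F z / (z - a)) a.
Proof.
move=> [F1 hF] [eta eta0 F0].
have G0 z : nm (z - a) < eta -> F z / (z - a) = 0 by move=> /F0 ->; rewrite mul0r.
split; last by exists eta.
exists (fun z => F1 z / (z - a) - F z * 1 / (z - a) ^+ 2) => z hz.
have [h1 [d hd]] := hF _ hz.
have [->|za] := eqVneq z a.
  have na : nm (a - a) < eta by rewrite subrr nm0.
  have hr0 : 0 < r0 by apply: le_lt_trans hz; exact: nm_ge0.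
  have F10 u : nm (u - a) < Num.min eta r0 -> F1 u = 0.
    rewrite lt_min => /andP[u1 u2].
    exact: cderiv_unique (hF _ u2).1 (cderiv_near0 F0 u1).
  split.
    by rewrite subrr expr0n /= invr0 !mulr0 subr0; apply: (cderiv_near0 G0).
  exists 0; apply: (@cderiv_near0 _ a (Num.min eta r0)); last by rewrite subrr nm0 lt_min eta0.
  move=> u hu; rewrite F10 //; move: hu; rewrite lt_min => /andP[/F0 -> _].
  by rewrite !mul0r subr0.
have za0 : z - a != 0 by rewrite subr_eq0.
have da : cderiv (fun u => u - a) z 1.
  by have := cderivB (cderiv_id z) (cderiv_cst a z); rewrite subr0.
split; first exact: (@cderiv_div _ F (fun u => u - a) z _ _ za0 h1 da).
have k1 := @cderiv_div _ F1 (fun u => u - a) z _ _ za0 hd da.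
have za2 : (z - a) * (z - a) != 0 by rewrite mulf_neq0.
have k2 := @cderiv_div _ _ (fun u => (u - a) * (u - a)) z _ _ za2
  (cderivM h1 (cderiv_cst 1 z)) (cderivM da da).
by eexists; exact: (cderivB k1 k2).
Qed.

(** Iterated Schwarz lemma: dividing n times by z - a and applying the maximum principle on the
    circle of radius r gives |F z| <= M (|z - a| / r)^n for every n, which tends to 0. *)
Lemma vanish_cdiff2 (F : C -> C) a (r0 : R) :
  cdiff2 (fun z => nm (z - a) < r0) F -> vanishes_near F a ->
  forall z, nm (z - a) < r0 -> F z = 0.
Proof.
move=> hF F0 z hz.
have [za|za] := eqVneq z a; first by case: F0 => eta e0 ->; rewrite ?za ?subrr ?nm0.
have z0 : 0 < nm (z - a) by rewrite nm_gt0 subr_eq0.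
pose r := (nm (z - a) + r0) / 2.
have zr : nm (z - a) < r by rewrite /r; lra.
have rr0 : r < r0 by rewrite /r; lra.
have rgt0 : 0 < r := lt_trans z0 zr.
have main n : forall (G : C -> C) (M : R), cdiff2 (fun z => nm (z - a) < r0) G ->
    vanishes_near G a -> (forall w, nm (w - a) = r -> nm (G w) <= M) ->
    nm (G z) <= M * (nm (z - a) / r) ^+ n.
  elim: n => [|n IH] G M hG G0 hM.
    by rewrite expr0 mulr1; exact: (max_nm (ltW rgt0) rr0 hG hM (ltW zr)).
  have [q1 q2] := quotient_cdiff2 hG G0.
  have := IH _ (M / r) q1 q2; rewrite nmM nmV => H.
  have /H : forall w, nm (w - a) = r -> nm (G w / (w - a)) <= M / r.
    by move=> w wr; rewrite nmM nmV wr ler_pM2r ?invr_gt0 // hM.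
  rewrite ler_pdivrMr //; move/le_trans; apply.
  rewrite exprS; set q := (_ / r) ^+ n.
  by rewrite (_ : M / r * q * nm (z - a) = M * (nm (z - a) / r * q)) //; ring.
have [F1 hF1] := hF.
have [|m hm Fmax] := @ball_max (fun u => nm (F u)) a r (ltW rgt0).
  move=> w hw e e0; have /cderiv_ccont/ccontP /(_ _ e0)[d d0 hd] := (hF1 _ (le_lt_trans hw rr0)).1.
  exists d => // u /hd hu; apply: le_lt_trans hu; rewrite ler_norml.
  have := nmBl (F u) (F w); have := nmBl (F w) (F u); rewrite (nmC (F w) (F u)).
  by move=> h1 h2; apply/andP; split; lra.
have bound n : nm (F z) <= nm (F m) * (nm (z - a) / r) ^+ n.
  by apply: main => // w wr; apply: Fmax; rewrite wr.
apply/eqP; rewrite -nm_eq0 eq_le nm_ge0 andbT; apply/ler_addgt0Pr => e e0; rewrite add0r.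
have q1 : `|nm (z - a) / r| < 1.
  have q0 : 0 <= nm (z - a) / r by apply: divr_ge0; rewrite ?nm_ge0 // ltW.
  by rewrite (ger0_norm q0) ltr_pdivrMr // mul1r.
have := cvg_expr q1 => /cvgrPdist_lt /(_ (e / (nm (F m) + 1))).
have M1 : 0 < nm (F m) + 1 by rewrite ltr_wpDl ?nm_ge0.
rewrite divr_gt0 // => /(_ isT)[N _ /(_ N (leqnn N))] /=.
rewrite sub0r normrN => hN; apply: le_trans (bound N) _.
apply: le_trans (ler_wpM2l (nm_ge0 _) (le_trans (ler_norm _) (ltW hN))) _.
by rewrite mulrCA ler_piMr ?(ltW e0) // ler_pdivrMr // mul1r lerDl.
Qed.

(** The maximum principle asks for a differentiable derivative, which f is not known to have but its
    primitive F has. F vanishes near a, hence on the disc, and f is its derivative. *)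
Lemma vanish_ball f a (r0 : R) :
  (forall z, nm (z - a) < r0 -> cdiff f z) -> vanishes_near f a ->
  forall z, nm (z - a) < r0 -> f z = 0.
Proof.
move=> fD [eta eta0 f0] z hz.
pose r := (nm (z - a) + r0) / 2.
have zr : nm (z - a) < r by rewrite /r; lra.
have rr0 : r < r0 by rewrite /r; lra.
have rgt0 : 0 < r by apply: le_lt_trans zr; exact: nm_ge0.
have [|F F0 hF] := @ball_primitive f a r rgt0.
  by move=> w hw; apply: fD; exact: le_lt_trans rr0.
have Fv : vanishes_near F a.
  exists (Num.min eta r); first by rewrite lt_min eta0.
  move=> w; rewrite lt_min => /andP[w1 w2]; rewrite -F0 -{1}(subrK a w) addrC.
  apply: cderiv0_const => s /andP[s0 s1].
  have hs : nm (a + ofR s * (w - a) - a) <= nm (w - a).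
    by rewrite addrC addKr nmM nm_ofR ger0_norm // ler_piMl ?nm_ge0.
  rewrite -(f0 (a + ofR s * (w - a))); last exact: le_lt_trans w1.
  by apply: hF; exact: le_lt_trans w2.
have F2 : cdiff2 (fun z => nm (z - a) < r) F.
  by exists f => w hw; split; [exact: hF|apply: fD; exact: lt_trans rr0].
have Fz0 := vanish_cdiff2 F2 Fv.
apply: cderiv_unique (hF _ zr) _.
exact: (@cderiv_near0 F a r z Fz0 zr).
Qed.

Theorem identity_segment f (p v : C) :
  (forall s : R, 0 <= s <= 1 ->
    exists2 rho : R, 0 < rho & forall u, nm (u - (p + ofR s * v)) < rho -> cdiff f u) ->
  vanishes_near f p -> vanishes_near f (p + v).
Proof.
move=> fD f0.
pose S : set R := [set s | 0 <= s <= 1 /\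
  forall s', 0 <= s' <= s -> vanishes_near f (p + ofR s' * v)].
have S0 : S 0.
  split; first by rewrite lexx ler01.
  by move=> s' /andP[a b]; rewrite (@le_anti _ _ s' 0) ?a ?b // mul0r addr0.
have hs : has_sup S by split; [exists 0|exists 1 => s [/andP[]]].
have sge0 : 0 <= sup S by apply: ub_le_sup => //; exact: hs.2.
have sle1 : sup S <= 1 by apply: ge_sup; [exists 0|move=> s [/andP[]]].
have hsup : 0 <= sup S <= 1 by rewrite sge0.
have [rho rho0 hrho] := fD _ hsup.
pose K := nm v + 1.
have K0 : 0 < K by rewrite ltr_wpDl ?nm_ge0.
(* A parameter change below e moves the point by less than rho / 8. So the disc of radius rho / 2
   about the point at s lies in the disc of differentiability at the supremum, and it contains the
   discs of radius rho / 8 about all points whose parameter is within e of the supremum. *)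
pose e := rho / (8 * K).
have e0 : 0 < e by rewrite divr_gt0 // mulr_gt0.
have eK : e * K = rho / 8 by rewrite /e; field; rewrite gt_eqF.
have [s [hs01 hsv] se] := sup_adherent e0 hs.
have ssup : s <= sup S by apply: ub_le_sup; [exact: hs.2|].
have vs : vanishes_near f (p + ofR s * v).
  by apply: hsv; case/andP: hs01 => -> _ /=.
have dist (s1 s2 : R) : `|s1 - s2| < e -> nm (p + ofR s1 * v - (p + ofR s2 * v)) < rho / 8.
  move=> h; rewrite (_ : _ - _ = ofR (s1 - s2) * v); last by rewrite ofRB; ring.
  rewrite nmM nm_ofR -eK; apply: le_lt_trans (_ : `|s1 - s2| * K < _).
    by rewrite ler_wpM2l // /K lerDl.
  by rewrite ltr_pM2r.
have ds : nm (p + ofR s * v - (p + ofR (sup S) * v)) < rho / 8.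
  by apply: dist; rewrite distrC ger0_norm ?subr_ge0 // ; lra.
have fz : forall z, nm (z - (p + ofR s * v)) < rho / 2 -> f z = 0.
  apply: vanish_ball vs => z hz; apply: hrho.
  have := nmD (z - (p + ofR s * v)) (p + ofR s * v - (p + ofR (sup S) * v)).
  by rewrite addrA subrK; lra.
have ext s' : `|s' - sup S| < e -> vanishes_near f (p + ofR s' * v).
  move=> hs'; exists (rho / 8); first by rewrite divr_gt0.
  move=> u hu; apply: fz.
  have h1 := dist _ _ hs'.
  have h2 := nmD (u - (p + ofR s' * v)) (p + ofR s' * v - (p + ofR (sup S) * v)).
  have h3 := nmD (u - (p + ofR (sup S) * v)) (p + ofR (sup S) * v - (p + ofR s * v)).
  rewrite addrA subrK in h2; rewrite addrA subrK (nmC (p + ofR (sup S) * v)) in h3; lra.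
have upto s' : 0 <= s' < sup S + e -> vanishes_near f (p + ofR s' * v).
  move=> /andP[a b]; have [h|h] := leP s' s; first by apply: hsv; rewrite a.
  by apply: ext; rewrite ltr_norml; apply/andP; split; lra.
suff S1 : 1 < sup S + e.
  by rewrite -[v in p + v](mul1r v) -ofR1; apply: upto; rewrite ler01.
rewrite ltNge; apply/negP => h1.
have : S (sup S + e / 2).
  split; first by apply/andP; split; lra.
  by move=> s' /andP[a b]; apply: upto; apply/andP; split => //; lra.
move=> hS; have : sup S + e / 2 <= sup S by apply: ub_le_sup => //; exact: hs.2.
lra.
Qed.

End IdentityTheorem.

(** * Complex exponential, hyperbolic functions and principal logarithm *)

Section Exponential.
Variable R : realType.
Notation C := (Cplx R).
Implicit Types (z w : C) (a b c : R).

Lemma is_derive_lin (x s : R) : is_derive s 1 (fun t : R => t * x) x.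
Proof.
apply: is_derive_real => e e0; exists 1 => // h _.
by rewrite (_ : _ - _ - _ = 0) ?normr0 ?mulr_ge0 // ?ltW //; ring.
Qed.

Lemma rderiv_cexp (h : C) (s : R) :
  rderiv (fun t => cexp (ofR t * h)) s (h * cexp (ofR s * h)).
Proof.
have dE := @is_derive1_comp R expR (fun t => t * re h) s _ _ (is_derive_expR (s * re h)) (is_derive_lin (re h) s).
have dC := @is_derive1_comp R cos (fun t => t * im h) s _ _ (is_derive_cos (s * im h)) (is_derive_lin (im h) s).
have dS := @is_derive1_comp R sin (fun t => t * im h) s _ _ (is_derive_sin (s * im h)) (is_derive_lin (im h) s).
split.
- under eq_fun do rewrite re_cexp reMofR imMofR.
  apply: (@is_derive_eq _ _ _ _ _ _ _ _ (is_deriveM dE dC)).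
  rewrite reM re_cexp im_cexp !reMofR !imMofR /= /GRing.scale /=; ring.
- under eq_fun do rewrite im_cexp reMofR imMofR.
  apply: (@is_derive_eq _ _ _ _ _ _ _ _ (is_deriveM dE dS)).
  rewrite imM re_cexp im_cexp !reMofR !imMofR /= /GRing.scale /=; ring.
Qed.

Lemma cexp_sub1 (h : C) : nm h <= 1 -> nm (cexp h - 1) <= 2 * expR 1 * nm h.
Proof.
move=> h1.
have := @rmvt R (fun t => cexp (ofR t * h)) (fun s => h * cexp (ofR s * h)) 0
  (nm h * expR 1) (fun s _ => rderiv_cexp h s).
rewrite ofR1 ofR0 mul1r mul0r cexp0 subr0 => H.
apply: le_trans (H _) _; last by rewrite (mulrC (nm h)) mulrA.
move=> s /andP[s0 s1]; rewrite subr0 nmM nm_cexp ler_wpM2l ?nm_ge0 // ler_expR reMofR.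
apply: le_trans (ler_norm _) _; rewrite normrM ger0_norm //.
by rewrite -(mulr1 1); apply: ler_pM => //; apply: le_trans (re_nm _) h1.
Qed.

Lemma cexp_sub2 (h : C) : nm h <= 1 -> nm (cexp h - 1 - h) <= 4 * expR 1 * nm h ^+ 2.
Proof.
move=> h1.
have := @rmvt R (fun t => cexp (ofR t * h)) (fun s => h * cexp (ofR s * h)) h
  (nm h * (2 * expR 1 * nm h)) (fun s _ => rderiv_cexp h s).
rewrite ofR1 ofR0 mul1r mul0r cexp0 => H.
apply: le_trans (H _) _; last by rewrite le_eqVlt; apply/orP; left; apply/eqP; ring.
move=> s /andP[s0 s1].
rewrite (_ : h * _ - h = h * (cexp (ofR s * h) - 1)); last by ring.
rewrite nmM ler_wpM2l ?nm_ge0 //.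
have hs : nm (ofR s * h) <= nm h by rewrite nmM nm_ofR ger0_norm // ler_piMl ?nm_ge0.
apply: le_trans (cexp_sub1 (le_trans hs h1)) _.
by rewrite ler_wpM2l // mulr_ge0 // expR_ge0.
Qed.

Lemma cderiv_cexp z : cderiv (@cexp R) z (cexp z).
Proof.
apply/cderivP => e e0.
pose K := 4 * expR 1 * nm (cexp z) + 1.
have K0 : 0 < K by rewrite ltr_wpDl // !mulr_ge0 ?nm_ge0 ?expR_ge0.
exists (Num.min 1 (e / K)); first by rewrite lt_min ltr01 divr_gt0.
move=> u; rewrite lt_min => /andP[u1 u2].
rewrite (_ : cexp u = cexp z * cexp (u - z)); last by rewrite -cexpD addrC subrK.
rewrite (_ : _ - _ - _ = cexp z * (cexp (u - z) - 1 - (u - z))); last by ring.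
rewrite nmM; apply: le_trans (ler_wpM2l (nm_ge0 _) (cexp_sub2 (ltW u1))) _.
rewrite (_ : _ * (_ * _) = (4 * expR 1 * nm (cexp z)) * nm (u - z) * nm (u - z)); last by ring.
rewrite ler_wpM2r ?nm_ge0 //; move: u2; rewrite ltr_pdivlMr // => u2.
apply: le_trans (ltW u2); rewrite mulrC ler_wpM2l ?nm_ge0 // /K lerDl //.
Qed.

Lemma csinhN z : csinh (- z) = - csinh z.
Proof. by rewrite /csinh opprK -mulNr opprB. Qed.
Lemma ccoshN z : ccosh (- z) = ccosh z.
Proof. by rewrite /ccosh opprK addrC. Qed.
Lemma cderiv_csinh z : cderiv (@csinh R) z (ccosh z).
Proof.
have h := cderiv_comp (cderivN (cderiv_id z)) (cderiv_cexp (- z)).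
have := cderivM (cderivB (cderiv_cexp z) h) (cderiv_cst (2^-1) z).
by congr cderiv; rewrite /ccosh; ring.
Qed.
Lemma cderiv_ccosh z : cderiv (@ccosh R) z (csinh z).
Proof.
have h := cderiv_comp (cderivN (cderiv_id z)) (cderiv_cexp (- z)).
have := cderivM (cderivD (cderiv_cexp z) h) (cderiv_cst (2^-1) z).
by congr cderiv; rewrite /csinh; ring.
Qed.
Lemma ccosh2Bsinh2 z : ccosh z ^+ 2 - csinh z ^+ 2 = 1.
Proof.
have e1 : cexp z * cexp (- z) = 1 by rewrite -cexpD subrr cexp0.
by rewrite /ccosh /csinh -[RHS]e1; field.
Qed.

Definition sh a := (expR a - expR (- a)) / 2.

Lemma sh_sqr_ge a : a ^+ 2 / 4 <= sh a ^+ 2.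
Proof.
have pos b : 0 <= b -> b / 2 <= sh b.
  move=> b0; rewrite /sh ler_pM2r // lerBrDr.
  have := expR_ge1Dx b; have : expR (- b) <= 1 by rewrite -expR0 ler_expR; lra.
  lra.
have -> : a ^+ 2 / 4 = (a / 2) ^+ 2 by field.
have sq b : 0 <= b -> (b / 2) ^+ 2 <= sh b ^+ 2.
  move=> b0; have h := pos _ b0; rewrite -subr_ge0 subr_sqr.
  by apply: mulr_ge0; lra.
have [a0|a0] := leP 0 a; first exact: sq.
have a0' : 0 <= - a by rewrite oppr_ge0 ltW.
have -> : sh a ^+ 2 = sh (- a) ^+ 2 by rewrite /sh opprK; field.
have -> : (a / 2) ^+ 2 = (- a / 2) ^+ 2 by field.
exact: sq.
Qed.

(** The distance to the zeros of sinh is split into two directions: away from the imaginary axis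
    sinh of the real part gives a lower bound, close to it the sine of the imaginary part does. *)
Lemma nm2_csinh z : nm (csinh z) ^+ 2 = sin (im z) ^+ 2 + sh (re z) ^+ 2.
Proof.
have half (u : C) : u / 2 = ofR (2^-1) * u by rewrite ofRV ofR_nat mulrC.
rewrite nm2 /csinh half reMofR imMofR reB imB !re_cexp !im_cexp reN imN cosN sinN /sh.
have c1 := cos2Dsin2 (im z).
have c2 : cos (im z) ^+ 2 = 1 - sin (im z) ^+ 2 by rewrite -c1; ring.
have e1 : expR (re z) * expR (- re z) = 1 by rewrite -expRD subrr expR0.
rewrite (_ : (2^-1 * _) ^+ 2 + _ = cos (im z) ^+ 2 * (expR (re z) - expR (- re z)) ^+ 2 / 4 +
  sin (im z) ^+ 2 * ((expR (re z) - expR (- re z)) ^+ 2 + 4 * (expR (re z) * expR (- re z))) / 4); last by field.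
by rewrite e1 c2; field.
Qed.

Lemma nm2_ccosh z : nm (ccosh z) ^+ 2 = cos (im z) ^+ 2 + sh (re z) ^+ 2.
Proof.
have half (u : C) : u / 2 = ofR (2^-1) * u by rewrite ofRV ofR_nat mulrC.
rewrite nm2 /ccosh half reMofR imMofR reD imD !re_cexp !im_cexp reN imN cosN sinN /sh.
have c1 := cos2Dsin2 (im z).
have c2 : sin (im z) ^+ 2 = 1 - cos (im z) ^+ 2 by rewrite -c1; ring.
have e1 : expR (re z) * expR (- re z) = 1 by rewrite -expRD subrr expR0.
rewrite (_ : (2^-1 * _) ^+ 2 + _ = sin (im z) ^+ 2 * (expR (re z) - expR (- re z)) ^+ 2 / 4 +
  cos (im z) ^+ 2 * ((expR (re z) - expR (- re z)) ^+ 2 + 4 * (expR (re z) * expR (- re z))) / 4); last by field.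
by rewrite e1 c2; field.
Qed.

Lemma nm2_ccosh_le z : nm (ccosh z) ^+ 2 <= nm (csinh z) ^+ 2 + 1.
Proof.
rewrite nm2_csinh nm2_ccosh; have := cos2Dsin2 (im z); have := sqr_ge0 (sin (im z)).
have := sqr_ge0 (sh (re z)); lra.
Qed.

Definition halfpii : C := ofR (pi / 2) * iC.

Lemma cexp_halfpii : cexp halfpii = iC.
Proof.
apply: Cplx_eq; rewrite ?re_cexp ?im_cexp /halfpii ?reMofR ?imMofR re_iC im_iC mulr0 expR0 mulr1 mul1r.
  by rewrite cos_pihalf.
by rewrite sin_pihalf.
Qed.

Lemma iC_inv : (@iC R)^-1 = - iC.
Proof.
have i0 : (@iC R) != 0 by rewrite -nm_eq0 nm_iC oner_eq0.
by apply: (mulfI i0); rewrite divff // mulrN iC2 opprK.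
Qed.

Lemma ccoshD_halfpii z : ccosh (z + halfpii) = iC * csinh z.
Proof. by rewrite /csinh /ccosh opprD !cexpD (cexpN halfpii) cexp_halfpii iC_inv; field. Qed.
Lemma csinh0 : csinh 0 = 0 :> C.
Proof. by rewrite /csinh oppr0 subrr mul0r. Qed.

(* The principal logarithm where re z > 0; elsewhere a junk value. *)
Definition clog z : C := ofR (ln (nm z)) + ofR (atan (im z / re z)) * iC.

Lemma re_clog z : re (clog z) = ln (nm z).
Proof. by rewrite /clog reD reMofR re_iC mulr0 addr0 re_ofR. Qed.
Lemma im_clog z : im (clog z) = atan (im z / re z).
Proof. by rewrite /clog imD imMofR im_iC mulr1 im_ofR add0r. Qed.

Lemma cexp_clog z : 0 < re z -> cexp (clog z) = z.
Proof.
move=> z0; have nz : 0 < nm z by apply: lt_le_trans z0 _; exact: le_trans (ler_norm _) (re_nm z).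
pose q := im z / re z.
have nmE : nm z = re z * Num.sqrt (1 + q ^+ 2).
  rewrite /nm (_ : _ + _ = re z ^+ 2 * (1 + q ^+ 2)); last by rewrite /q; field; rewrite gt_eqF.
  by rewrite sqrtrM ?sqr_ge0 // sqrtr_sqr gtr0_norm.
have s0 : Num.sqrt (1 + q ^+ 2) != 0.
  by apply: contraTneq nz => h; rewrite nmE h mulr0 ltxx.
have cE : cos (atan q) = (Num.sqrt (1 + q ^+ 2))^-1 by rewrite cos_atan.
have c0 : cos (atan q) != 0 by rewrite cE invr_eq0.
have sE : sin (atan q) = q * (Num.sqrt (1 + q ^+ 2))^-1.
  by rewrite -cE -{2}(atanK q) /tan divfK.
apply: Cplx_eq; rewrite ?re_cexp ?im_cexp re_clog im_clog lnK ?posrE // -/q.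
  by rewrite cE nmE mulfK.
by rewrite sE nmE /q; field; rewrite s0 gt_eqF.
Qed.

Lemma im_clog_bound z : `|im (clog z)| <= pi.
Proof.
rewrite im_clog ler_norml; have := atan_gtNpi2 (im z / re z).
have := atan_ltpi2 (im z / re z); have := pi_gt0 R => ? ? ?; apply/andP; split; lra.
Qed.

Lemma ccont_clog z : 0 < re z -> ccont clog z.
Proof.
move=> z0; have nz : 0 < nm z by apply: lt_le_trans z0 _; exact: le_trans (ler_norm _) (re_nm z).
have cre : re u @[u --> z] --> re z.
  apply/cvgrPdist_lt => e e0; apply/near_nmP; exists e => // u hu.
  by rewrite -reB; apply: le_lt_trans (re_nm _) _; rewrite nmC.
have cim : im u @[u --> z] --> im z.
  apply/cvgrPdist_lt => e e0; apply/near_nmP; exists e => // u hu.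
  by rewrite -imB; apply: le_lt_trans (im_nm _) _; rewrite nmC.
have cnm : nm u @[u --> z] --> nm z.
  apply/cvgrPdist_lt => e e0; apply/near_nmP; exists e => // u hu.
  apply: le_lt_trans hu; rewrite ler_norml.
  have := nmBl z u; have := nmBl u z; rewrite (nmC z u) => h1 h2; apply/andP; split; lra.
have cl : ln (nm u) @[u --> z] --> ln (nm z).
  by apply: (cvg_comp _ _ cnm); apply: continuous_ln.
have ca : atan (im u / re u) @[u --> z] --> atan (im z / re z).
  have cq : im u / re u @[u --> z] --> im z / re z.
    by apply: (cvgM cim); apply: cvgV cre; rewrite gt_eqF.
  by apply: (cvg_comp _ _ cq); apply: continuous_atan.
apply/ccontP => e e0; have e20 : 0 < e / 2 by rewrite divr_gt0.
move/cvgrPdist_lt: cl => /(_ _ e20)/near_nmP[r1 r10 h1].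
move/cvgrPdist_lt: ca => /(_ _ e20)/near_nmP[r2 r20 h2].
exists (Num.min r1 r2); first by rewrite lt_min r10.
move=> u; rewrite lt_min => /andP[/h1 k1 /h2 k2].
apply: le_lt_trans (nm_le _) _; rewrite reB imB !re_clog !im_clog.
by rewrite (distrC (ln _)) (distrC (atan _)); lra.
Qed.

Lemma cderiv_clog z : 0 < re z -> cderiv clog z z^-1.
Proof.
move=> z0; have cl := ccont_clog z0.
have zn0 : z != 0 by apply: contraTneq z0 => ->; rewrite re0 ltxx.
have [phi cphi phiE hphi] := cderiv_cexp (clog z).
have cc : ccont (fun u => phi (clog u)) z by apply: (ccont_comp cl).
have p0 : phi (clog z) != 0 by rewrite phiE cexp_neq0.
have near0 : \forall u \near z, phi (clog u) != 0 /\ 0 < re u.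
  move/ccontP: cc => /(_ (nm (phi (clog z)))); rewrite nm_gt0 => /(_ p0)[r r0 hr].
  apply/near_nmP; exists (Num.min r (re z)); first by rewrite lt_min r0.
  move=> u; rewrite lt_min => /andP[/hr h1 h2]; split.
    by apply: contraTneq h1 => ->; rewrite sub0r nmN ltxx.
  have := le_lt_trans (re_nm _) h2; rewrite reB ltr_norml => /andP[h3 _]; lra.
(* As for the inverse function, the definition is altered far from z so that Caratheodory's identity
   holds everywhere, with 1 / phi (clog u) as its factor. *)
pose g u := if (phi (clog u) != 0) && (0 < re u) then clog u else clog z + (u - z) / phi (clog u).
apply: (@cderiv_near _ g).
  by move: near0; apply: filterS => u [h1 h2]; rewrite /g h1 h2.
apply: (@Cderiv _ _ _ _ (fun u => (phi (clog u))^-1)).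
- exact: ccontV.
- by rewrite phiE cexp_clog.
- move=> u; rewrite {2}/g p0 z0 /=.
  rewrite /g; case: ifP => [/andP[h1 h2]|_]; last by rewrite addrC addKr mulrC.
  have := hphi (clog u); rewrite !cexp_clog // => ->.
  by rewrite mulKf.
Qed.

End Exponential.

(** * The time t and the function x(t) *)

Section Covering.
Variable R : realType.
Notation C := (Cplx R).
Implicit Types (w t : C).

Lemma eps_sqr w : eps w = sqrt_eps w ^+ 2.
Proof. by rewrite /eps /sqrt_eps expr2 -cexpD; congr cexp; field. Qed.

Lemma sqrt_eps_neq0 w : sqrt_eps w != 0.
Proof. exact: cexp_neq0. Qed.

Lemma sqrt_eps_gt0 w : 0 < nm (sqrt_eps w).
Proof. by rewrite nm_gt0 sqrt_eps_neq0. Qed.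

Lemma eps_turn w : eps (turn w) = eps w.
Proof. by rewrite /eps /turn cexpD cexp_2pi mulr1. Qed.

Lemma sqrt_eps_turn w : sqrt_eps (turn w) = - sqrt_eps w.
Proof.
rewrite /sqrt_eps /turn (_ : _ / 2 = w / 2 + ofR pi * iC); last by rewrite ofRM ofR_nat; field.
by rewrite cexpD cexp_pi mulrN1.
Qed.

Lemma Pper_turn w : Pper (turn w) = - Pper w.
Proof. by rewrite /Pper sqrt_eps_turn invrN mulrN. Qed.

Lemma sqrt_Pper w : sqrt_eps w * Pper w = - (ofR pi * iC).
Proof. by rewrite /Pper mulrC divfK // sqrt_eps_neq0. Qed.

(** x(t) is even in sqrt eps. This allows one time t for bar-eps and tilde-eps, whose square roots
    are opposite. *)
Lemma xt_opp w w' t : sqrt_eps w' = - sqrt_eps w -> xt w' t = xt w t.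
Proof. by move=> e; rewrite /xt e (mulNr _ t) csinhN ccoshN invrN opprK !mulrN mulNr. Qed.

Lemma cderiv_xt w t : csinh (sqrt_eps w * t) != 0 ->
  cderiv (xt w) t (xt w t ^+ 2 - eps w).
Proof.
move=> s0; have hl := cderivZ (sqrt_eps w) (cderiv_id t).
have hc := cderiv_comp hl (cderiv_ccosh (sqrt_eps w * t)).
have hs := cderiv_comp hl (cderiv_csinh (sqrt_eps w * t)).
have := cderivZ (- sqrt_eps w)
  (@cderiv_div _ _ (fun u => csinh (sqrt_eps w * u)) t _ _ s0 hc hs).
by congr cderiv; rewrite /xt eps_sqr; field.
Qed.

Lemma xt2Beps w t : csinh (sqrt_eps w * t) != 0 ->
  xt w t ^+ 2 - eps w = eps w / csinh (sqrt_eps w * t) ^+ 2.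
Proof.
move=> s0; rewrite /xt eps_sqr; have := ccosh2Bsinh2 (sqrt_eps w * t); move: s0.
set c := ccosh _; set s := csinh _ => s0 h.
have : c ^+ 2 = 1 + s ^+ 2 by rewrite -h subrK.
by move=> c2; rewrite mulNr sqrrN exprMn expr_div_n c2; field.
Qed.

Lemma xtN w t : xt w (- t) = - xt w t.
Proof. by rewrite /xt mulrN csinhN ccoshN invrN !mulrN. Qed.

Lemma csinhN_eq0 w t : (csinh (sqrt_eps w * - t) == 0) = (csinh (sqrt_eps w * t) == 0).
Proof. by rewrite mulrN csinhN oppr_eq0. Qed.

(** From |cosh|^2 <= |sinh|^2 + 1. A lower bound on |sinh| that is uniform in eps makes |x(t)| of
    order sqrt |eps|; points are shown in this way to lie over the disc of radius r. *)
Lemma nm_xt w t (s : R) : 0 < s -> s <= nm (csinh (sqrt_eps w * t)) ^+ 2 ->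
  csinh (sqrt_eps w * t) != 0 /\ nm (xt w t) ^+ 2 <= nm (eps w) * (1 + s^-1).
Proof.
move=> s0 hs; have n0 : 0 < nm (csinh (sqrt_eps w * t)) ^+ 2 := lt_le_trans s0 hs.
have sn0 : csinh (sqrt_eps w * t) != 0.
  by apply: contraTneq n0 => ->; rewrite nm0 expr0n ltxx.
split => //; rewrite /xt mulNr nmN (nmM (sqrt_eps w)) (nmM (ccosh _)) nmV !exprMn eps_sqr nmX.
apply: ler_wpM2l; first exact: sqr_ge0.
rewrite exprVn (ler_pdivrMr _ _ n0).
apply: le_trans (nm2_ccosh_le _) _; rewrite mulrDl mul1r lerD2l.
by rewrite mulrC ler_pdivlMr // mul1r.
Qed.

(* Soft thresholding: the profile of sigma up to the slope. *)
Definition shrink (a u : R) := Num.max 0 (u - a) + Num.min 0 (u + a).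

Lemma shrink_cases (a u : R) : 0 <= a -> [\/ [/\ - a <= u, u <= a & shrink a u = 0],
  a <= u /\ shrink a u = u - a | u <= - a /\ shrink a u = u + a].
Proof.
move=> a0; rewrite /shrink maxEle minEle.
case: (leP 0 (u - a)) => h1; case: (leP 0 (u + a)) => h2.
- by apply: Or32; split; lra.
- by exfalso; lra.
- by apply: Or31; split; lra.
- by apply: Or33; split; lra.
Qed.

Lemma shrink_le (a u v : R) : 0 <= a -> u <= v -> 0 <= shrink a v - shrink a u <= v - u.
Proof.
move=> a0 uv; have [[h1 h2 ->]|[h1 ->]|[h1 ->]] := shrink_cases u a0;
have [[k1 k2 ->]|[k1 ->]|[k1 ->]] := shrink_cases v a0; apply/andP; split; lra.
Qed.

Lemma shrink_err (a u : R) : 0 <= a -> `|shrink a u - u| <= a.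
Proof.
move=> a0; rewrite ler_norml.
have [[h1 h2 ->]|[h1 ->]|[h1 ->]] := shrink_cases u a0; apply/andP; split; lra.
Qed.

Lemma shrinkN (a u : R) : 0 <= a -> shrink a (- u) = - shrink a u.
Proof.
move=> a0; have [[h1 h2 ->]|[h1 ->]|[h1 ->]] := shrink_cases u a0;
have [[k1 k2 ->]|[k1 ->]|[k1 ->]] := shrink_cases (- u) a0; lra.
Qed.

Lemma shrink_norm (a u : R) : 0 <= a -> `|shrink a u| <= `|u| /\ 0 <= u * shrink a u.
Proof.
move=> a0; split; last first.
  by have [[h1 h2 ->]|[h1 ->]|[h1 ->]] := shrink_cases u a0; nra.
rewrite ler_norml; have := ler_norm u; have := ler_norm (- u); rewrite normrN.
by have [[h1 h2 ->]|[h1 ->]|[h1 ->]] := shrink_cases u a0; move=> ? ?; apply/andP; split; lra.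
Qed.

Lemma nm_eps w : nm (eps w) = nm (sqrt_eps w) ^+ 2.
Proof. by rewrite eps_sqr nmX. Qed.

Lemma sigmaE (g : geometry R) w u : 0 < g_c0 g ->
  sigma g w u = shrink (g_c0 g / nm (sqrt_eps w)) u * tan (theta g w).
Proof.
move=> c00; rewrite /sigma norm_nm re_ofR nm_eps sqrtr_sqr (ger0_norm (nm_ge0 _)).
set a := _ / _; have a0 : 0 < a := divr_gt0 c00 (sqrt_eps_gt0 w).
have [[h1 h2 ->]|[h1 ->]|[h1 ->]] := shrink_cases u (ltW a0).
- by rewrite ler_norml h1 h2 mul0r.
- have u0 : 0 < u by lra.
  rewrite gtr0_norm // gtr0_sg // mul1r; case: leP => // h2.
  by rewrite (@le_anti _ _ u a) ?h1 ?h2 // subrr mul0r.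
- have u0 : u < 0 by lra.
  rewrite ltr0_norm // ltr0_sg // mulN1r opprK; case: leP => // h2.
  by rewrite (_ : u + a = 0) ?mul0r //; lra.
Qed.

(* Height of t over the line of slope T through 0. *)
Definition ell (T : R) t := im t - re t * T.

Lemma ellD T t u : ell T (t + u) = ell T t + ell T u.
Proof. by rewrite /ell reD imD; ring. Qed.
Lemma ellN T t : ell T (- t) = - ell T t.
Proof. by rewrite /ell reN imN; ring. Qed.
Lemma ellZ T (s : R) t : ell T (ofR s * t) = s * ell T t.
Proof. by rewrite /ell reMofR imMofR; ring. Qed.

Lemma sqrt_epsE w : sqrt_eps w = ofR (nm (sqrt_eps w)) *
  (ofR (cos (arg_sqrt w)) + ofR (sin (arg_sqrt w)) * iC).
Proof.
have aE : arg_sqrt w = im (w / 2).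
  by rewrite (_ : w / 2 = ofR (2^-1) * w) ?imMofR 1?mulrC // ofRV ofR_nat mulrC.
rewrite aE /sqrt_eps nm_cexp; move: (re_cexp (w / 2)) (im_cexp (w / 2)).
move: (w / 2) => v; set E := expR _; set c := cos _; set s := sin _ => hr hi.
by apply: Cplx_eq; rewrite ?hr ?hi !(reM, imM, reD, imD, re_ofR, im_ofR, re_iC, im_iC); ring.
Qed.

Lemma PperE w : Pper w = ofR (- (pi / nm (sqrt_eps w))) *
  (ofR (sin (arg_sqrt w)) + ofR (cos (arg_sqrt w)) * iC).
Proof.
apply: (mulfI (sqrt_eps_neq0 w)); rewrite sqrt_Pper {1}sqrt_epsE.
have m0 : nm (sqrt_eps w) != 0 by rewrite nm_eq0 sqrt_eps_neq0.
set m := nm _ in m0 *; set c := cos _; set s := sin _.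
have cs : c * c + s * s = 1 by rewrite -!expr2 cos2Dsin2.
apply: Cplx_eq; rewrite ?reN ?imN !(reM, imM, reD, imD, re_ofR, im_ofR, re_iC, im_iC).
  by field.
by rewrite -[pi in LHS]mulr1 -cs; field.
Qed.

Lemma Pper_re w : re (Pper w) = - (pi / nm (sqrt_eps w)) * sin (arg_sqrt w).
Proof. by rewrite PperE reMofR reD re_ofR reMofR re_iC mulr0 addr0. Qed.

Lemma Pper_im w : im (Pper w) = - (pi / nm (sqrt_eps w)) * cos (arg_sqrt w).
Proof. by rewrite PperE imMofR imD im_ofR imMofR im_iC mulr1 add0r. Qed.

End Covering.

(** * Trigonometric bounds *)

Section Trigonometry.
Variable R : realType.
Implicit Types x y : R.

Lemma cos_sqr_ge_half y : `|y| <= pi / 4 -> 1 / 2 <= cos y ^+ 2.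
Proof.
rewrite ler_norml => /andP[h1 h2].
have : 0 <= cos (y + y) by apply: cos_ge0_pihalf; apply/andP; split; lra.
by rewrite cosD; have := cos2Dsin2 y; lra.
Qed.

(** Mean value theorem, with cos decreasing. The limit 3 pi / 8 is the sum pi / 4 + pi / 8 that
    bounds the imaginary part in [csinh_curve]. *)
Lemma sin_sqr_ge y : `|y| <= 3 * pi / 8 -> (cos (3 * pi / 8) * y) ^+ 2 <= sin y ^+ 2.
Proof.
have p0 := pi_gt0 R.
have c0 : 0 < cos (3 * pi / 8 : R) by apply: cos_gt0_pihalf; apply/andP; split; lra.
have pos x : 0 <= x <= 3 * pi / 8 -> cos (3 * pi / 8) * x <= sin x.
  move=> /andP[x0 x1].
  have [|c] := @MVT_segment R sin cos 0 x x0 (fun y _ => is_derive_sin y).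
    by apply: continuous_subspaceT => z; exact: continuous_sin.
  rewrite in_itv /= sin0 !subr0 => /andP[c1 c2] ->; rewrite ler_wpM2r //.
  have [->//|cl] := eqVneq c (3 * pi / 8).
  by apply: ltW; rewrite ltr_cos ?in_itv /= ?lt_neqAle ?cl //; apply/andP; split; lra.
have sq x : 0 <= x <= 3 * pi / 8 -> (cos (3 * pi / 8) * x) ^+ 2 <= sin x ^+ 2.
  move=> hx; have := pos _ hx; have : 0 <= cos (3 * pi / 8) * x.
    by rewrite mulr_ge0 ?(ltW c0) //; case/andP: hx.
  by move=> k1 k2; rewrite -subr_ge0 subr_sqr mulr_ge0 //; lra.
move=> hy; have [y0|y0] := leP 0 y.
  by apply: sq; rewrite y0 -(ger0_norm y0).
rewrite -(sqrrN (sin y)) -sinN -(sqrrN (_ * y)) -mulrN.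
by apply: sq; rewrite oppr_ge0 (ltW y0) -(ltr0_norm y0).
Qed.

Lemma ltr_cos_sin x y : 0 < x -> pi / 2 + x <= y -> y <= 3 * pi / 2 - x -> sin x <= - cos y.
Proof.
move=> x0 h1 h2; have p0 := pi_gt0 R.
have key z : pi / 2 + x <= z <= pi -> sin x <= - cos z.
  move=> /andP[z1 z2]; rewrite -(opprK (sin x)) lerN2.
  have -> : - sin x = cos (pi / 2 + x) by rewrite cosD cos_pihalf sin_pihalf; ring.
  have [<-//|ne] := eqVneq (pi / 2 + x) z.
  by apply: ltW; rewrite ltr_cos ?in_itv /= ?lt_neqAle ?ne //; apply/andP; split; lra.
have [yp|yp] := leP y pi; first by apply: key; rewrite h1 yp.
have -> : cos y = cos (2 * pi - y).
  rewrite (_ : 2 * pi - y = pi + (pi - y)); last by ring.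
  by rewrite cosD cosB sinB cospi sinpi; ring.
by apply: key; apply/andP; split; lra.
Qed.

End Trigonometry.

(** * The domains in the t-plane for one parameter *)

Section Domain.
Variables (R : realType) (g : geometry R) (w : Cplx R).
Notation C := (Cplx R).
Notation gam := (g_gamma g).
Notation m := (nm (sqrt_eps w)).
Notation th := (theta g w).
Notation ph := (arg_sqrt w).
Notation T := (tan th).
Notation L := (ell T (Pper w)).
Notation sa := (sin (2 * gam ^+ 2 / pi)).
Implicit Types (t : C).

Hypothesis gam0 : 0 < gam.
Hypothesis gam1 : gam * (1 + 2 * gam / pi) < pi / 2.
Hypothesis wS : pi - 2 * gam < im w < 3 * pi + 2 * gam.

Let p0 : 0 < pi :> R := pi_gt0 R.
Let pn0 : pi != 0 :> R := lt0r_neq0 p0.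

Lemma al0_gt0 : 0 < 2 * gam ^+ 2 / pi.
Proof. by rewrite divr_gt0 // mulr_gt0 // exprn_gt0. Qed.

Lemma gamE : gam * (1 + 2 * gam / pi) = gam + 2 * gam ^+ 2 / pi.
Proof. by rewrite mulrDr mulr1; congr (_ + _); rewrite expr2; ring. Qed.

Lemma al0_lt : 2 * gam ^+ 2 / pi < pi / 2.
Proof. by move: gam1; rewrite gamE; have := gam0; lra. Qed.

Lemma sa_gt0 : 0 < sa.
Proof. by apply: sin_gt0_pi; have := al0_gt0; have := al0_lt; move=> a b; apply/andP; split; lra. Qed.

Lemma ph_range : pi / 2 - gam < ph < 3 * pi / 2 + gam.
Proof. by rewrite /arg_sqrt; move: wS => /andP[h1 h2]; apply/andP; split; lra. Qed.

Lemma thE : th = 2 * gam - 2 * gam * ph / pi.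
Proof.
have E (p x y : R) : p != 0 -> 2 * x / p * (p - y) = 2 * x - 2 * x * y / p by move=> ?; field.
exact: E.
Qed.

Lemma th_bound : - (gam * (1 + 2 * gam / pi)) < th < gam * (1 + 2 * gam / pi).
Proof.
have /andP[h1 h2] := ph_range; rewrite thE gamE.
have k0 : 0 < 2 * gam / pi by rewrite divr_gt0 // mulr_gt0.
have e1 : 2 * gam * ph / pi = 2 * gam / pi * ph by ring.
have e2 : 2 * gam ^+ 2 / pi = 2 * gam / pi * gam by ring.
have e3 : gam = 2 * gam / pi * (pi / 2).
  have E (p x : R) : p != 0 -> x = 2 * x / p * (p / 2) by move=> ?; field.
  exact: E.
have m1 : 2 * gam / pi * (pi / 2 - gam) < 2 * gam / pi * ph by rewrite ltr_pM2l.
have m2 : 2 * gam / pi * ph < 2 * gam / pi * (3 * pi / 2 + gam) by rewrite ltr_pM2l.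
have e4 : 2 * gam / pi * (3 * pi / 2 + gam) = 3 * (2 * gam / pi * (pi / 2)) + 2 * gam / pi * gam by ring.
by rewrite e1 e2; move: m1 m2; rewrite mulrBr e4 -e3 => m1 m2; apply/andP; split; lra.
Qed.

Lemma cos_th : 0 < cos th.
Proof.
by have /andP[h1 h2] := th_bound; apply: cos_gt0_pihalf; apply/andP; split; have := gam1; lra.
Qed.

(** theta is affine in arg sqrt eps with slope - 2 gam / pi > -1, so the sum increases and its
    extremes are at the ends of the sector. Hence sqrt eps e^{i theta} points into the left
    half-plane with a fixed margin: along lines of slope T, Re (sqrt eps t) tends to -oo to the
    right, where x(t) tends to x_L, and to +oo to the left, where x(t) tends to x_R. *)
Lemma phth_range : pi / 2 + 2 * gam ^+ 2 / pi <= ph + th <= 3 * pi / 2 - 2 * gam ^+ 2 / pi.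
Proof.
have /andP[h1 h2] := ph_range; rewrite thE.
have k0 : 0 < 1 - 2 * gam / pi.
  rewrite subr_gt0 ltr_pdivrMr // mul1r.
  have := gam1; have := al0_gt0; rewrite gamE; lra.
have e1 : ph + (2 * gam - 2 * gam * ph / pi) = 2 * gam + ph * (1 - 2 * gam / pi) by ring.
have m1 : (pi / 2 - gam) * (1 - 2 * gam / pi) <= ph * (1 - 2 * gam / pi) by rewrite ler_pM2r // ltW.
have m2 : ph * (1 - 2 * gam / pi) <= (3 * pi / 2 + gam) * (1 - 2 * gam / pi) by rewrite ler_pM2r // ltW.
have e2 : (pi / 2 - gam) * (1 - 2 * gam / pi) = pi / 2 - 2 * gam + 2 * gam ^+ 2 / pi.
  have E (p x : R) : p != 0 -> (p / 2 - x) * (1 - 2 * x / p) = p / 2 - 2 * x + 2 * x ^+ 2 / p.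
    by move=> ?; field.
  exact: E.
have e3 : (3 * pi / 2 + gam) * (1 - 2 * gam / pi) = 3 * pi / 2 - 2 * gam - 2 * gam ^+ 2 / pi.
  have E (p x : R) : p != 0 ->
      (3 * p / 2 + x) * (1 - 2 * x / p) = 3 * p / 2 - 2 * x - 2 * x ^+ 2 / p.
    by move=> ?; field.
  exact: E.
by rewrite e1; move: m1 m2; rewrite e2 e3 => m1 m2; apply/andP; split; lra.
Qed.

Lemma S_ge : sa <= - cos (ph + th).
Proof. by have /andP[h1 h2] := phth_range; apply: ltr_cos_sin => //; exact: al0_gt0. Qed.

Lemma LE : L = pi / m * - cos (ph + th) / cos th.
Proof.
have c0 := cos_th; have m0 := sqrt_eps_gt0 w.
by rewrite /ell Pper_re Pper_im /tan cosD; field; rewrite !gt_eqF.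
Qed.

Lemma L_gt0 : 0 < L.
Proof.
have m0 := sqrt_eps_gt0 w.
rewrite LE !mulr_gt0 ?invr_gt0 ?cos_th //.
exact: lt_le_trans sa_gt0 S_ge.
Qed.

(** L is the vertical distance between consecutive lines of slope T through the poles of x(t). It
    has size at least 1 / |sqrt eps| up to a constant, and c0 and [c2] are measured against it. *)
Lemma L_ge : pi / m * sa <= L.
Proof.
have m0 := sqrt_eps_gt0 w; have c0 := cos_th.
rewrite LE ler_pdivlMr //; apply: le_trans (_ : pi / m * sa <= _).
  by rewrite ler_piMr // ?cos_le1 // !mulr_ge0 ?invr_ge0 ?(ltW p0) ?(ltW m0) ?(ltW sa_gt0).
by rewrite ler_wpM2l ?S_ge // divr_ge0 // ltW.
Qed.

Lemma oblique_coord (P t : C) (c s lam : R) : c != 0 -> ell (s / c) t = lam * ell (s / c) P ->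
  t = ofR lam * P + ofR ((re t - lam * re P) / c) * (ofR c + ofR s * iC).
Proof.
rewrite /ell => c0 ht.
have it : im t = lam * (im P - re P * (s / c)) + re t * (s / c) by rewrite -ht; ring.
by apply: Cplx_eq; rewrite !(reM, imM, reD, imD, re_ofR, im_ofR, re_iC, im_iC) ?it; field.
Qed.

Lemma sqrt_t_coord t (lam : R) : ell T t = lam * L ->
  exists rho, [/\ re (sqrt_eps w * t) = rho * cos (ph + th),
    im (sqrt_eps w * t) = - (pi * lam) + rho * sin (ph + th) &
    rho * cos th = m * (re t - lam * re (Pper w))].
Proof.
move=> ht; have c0 := cos_th; have m0 := sqrt_eps_gt0 w.
pose r := (re t - lam * re (Pper w)) / cos th.
have tE : t = ofR lam * Pper w + ofR r * (ofR (cos th) + ofR (sin th) * iC).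
  exact: (oblique_coord (lt0r_neq0 c0) ht).
have rE : m * r * cos th = m * (re t - lam * re (Pper w)) by rewrite /r -mulrA divfK // gt_eqF.
exists (m * r).
have -> : sqrt_eps w * t = ofR lam * (sqrt_eps w * Pper w) +
    ofR r * (sqrt_eps w * (ofR (cos th) + ofR (sin th) * iC)) by rewrite {1}tE; ring.
have polar (c s c' s' : R) : (ofR c + ofR s * iC) * (ofR c' + ofR s' * iC) =
    ofR (c * c' - s * s') + ofR (s * c' + c * s') * iC :> C.
  by apply: Cplx_eq; rewrite !(reM, imM, reD, imD, re_ofR, im_ofR, re_iC, im_iC); ring.
have -> : sqrt_eps w * (ofR (cos th) + ofR (sin th) * iC) =
    ofR m * (ofR (cos (ph + th)) + ofR (sin (ph + th)) * iC).
  by rewrite {1}sqrt_epsE -mulrA polar -cosD -sinD.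
split; last exact: rE.
all: rewrite sqrt_Pper; move: (cos (ph + th)) (sin (ph + th)) => c s; move: m => m'.
all: by rewrite !(reM, imM, reD, imD, reN, imN, re_ofR, im_ofR, re_iC, im_iC); ring.
Qed.

(** Halfway between two rows of poles the shift is pi / 2, so the sine becomes the cosine of y = rho
    sin (ph + th). Either y is small and cos^2 y >= 1 / 2, or rho is large and the real part rho cos
    (ph + th) makes sinh large. *)
Lemma csinh_midline t : `|ell T t| = L / 2 -> sa ^+ 2 / 64 <= nm (csinh (sqrt_eps w * t)) ^+ 2.
Proof.
move=> ht; have [lam lamE hlam] : exists2 lam, (lam = 1/2 \/ lam = - (1 / 2)) & ell T t = lam * L.
  move: ht; have [h|h] := leP 0 (ell T t).
    by rewrite ger0_norm // => ->; exists (1/2); [left|ring].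
  by rewrite ltr0_norm // => h2; exists (- (1/2)); [right|rewrite -(opprK (ell T t)) h2; ring].
have [rho [h1 h2 _]] := sqrt_t_coord hlam.
rewrite nm2_csinh h1 h2.
have sa0 := sa_gt0; have sa1 : sa <= 1 by exact: sin_le1.
have Sge := S_ge; set S := - cos (ph + th) in Sge.
set y := rho * sin (ph + th).
have sE : sin (- (pi * lam) + y) ^+ 2 = cos y ^+ 2.
  have p2 : cos (pi * lam) = 0 /\ sin (pi * lam) ^+ 2 = 1.
    case: lamE => ->.
      by rewrite mul1r cos_pihalf sin_pihalf expr1n.
    by rewrite mul1r mulrN cosN sinN sqrrN cos_pihalf sin_pihalf expr1n.
  rewrite sinD cosN sinN p2.1 mul0r addr0 exprMn sqrrN p2.2 mul1r //.
rewrite sE; have s2 := sqr_ge0 (cos y); have s3 := sqr_ge0 (sh (rho * cos (ph + th))).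
have [yl|yl] := leP `|y| (pi / 4).
  have := cos_sqr_ge_half yl; have : sa ^+ 2 <= 1 by rewrite expr_le1 // ltW.
  lra.
have := sh_sqr_ge (rho * cos (ph + th)).
have rl : pi / 4 < `|rho|.
  by apply: lt_le_trans yl _; rewrite /y normrM ler_piMr // ler_norml sin_geN1 sin_le1.
have p2 := pi_ge2 R.
have rho2 : 1 / 4 <= rho ^+ 2.
  by rewrite -real_normK ?num_real // expr2; nra.
have : sa ^+ 2 <= cos (ph + th) ^+ 2.
  by rewrite -(sqrrN (cos _)) -/S; rewrite lerXn2r ?nnegrE //; lra.
rewrite exprMn; have := sqr_ge0 sa; nra.
Qed.

(** The smaller of the two bounds found in [csinh_curve]: by sinh^2 when the real part of sqrt eps t
    is at least min (sa pi / 8) (c2 / 2), by sin^2 otherwise. *)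
Definition curve_bound (c2 : R) := Num.min
  ((Num.min (sa * (pi / 8)) (c2 / 2)) ^+ 2 / 4)
  ((cos (3 * pi / 8) * (c2 / 2)) ^+ 2).

Lemma curve_bound_gt0 c2 : 0 < c2 -> 0 < curve_bound c2.
Proof.
move=> c20; have sa0 := sa_gt0.
have c0 : 0 < cos (3 * pi / 8 : R) by apply: cos_gt0_pihalf; have := p0; move=> ?; apply/andP; split; lra.
rewrite /curve_bound lt_min; apply/andP; split.
  by rewrite divr_gt0 // exprn_gt0 // lt_min divr_gt0 // mulr_gt0 // divr_gt0.
by rewrite exprn_gt0 // mulr_gt0 // divr_gt0.
Qed.

(** The poles of x(t) have heights in the multiples of L, so the strip contains only t = 0, which
    the bound on the abscissa excludes. If the real part of sqrt eps t is small then so is rho; the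
    imaginary part then lies between c2 / 2 and 3 pi / 8 in modulus, where the sine is bounded
    below. *)
Lemma csinh_curve t c2 : 0 < c2 -> `|ell T t| <= L / 4 -> c2 <= m * `|re t| ->
  curve_bound c2 <= nm (csinh (sqrt_eps w * t)) ^+ 2.
Proof.
move=> c20 ht hre; have L0 := L_gt0; have sa0 := sa_gt0.
have hlam : ell T t = (ell T t / L) * L by rewrite divfK // gt_eqF.
have [rho [h1 h2 _]] := sqrt_t_coord hlam.
have lam4 : `|ell T t / L| <= 1 / 4.
  by rewrite normrM normfV (gtr0_norm L0) ler_pdivrMr //; move: ht; lra.
move: (ell T t / L) lam4 h2 => lam lam4 h2.
have big : c2 <= nm (sqrt_eps w * t).
  by rewrite nmM; apply: le_trans hre _; rewrite ler_wpM2l ?nm_ge0 ?re_nm.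
set q := sqrt_eps w * t in h1 h2 big *.
have Sge := S_ge.
rewrite nm2_csinh /curve_bound.
pose r1 := Num.min (sa * (pi / 8)) (c2 / 2).
have r10 : 0 < r1 by rewrite lt_min divr_gt0 // mulr_gt0 // divr_gt0.
have r1a : r1 <= sa * (pi / 8) by rewrite ge_min lexx.
have r1b : r1 <= c2 / 2 by rewrite ge_min lexx orbT.
rewrite -/r1 ge_min; apply/orP.
have [hr|hr] := leP r1 `|re q|.
  left; have := sh_sqr_ge (re q); have := sqr_ge0 (sin (im q)).
  have : r1 ^+ 2 <= re q ^+ 2 by rewrite -(real_normK (num_real (re q))) lerXn2r ?nnegrE // ltW.
  lra.
right.
have rho8 : `|rho| <= pi / 8.
  have : `|rho| * sa <= sa * (pi / 8).
    apply: le_trans (le_trans (ltW hr) r1a); rewrite h1 normrM ler_wpM2l //.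
    by rewrite -normrN; apply: le_trans Sge (ler_norm _).
  by rewrite mulrC ler_pM2l.
have im8 : `|im q| <= 3 * pi / 8.
  rewrite h2; apply: le_trans (ler_normD _ _) _.
  rewrite normrN !normrM (gtr0_norm p0).
  have : `|rho| * `|sin (ph + th)| <= `|rho|.
    by rewrite ler_piMr // ler_norml sin_geN1 sin_le1.
  have : pi * `|lam| <= pi * (1 / 4) by rewrite ler_wpM2l // ltW.
  lra.
have imb : c2 / 2 <= `|im q|.
  have := nm_le q; lra.
apply: le_trans (_ : sin (im q) ^+ 2 <= _); last by rewrite lerDl sqr_ge0.
apply: le_trans (sin_sqr_ge im8).
rewrite !exprMn ler_wpM2l ?sqr_ge0 // -exprMn -(real_normK (num_real (im q))).
by rewrite lerXn2r ?nnegrE ?divr_ge0 // ltW.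
Qed.

Hypothesis c00 : 0 < g_c0 g.
Hypothesis c01 : g_c0 g <= pi / 4 * sa.
Hypothesis h0 : 0 < g_h g.
Hypothesis k0 : 0 < g_kappa g.
Hypothesis r0 : 0 < g_r g.

Notation sig := (sigma g w).

(** The flat part of sigma has half-length c0 / |sqrt eps|, the same scale as L, and the bound on c0
    makes the resulting offset at most L / 4. *)
Lemma thresholdT : g_c0 g / m * `|T| <= L / 4.
Proof.
have m0 := sqrt_eps_gt0 w; have c0 := cos_th; have Sge := S_ge.
have -> : g_c0 g / m * `|T| = (g_c0 g * `|sin th|) / (m * cos th).
  by rewrite /tan normrM normfV (gtr0_norm c0); field; rewrite !gt_eqF.
have -> : L / 4 = (pi / 4 * - cos (ph + th)) / (m * cos th).
  rewrite LE; move: (- cos _) pi_gt0 => S' _; have E (p x y z : R) : y != 0 -> z != 0 ->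
    p / y * x / z / 4 = p / 4 * x / (y * z) by move=> ? ?; field; apply/andP.
  by apply: E; rewrite gt_eqF.
rewrite ler_pM2r ?invr_gt0 ?mulr_gt0 //.
apply: le_trans (_ : g_c0 g * 1 <= _).
  by rewrite ler_wpM2l ?(ltW c00) // ler_norml sin_geN1 sin_le1.
by rewrite mulr1; apply: le_trans c01 _; rewrite ler_wpM2l ?S_ge // divr_ge0 // ltW.
Qed.

(** So the curve Im t = sigma (Re t) stays strictly between the two midlines, which have height - L
    / 2 and L / 2 over the line of slope T. *)
Lemma sigma_err u : `|sig u - u * T| <= L / 4.
Proof.
have a0 : 0 <= g_c0 g / m by rewrite divr_ge0 ?nm_ge0 // ltW.
rewrite sigmaE // -mulrBl normrM; apply: le_trans thresholdT.
by rewrite ler_wpM2r // shrink_err.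
Qed.

Lemma sigmaN u : sig (- u) = - sig u.
Proof.
have a0 : 0 <= g_c0 g / m by rewrite divr_ge0 ?nm_ge0 // ltW.
by rewrite !sigmaE // shrinkN // mulNr.
Qed.

Lemma sigma_lip u v : `|sig u - sig v| <= `|T| * `|u - v|.
Proof.
have a0 : 0 <= g_c0 g / m by rewrite divr_ge0 ?nm_ge0 // ltW.
rewrite !sigmaE // -mulrBl normrM mulrC ler_wpM2l //.
have [uv|/ltW uv] := leP u v.
  have /andP[h1 h2] := shrink_le a0 uv.
  by rewrite distrC ger0_norm // distrC ger0_norm // subr_ge0.
have /andP[h1 h2] := shrink_le a0 uv.
by rewrite ger0_norm // ger0_norm // subr_ge0.
Qed.

Lemma sigma_incr u v : 0 <= T -> u <= v -> sig u <= sig v.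
Proof.
have a0 : 0 <= g_c0 g / m by rewrite divr_ge0 ?nm_ge0 // ltW.
move=> T0 uv; rewrite !sigmaE // ler_wpM2r //.
by have /andP[h1 _] := shrink_le a0 uv; rewrite -subr_ge0.
Qed.

Lemma sigma_decr u v : T <= 0 -> u <= v -> sig v <= sig u.
Proof.
have a0 : 0 <= g_c0 g / m by rewrite divr_ge0 ?nm_ge0 // ltW.
move=> T0 uv; rewrite !sigmaE // ler_wnM2r //.
by have /andP[h1 _] := shrink_le a0 uv; rewrite -subr_ge0.
Qed.

(** A pointwise condition that excludes t from N. Unlike the complement of a connected component it
    is visibly open and symmetric under t -> - t. *)
Definition inside t := csinh (sqrt_eps w * t) != 0 /\ nm (xt w t) < g_r g.

Lemma insideN t : inside t -> inside (- t).
Proof. by move=> [h1 h2]; split; [rewrite csinhN_eq0|rewrite xtN nmN]. Qed.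

Lemma inside_Nset t : inside t -> ~ Nset g w t.
Proof.
move=> [h1 h2] /connected_component_sub /= [h|]; first by move: h1; rewrite h eqxx.
by rewrite norm_nm ofR_le leNgt h2.
Qed.

Lemma GammaD_intro t : inside t -> im t < g_h g + sig (re t) ->
  - ((2^-1 + g_kappa g) * L) < ell T t -> Gamma g sD w t.
Proof.
move=> /inside_Nset h1 h2 h3; split => //.
rewrite /line_height; move: h3; rewrite /ell imN reN imMofR reMofR; lra.
Qed.

Lemma GammaU_intro t : inside t -> - g_h g + sig (re t) < im t ->
  ell T t < (2^-1 + g_kappa g) * L -> Gamma g sU w t.
Proof.
move=> /inside_Nset h1 h2 h3; split => //.
rewrite /line_height; move: h3; rewrite /ell imMofR reMofR; lra.
Qed.

Lemma kL : 0 < g_kappa g * L. Proof. by rewrite mulr_gt0 // L_gt0. Qed.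

Lemma GammaD_midline t : inside t -> ell T t = - (L / 2) -> Gamma g sD w t.
Proof.
move=> it ht; have L0 := L_gt0; have k1 := kL; apply: GammaD_intro => //.
  have := sigma_err (re t); rewrite ler_norml => /andP[e1 e2].
  have := h0; have : im t = ell T t + re t * T by rewrite /ell subrK.
    by rewrite ht; lra.
by rewrite ht; lra.
Qed.

Lemma GammaU_midline t : inside t -> ell T t = L / 2 -> Gamma g sU w t.
Proof.
move=> it ht; have L0 := L_gt0; have k1 := kL; apply: GammaU_intro => //.
  have := sigma_err (re t); rewrite ler_norml => /andP[e1 e2].
  have := h0; have : im t = ell T t + re t * T by rewrite /ell subrK.
    by rewrite ht; lra.
by rewrite ht; lra.
Qed.

Definition small (s : R) := nm (eps w) * (1 + s^-1) < g_r g ^+ 2.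

Lemma inside_small s t : 0 < s -> small s -> s <= nm (csinh (sqrt_eps w * t)) ^+ 2 -> inside t.
Proof.
move=> s0 hs ht; have [h1 h2] := nm_xt s0 ht; split => //.
have := le_lt_trans h2 hs; rewrite ltr_pXn2r // ?nnegrE ?nm_ge0 // ltW //.
Qed.

Lemma inside_midline t : small (sa ^+ 2 / 64) -> `|ell T t| = L / 2 -> inside t.
Proof.
move=> hs ht; apply: inside_small hs _; last exact: csinh_midline.
by rewrite divr_gt0 // exprn_gt0 // sa_gt0.
Qed.

(** The curve halfway between the upper boundary sigma + h of Gamma_D and the lower boundary sigma -
    h of Gamma_U. It runs through their overlap and provides explicit paths to Re t = +oo and
    -oo. *)
Definition curve (u : R) : C := ofR u + ofR (sig u) * iC.

Lemma re_curve u : re (curve u) = u.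
Proof. by rewrite /curve !(reM, imM, reD, imD, re_ofR, im_ofR, re_iC, im_iC); ring. Qed.
Lemma im_curve u : im (curve u) = sig u.
Proof. by rewrite /curve !(reM, imM, reD, imD, re_ofR, im_ofR, re_iC, im_iC); ring. Qed.

Lemma curve_eq t : im t = sig (re t) -> t = curve (re t).
Proof. by move=> h; apply: Cplx_eq; rewrite ?re_curve ?im_curve. Qed.

Lemma curve_ell u : `|ell T (curve u)| <= L / 4.
Proof. by rewrite /ell re_curve im_curve sigma_err. Qed.

Lemma curve_Gamma u : inside (curve u) -> Gamma g sD w (curve u) /\ Gamma g sU w (curve u).
Proof.
move=> iu; have L0 := L_gt0; have k1 := kL.
have := curve_ell u; rewrite ler_norml => /andP[e1 e2].
split; [apply: GammaD_intro|apply: GammaU_intro] => //; rewrite ?re_curve ?im_curve; have := h0; lra.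
Qed.

Lemma curve_nm u v : nm (curve u - curve v) <= (1 + `|T|) * `|u - v|.
Proof.
rewrite (_ : curve u - curve v = ofR (u - v) + ofR (sig u - sig v) * iC); last first.
  by rewrite /curve !ofRB; ring.
apply: le_trans (nmD _ _) _; rewrite nmM nm_iC mulr1 !nm_ofR mulrDl mul1r lerD2l.
exact: sigma_lip.
Qed.

Lemma curve_continuous : continuous curve.
Proof.
move=> u; apply/cvg_nmP => e e0; have K0 : 0 < 1 + `|T| by rewrite ltr_pwDl.
apply/nbhs_ballP; exists (e / (1 + `|T|)); first by rewrite /= divr_gt0.
move=> v; rewrite /ball /= ltr_pdivlMr // distrC mulrC => hv.
exact: le_lt_trans (curve_nm v u) hv.
Qed.

Lemma curve_component (u v : R) : (forall s, Num.min u v <= s <= Num.max u v -> inside (curve s)) ->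
  connected_component (Gamma g sD w `&` Gamma g sU w) (curve u) (curve v).
Proof.
move=> hin; pose B := curve @` `[Num.min u v, Num.max u v].
have uB : B (curve u) by exists u => //=; rewrite in_itv /= ge_min lexx le_max lexx.
have vB : B (curve v) by exists v => //=; rewrite in_itv /= ge_min lexx le_max lexx !orbT.
apply: (connected_component_max uB) vB.
- move=> _ [s hs <-]; apply: curve_Gamma; apply: hin.
  by move: hs; rewrite /= in_itv.
- apply: connected_continuous_connected; first exact: segment_connected.
  by apply: continuous_subspaceT; exact: curve_continuous.
Qed.

Section Components.
Variable c2 : R.
Hypothesis c20 : 0 < c2.
Hypothesis smallc : small (curve_bound c2).

Lemma inside_curve u : c2 <= m * `|u| -> inside (curve u).
Proof.
move=> hu; apply: inside_small smallc _; first exact: curve_bound_gt0.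
by apply: csinh_curve => //; rewrite ?re_curve ?curve_ell.
Qed.

Lemma curve_OmegaL u : 0 < u -> c2 <= m * u -> OmegaLR g pL w (xt w (curve u)).
Proof.
move=> u0 hu; exists (curve u) => // M; exists (curve (Num.max u (M + 1))).
  apply: curve_component => s.
  have -> : Num.min u (Num.max u (M + 1)) = u by apply/min_idPl; rewrite le_max lexx.
  move=> /andP[us _]; apply: inside_curve; apply: le_trans hu _.
  by rewrite ler_wpM2l ?nm_ge0 //; apply: le_trans us (ler_norm _).
by rewrite re_curve lt_max ltrDl ltr01 orbT.
Qed.

End Components.
End Domain.

Lemma opp_inside (R : realType) (g : geometry R) (w w' t : Cplx R) :
  sqrt_eps w' = - sqrt_eps w -> inside g w t -> inside g w' t.
Proof.
move=> e [h1 h2]; split; last by rewrite (xt_opp _ e).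
by rewrite e mulNr csinhN oppr_eq0.
Qed.

(** Used with x = T1 and y = T2 of opposite signs, u the abscissa of a crossing point and k the
    shrunk value of u. If x u were not positive, both k x and - u y would be at most 0, against k x
    - u y = l > 0. *)
Lemma sign_aux (R : realType) (x y u k l : R) : 0 < l -> k * x - u * y = l ->
  `|k| <= `|u| -> 0 <= u * k -> (0 < x /\ y < 0) \/ (x < 0 /\ 0 < y) -> 0 < x * u.
Proof.
move=> l0 e k1 k2 sg.
have neg (v c : R) : v <= 0 -> `|c| <= `|v| -> 0 <= v * c -> c <= 0.
  rewrite le_eqVlt => /orP[/eqP -> |v0 _].
    by rewrite normr0 normr_le0 => /eqP ->.
  by rewrite nmulr_rge0.
case: sg => -[x0 y0].
  rewrite pmulr_rgt0 // ltNge; apply/negP => u0; have k0 := neg _ _ u0 k1 k2.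
  have : k * x <= 0 by rewrite pmulr_lle0.
  have : 0 <= u * y by rewrite nmulr_lge0.
  lra.
rewrite nmulr_rgt0 // ltNge; apply/negP => u0.
have nu : - u <= 0 by rewrite oppr_le0.
have := neg (- u) (- k) nu; rewrite !normrN mulrNN => /(_ k1 k2); rewrite oppr_le0 => k0.
have : k * x <= 0 by rewrite nmulr_lle0.
have : 0 <= u * y by rewrite pmulr_lge0.
lra.
Qed.

(** * Paths between the domains of two parameters *)

Section TwoParameters.
Variables (R : realType) (g : geometry R) (w1 w2 : Cplx R).
Notation C := (Cplx R).
Notation gam := (g_gamma g).
Notation sa := (sin (2 * gam ^+ 2 / pi)).
Notation T1 := (tan (theta g w1)).
Notation T2 := (tan (theta g w2)).
Notation L1 := (ell T1 (Pper w1)).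
Notation L2 := (ell T2 (Pper w2)).
Notation a0 := (gam * (1 + 2 * gam / pi)).

Hypothesis gam0 : 0 < gam.
Hypothesis gam1 : a0 < pi / 2.
Hypothesis S1 : pi - 2 * gam < im w1 < 3 * pi + 2 * gam.
Hypothesis S2 : pi - 2 * gam < im w2 < 3 * pi + 2 * gam.
Hypothesis c00 : 0 < g_c0 g.
Hypothesis c01 : g_c0 g <= pi / 4 * sa.
Hypothesis h0 : 0 < g_h g.
Hypothesis k0 : 0 < g_kappa g.
Hypothesis r0 : 0 < g_r g.
Hypothesis opp : sqrt_eps w2 = - sqrt_eps w1.

(** At the crossing point of an edge with the curve, of abscissa u, L2 / 2 <= |u| (|T1| + |T2|) with
    slopes at most 1 / cos a0, and L2 >= pi sa / |sqrt eps|. Together these bound |sqrt eps| |u|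
    below by this constant. *)
Definition c2 : R := pi * sa * cos a0 / 4.

Lemma opp_nm : nm (sqrt_eps w2) = nm (sqrt_eps w1). Proof. by rewrite opp nmN. Qed.
Lemma opp_Pper : Pper w2 = - Pper w1. Proof. by rewrite /Pper opp invrN mulrN. Qed.
Lemma cos_a0 : 0 < cos a0.
Proof.
have := pi_gt0 R; have : 0 < a0 by rewrite mulr_gt0 // ltr_wpDr ?ltr01 // divr_ge0 ?mulr_ge0 ?(ltW gam0) ?pi_ge0.
by move=> ? ?; apply: cos_gt0_pihalf; apply/andP; split; have := gam1; lra.
Qed.

Lemma c2_gt0 : 0 < c2.
Proof. by rewrite divr_gt0 // !mulr_gt0 ?pi_gt0 ?sa_gt0 // cos_a0. Qed.

Lemma tan_bound w : pi - 2 * gam < im w < 3 * pi + 2 * gam -> `|tan (theta g w)| <= (cos a0)^-1.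
Proof.
move=> wS; have c0 := cos_th gam0 gam1 wS; have /andP[t1 t2] := th_bound gam0 wS.
have cc := cos_a0; have p0 := pi_gt0 R.
rewrite /tan normrM normfV (gtr0_norm c0).
apply: le_trans (_ : 1 / cos (theta g w) <= _).
  by rewrite ler_pM2r ?invr_gt0 // ler_norml sin_geN1 sin_le1.
rewrite mul1r lef_pV2 ?posrE //.
have ca (x : R) : cos `|x| = cos x by case: (leP 0 x) => h; rewrite ?(ger0_norm h) ?(ltr0_norm h) ?cosN.
rewrite -(ca (theta g w)).
have h : `|theta g w| < a0 by rewrite ltr_norml t1.
apply: ltW; rewrite ltr_cos // in_itv /=; apply/andP; split; rewrite ?normr_ge0 //; have := gam1.
- by have := normr_ge0 (theta g w); lra.
- by lra.
by lra.
Qed.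

(** The intersection of the midline of slope T1 through P1 / 2 with the midline of slope T2 through
    P2 / 2 = - P1 / 2. *)
Definition apex : C :=
  let u := (L2 - L1) / 2 / (T1 - T2) in ofR u + ofR (T1 * u + L1 / 2) * iC.

(** The segment from - P1 / 2 to the apex lies on the upper midline of [w2], hence in Gamma_U of
    [w2], while its height over the line of slope T1 rises from - L1 / 2 to L1 / 2: it passes from
    Gamma_D of [w1] to Gamma_U of [w1]. *)
Definition edge (s : R) : C := - (Pper w1 / 2) + ofR s * (apex + Pper w1 / 2).

(** The edge meets the middle curve of [w1] at the parameter [s1], above the abscissa [u1]. The sign
    of [u1] decides whether the passage takes place in Omega_L or in Omega_R. *)
Record edge_spec (s1 u1 : R) : Prop := SideSpec {
  ss_01 : 0 <= s1 <= 1;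
  ss_in : forall s : R, 0 <= s <= 1 -> inside g w1 (edge s);
  ss_D : forall s : R, 0 <= s <= s1 -> Gamma g sD w1 (edge s) /\ Gamma g sU w1 (- edge s);
  ss_U : forall s : R, s1 <= s <= 1 -> Gamma g sU w1 (edge s) /\ Gamma g sD w1 (- edge s);
  ss_2 : forall s : R, 0 <= s <= 1 -> Gamma g sU w2 (edge s) /\ Gamma g sD w2 (- edge s);
  ss_curve : edge s1 = curve g w1 u1 /\ - edge s1 = curve g w1 (- u1);
  ss_u1 : c2 <= nm (sqrt_eps w1) * `|u1|;
  ss_sign : 0 < T1 * u1
}.

Hypothesis signs : 0 < T1 /\ T2 < 0 \/ T1 < 0 /\ 0 < T2.
Hypothesis small_mid : small g w1 (sa ^+ 2 / 64).

Lemma half_ofR (z : C) : z / 2 = ofR (2^-1) * z.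
Proof. by rewrite ofRV ofR_nat mulrC. Qed.

Lemma apex_ell1 : ell T1 apex = L1 / 2.
Proof.
by rewrite /apex /=; set u := (_ / _ / _);
  rewrite {1}/ell !(reD, imD, reMofR, imMofR, re_ofR, im_ofR, re_iC, im_iC); ring.
Qed.

Lemma apex_ell2 : ell T2 apex = L2 / 2.
Proof.
have TT : T1 - T2 != 0 by case: signs => -[? ?]; [rewrite gt_eqF|rewrite lt_eqF]; lra.
have E (x y u v : R) : x - y != 0 -> x * ((v - u) / 2 / (x - y)) + u / 2 - (v - u) / 2 / (x - y) * y = v / 2.
  by move=> ?; field.
rewrite -(E _ _ L1 L2 TT).
by rewrite /apex /=; set u := (_ / _ / _);
  rewrite {1}/ell !(reD, imD, reMofR, imMofR, re_ofR, im_ofR, re_iC, im_iC); ring.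
Qed.

Lemma edge_ell1 s : ell T1 (edge s) = - (L1 / 2) + s * L1.
Proof. by rewrite /edge ellD ellN ellZ ellD apex_ell1 half_ofR ellZ; field. Qed.

Lemma edge_ell2 s : ell T2 (edge s) = L2 / 2.
Proof.
rewrite /edge ellD ellN ellZ ellD apex_ell2 half_ofR ellZ opp_Pper ellN.
by move: (ell T2 (Pper w1)) => x; field.
Qed.

Lemma edge_spec_exists : exists s1 u1, edge_spec s1 u1.
Proof.
have L10 := L_gt0 gam0 gam1 S1; have L20 := L_gt0 gam0 gam1 S2.
have small2 : small g w2 (sa ^+ 2 / 64) by rewrite /small nm_eps opp_nm -nm_eps.
have opp' : sqrt_eps w1 = - sqrt_eps w2 by rewrite opp opprK.
have in2 s : inside g w2 (edge s).
  by apply: inside_midline => //; rewrite edge_ell2 ger0_norm // divr_ge0 // ltW.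
have in1 s : inside g w1 (edge s).
  by apply: (opp_inside opp').
have err u := sigma_err gam0 gam1 S1 c00 c01 u.
have err2 u := sigma_err gam0 gam1 S2 c00 c01 u.
have k1 : 0 < g_kappa g * L1 by rewrite mulr_gt0.
have k2 : 0 < g_kappa g * L2 by rewrite mulr_gt0.
set v := apex + Pper w1 / 2.
have sv s : edge s = edge 0 + ofR s * v by rewrite /edge -/v ofR0; ring.
have reS s : re (edge s) = re (edge 0) + s * re v by rewrite {1}sv reD reMofR.
have imS s : im (edge s) = im (edge 0) + s * im v by rewrite {1}sv imD imMofR.
have v1 : ell T1 v = L1 by rewrite /v ellD apex_ell1 half_ofR ellZ; field.
have v2 : ell T2 v = 0.
  by rewrite /v ellD apex_ell2 half_ofR ellZ opp_Pper ellN; move: (ell T2 _) => x; field.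
have imv : im v = re v * T2 by move: v2; rewrite /ell; lra.
have rev : re v * (T2 - T1) = L1 by move: v1; rewrite {1}/ell imv; lra.
(* The height over the middle curve of [w1]. Along the edge Im t does not decrease, and sigma does
   not increase because Re t moves against the sign of T1. So d is nondecreasing: the condition of
   Gamma_D holds up to its zero s1, that of Gamma_U from there on. *)
pose d s := im (edge s) - sigma g w1 (re (edge s)).
have d_mono s s' : s <= s' -> d s <= d s'.
  move=> ss; rewrite /d (imS s) (imS s') (reS s) (reS s').
  have sgn : (0 <= T1 /\ re v <= 0) \/ (T1 <= 0 /\ 0 <= re v).
    have rT : 0 < re v * (T2 - T1) by rewrite rev.
    case: signs => -[t1 t2]; [left|right]; split; rewrite ?(ltW t1) //.
      by apply: ltW; rewrite -(nmulr_lgt0 _ (_ : T2 - T1 < 0)) //; lra.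
    by apply: ltW; rewrite -(pmulr_lgt0 _ (_ : 0 < T2 - T1)) //; lra.
  have im0 : 0 <= im v.
    rewrite imv; case: signs => -[t1 t2]; case: sgn => -[t3 rv]; try lra.
      by rewrite mulr_le0 // ltW.
    by rewrite mulr_ge0 // ltW.
  have : s * im v <= s' * im v by rewrite ler_wpM2r.
  suff : sigma g w1 (re (edge 0) + s' * re v) <= sigma g w1 (re (edge 0) + s * re v) by lra.
  case: sgn => -[t1 rv].
    by apply: sigma_incr => //; rewrite lerD2l ler_wnM2r.
  by apply: sigma_decr => //; rewrite lerD2l ler_wpM2r.
have d_lip s s' : `|d s - d s'| <= (`|im v| + `|T1| * `|re v|) * `|s - s'|.
  rewrite /d (_ : _ - _ = (im (edge s) - im (edge s')) -
    (sigma g w1 (re (edge s)) - sigma g w1 (re (edge s')))); last by ring.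
  apply: le_trans (ler_normB _ _) _; rewrite mulrDl; apply: lerD.
    by rewrite (imS s) (imS s') (_ : _ - _ = im v * (s - s')) ?normrM //; ring.
  apply: le_trans (sigma_lip _ _ _ _) _ => //.
  by rewrite (reS s) (reS s') (_ : _ - _ = re v * (s - s')) ?normrM ?mulrA //; ring.
have d_cont : continuous d.
  move=> s; apply/cvgrPdist_lt => e e0; pose K := `|im v| + `|T1| * `|re v| + 1.
  have K0 : 0 < K by rewrite ltr_wpDl // addr_ge0 // mulr_ge0.
  apply/nbhs_ballP; exists (e / K); first by rewrite /= divr_gt0.
  move=> s'; rewrite /ball /= ltr_pdivlMr // mulrC => hs.
  apply: le_lt_trans (d_lip _ _) _; apply: le_lt_trans hs.
  by rewrite ler_wpM2r // lerDl.
have imE (T : R) (t : C) : im t = ell T t + re t * T by rewrite /ell subrK.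
have d0 : d 0 < 0.
  rewrite /d (imE T1) edge_ell1 mul0r addr0.
  by have := err (re (edge 0)); rewrite ler_norml => /andP[? ?]; lra.
have d1 : 0 < d 1.
  rewrite /d (imE T1) edge_ell1 mul1r.
  by have := err (re (edge 1)); rewrite ler_norml => /andP[? ?]; lra.
have [|s1] := @IVT R d 0 1 0 ler01 (continuous_subspaceT d_cont).
  by rewrite ge_min le_max (ltW d0) (ltW d1) orbT.
rewrite in_itv /= => s101 ds1.
have sN t : sigma g w1 (- t) = - sigma g w1 t by exact: sigmaN.
have sN2 t : sigma g w2 (- t) = - sigma g w2 t by exact: sigmaN.
pose u1 := re (edge s1).
have cE : edge s1 = curve g w1 u1 by apply: curve_eq; move: ds1; rewrite /d => /eqP; rewrite subr_eq0 => /eqP.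
(* At the crossing Im t = sigma, so the equation of the midline of [w2] reads shrink (u1) T1 - u1 T2
   = L2 / 2. Both the size and the sign of u1 follow from it. *)
have [ub us] : c2 <= nm (sqrt_eps w1) * `|u1| /\ 0 < T1 * u1.
  have m0 := sqrt_eps_gt0 w1; have cc := cos_a0; have p0 := pi_gt0 R.
  have a1 : 0 <= g_c0 g / nm (sqrt_eps w1) by rewrite divr_ge0 // ltW.
  have e2 := edge_ell2 s1; move: e2; rewrite {1}/ell -/u1.
  have -> : im (edge s1) = sigma g w1 u1 by rewrite cE im_curve.
  rewrite sigmaE //; set sk := shrink _ _ => e2.
  have Lge := L_ge gam0 gam1 S2; rewrite opp_nm in Lge.
  have tb1 := tan_bound S1; have tb2 := tan_bound S2.
  have [sk1 sk2] := shrink_norm u1 a1; rewrite -/sk in sk1 sk2.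
  split.
    have big : L2 / 2 <= `|u1| * (2 * (cos a0)^-1).
      apply: le_trans (_ : `|sk * T1| + `|u1 * T2| <= _).
        by rewrite -e2; apply: le_trans (ler_norm _) (ler_normB _ _).
      rewrite (normrM sk T1) (normrM u1 T2).
      have b1 : `|sk| * `|T1| <= `|u1| * (cos a0)^-1 by apply: ler_pM.
      have b2 : `|u1| * `|T2| <= `|u1| * (cos a0)^-1 by apply: ler_pM.
      have dbl (x y : R) : x * (2 * y) = x * y + x * y by ring.
      by rewrite dbl; exact: lerD.
    rewrite /c2.
    have h1 : pi * sa <= L2 * nm (sqrt_eps w1).
      by move: Lge; rewrite mulrAC ler_pdivrMr.
    have h2 : L2 / 2 * cos a0 <= `|u1| * 2.
      by move: big; rewrite mulrA ler_pdivlMr.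
    have h3 : pi * sa * cos a0 <= L2 * nm (sqrt_eps w1) * cos a0 by rewrite ler_pM2r.
    have h4 : nm (sqrt_eps w1) * (L2 / 2 * cos a0) <= nm (sqrt_eps w1) * (`|u1| * 2).
      by rewrite ler_pM2l.
    lra.
  by apply: (sign_aux _ e2 sk1 sk2 signs); rewrite divr_gt0.
have mk1 (s : R) : 0 <= s <= 1 -> Gamma g sU w2 (edge s) /\ Gamma g sD w2 (- edge s).
  by move=> _; split; [apply: GammaU_midline|apply: GammaD_midline] => //; rewrite ?ellN ?edge_ell2 //; exact: insideN.
have sE s : im (edge s) = d s + sigma g w1 (re (edge s)) by rewrite /d subrK.
clearbody d; exists s1, u1; split => //.
- move=> s /andP[s0 ss]; have ds := d_mono _ _ ss; rewrite ds1 in ds.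
  have b1 : 0 <= s * L1 by rewrite mulr_ge0 // ltW.
  split.
    apply: GammaD_intro => //; first by rewrite sE; have := h0; lra.
    by rewrite edge_ell1; lra.
  apply: GammaU_intro; first exact: insideN.
    by rewrite reN imN sN sE; have := h0; lra.
  by rewrite ellN edge_ell1; lra.
- move=> s /andP[ss s1']; have ds := d_mono _ _ ss; rewrite ds1 in ds.
  have b1 : s * L1 <= L1 by rewrite ler_piMl // ltW.
  split.
    apply: GammaU_intro => //; first by rewrite sE; have := h0; lra.
    by rewrite edge_ell1; lra.
  apply: GammaD_intro; first exact: insideN.
    by rewrite reN imN sN sE; have := h0; lra.
  by rewrite ellN edge_ell1; lra.
- split => //; rewrite cE /curve sN !ofRN; ring.
Qed.

End TwoParameters.

(** * Polygonal paths and continuation along them *)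

Section Paths.
Variable R : realType.
Notation C := (Cplx R).
Implicit Types (p q v t : C) (A : C -> Prop).

Definition path_continuous (k : R -> C) := forall s : R, 0 <= s <= 1 -> forall e : R, 0 < e ->
  exists2 d : R, 0 < d & forall s' : R, 0 <= s' <= 1 -> `|s' - s| < d -> nm (k s' - k s) < e.

(** The real part is 0. If the imaginary part changed, the intermediate value theorem would produce
    an increment c in (0, pi] with cos c = 1. *)
Lemma path_continuous_exp_const k : path_continuous k ->
  (forall s : R, 0 <= s <= 1 -> cexp (k s) = 1) -> k 1 = k 0.
Proof.
move=> ck k1; have p0 := pi_gt0 R.
have rek s : 0 <= s <= 1 -> re (k s) = 0.
  move=> /k1 /(congr1 (@nm R)); rewrite nm_cexp nm1 -expR0 => /expR_inj //.
have imk s : 0 <= s <= 1 -> cos (im (k s)) = 1 /\ sin (im (k s)) = 0.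
  move=> hs; have e := k1 _ hs.
  have := congr1 (@re R) e; have := congr1 (@im R) e.
  by rewrite re_cexp im_cexp rek // expR0 !mul1r re1 im1.
have h0 : 0 <= (0 : R) <= 1 by rewrite lexx ler01.
have h1 : 0 <= (1 : R) <= 1 by rewrite ler01 lexx.

apply: Cplx_eq; first by rewrite !rek.
pose f s := im (k s).
have cf : {within `[0, 1], continuous f}.
  apply/subspace_continuousP => s; rewrite /= in_itv /= => hs.
  apply/cvgrPdist_lt => e e0; have [d d0 hd] := ck _ hs _ e0.
  rewrite near_withinE; apply/nbhs_ballP; exists d => // s' hs'; rewrite /= in_itv /= => hs1.
  rewrite distrC /f -imB; apply: le_lt_trans (im_nm _) _; apply: hd => //.
  by move: hs'; rewrite /ball /= distrC.
have ivt (v : R) : Num.min (f 0) (f 1) <= v <= Num.max (f 0) (f 1) -> cos v = 1 /\ sin v = 0.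
  move=> hv; have [c] := IVT ler01 cf hv.
  by rewrite in_itv /= => /imk hc <-.
have noc (c : R) : 0 < c <= pi -> cos c != 1.
  move=> /andP[c0 cp]; apply/eqP => cc; move: (c0); rewrite (_ : c = 0) ?ltxx //.
  apply: (@cos_inj R); last by rewrite cos0.
    by rewrite in_itv /= cp (ltW c0).
  by rewrite in_itv /= lexx (ltW p0).
apply/eqP; apply/negP => /negP ne.
have [c0 s0] := imk _ h0.
have [lt|lt|eq] := ltgtP (im (k 0)) (im (k 1)).
- pose c := Num.min (im (k 1) - im (k 0)) pi.
  have cp : 0 < c by rewrite lt_min subr_gt0 lt.
  have c1 : c <= im (k 1) - im (k 0) by rewrite ge_min lexx.
  have c2 : c <= pi by rewrite ge_min lexx orbT.
  have := ivt (im (k 0) + c); rewrite /f minEle maxEle (ltW lt) => -[].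
    by apply/andP; split; lra.
  rewrite cosD c0 s0 mul1r mul0r subr0 => h _.
  by move: (noc c); rewrite cp c2 h eqxx => /(_ isT).
- pose c := Num.min (im (k 0) - im (k 1)) pi.
  have cp : 0 < c by rewrite lt_min subr_gt0 lt.
  have c1 : c <= im (k 0) - im (k 1) by rewrite ge_min lexx.
  have c2 : c <= pi by rewrite ge_min lexx orbT.
  have nle : (im (k 0) <= im (k 1)) = false by rewrite leNgt lt.
  have := ivt (im (k 0) - c); rewrite /f minEle maxEle nle => -[].
    by apply/andP; split; lra.
  rewrite cosB c0 s0 mul1r mul0r addr0 => h _.
  by move: (noc c); rewrite cp c2 h eqxx => /(_ isT).
- by move: ne; rewrite eq eqxx.
Qed.

Lemma path_continuousB (k l : R -> C) : path_continuous k -> path_continuous l ->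
  path_continuous (fun s => k s - l s).
Proof.
move=> hk hl s hs e e0; have e20 : 0 < e / 2 by rewrite divr_gt0.
have [d d0 hd] := hk _ hs _ e20; have [d' d'0 hd'] := hl _ hs _ e20.
exists (Num.min d d'); first by rewrite lt_min d0.
move=> s' hs'; rewrite lt_min => /andP[/(hd _ hs') h1 /(hd' _ hs') h2].
rewrite (_ : _ - _ = (k s' - k s) - (l s' - l s)); last by ring.
by apply: le_lt_trans (nmB _ _) _; lra.
Qed.

Lemma affine_lip p v (s s' : R) : nm (p + ofR s' * v - (p + ofR s * v)) = `|s' - s| * nm v.
Proof.
rewrite (_ : _ - _ = ofR (s' - s) * v); last by rewrite ofRB; ring.
by rewrite nmM nm_ofR.
Qed.

Lemma ccont_path (f : C -> C) p v :
  (forall s : R, 0 <= s <= 1 -> ccont f (p + ofR s * v)) ->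
  path_continuous (fun s => f (p + ofR s * v)).
Proof.
move=> cf s hs e e0; have /ccontP /(_ _ e0)[d d0 hd] := cf _ hs.
have K0 : 0 < nm v + 1 by rewrite ltr_wpDl ?nm_ge0.
exists (d / (nm v + 1)); first by rewrite divr_gt0.
move=> s' hs' h; apply: hd; rewrite affine_lip.
move: h; rewrite ltr_pdivlMr //; apply: le_lt_trans.
by rewrite ler_wpM2l // lerDl.
Qed.

Lemma within_path (A : set (C * C)) (f : C * C -> C) (a b : R -> C) :
  {within A, continuous f} -> (forall s : R, 0 <= s <= 1 -> A (a s, b s)) ->
  path_continuous a -> path_continuous b -> path_continuous (fun s => f (a s, b s)).
Proof.
move=> /subspace_continuousP cf hA ca cb s hs e e0.
have := cf _ (hA _ hs) => /cvg_nmP /(_ _ e0).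
rewrite near_withinE => -[[U V] /= [/near_nmP[r r0 hr] /near_nmP[r' r'0 hr']] hUV].
have [d d0 hd] := ca _ hs _ r0; have [d' d'0 hd'] := cb _ hs _ r'0.
exists (Num.min d d'); first by rewrite lt_min d0.
move=> s' hs'; rewrite lt_min => /andP[/(hd _ hs') h1 /(hd' _ hs') h2].
apply: (hUV (a s', b s')); last exact: hA.
by split; [exact: hr|exact: hr'].
Qed.

(** Polygonal paths inside A. Continuation of logarithms, of vanishing and of solutions along them
    is then an induction on the segments. *)
Inductive reach A : C -> C -> Prop :=
| reach_refl p : A p -> reach A p p
| reach_step p q r : (forall s : R, 0 <= s <= 1 -> A (p + ofR s * (q - p))) -> reach A q r ->
    reach A p r.

Lemma reach_seg A p q : (forall s : R, 0 <= s <= 1 -> A (p + ofR s * (q - p))) -> reach A p q.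
Proof.
move=> h; apply: (reach_step h); apply: reach_refl.
by have := h 1; rewrite ofR1 mul1r addrC subrK; apply; rewrite ler01 lexx.
Qed.

Lemma reach_trans A p q r : reach A p q -> reach A q r -> reach A p r.
Proof. by elim=> // p' q' r' h _ IH /IH; exact: reach_step. Qed.

Lemma reach_start A p q : reach A p q -> A p.
Proof.
case=> // p' q' r' h _; have := h 0; rewrite ofR0 mul0r addr0; apply.
by rewrite lexx ler01.
Qed.

Lemma reach_sym A p q : reach A p q -> reach A q p.
Proof.
elim=> [p' hp|p' q' r' h _ IH]; first exact: reach_refl.
apply: reach_trans IH _; apply: reach_seg => s /andP[s0 s1].
have hs : 0 <= 1 - s <= 1 by apply/andP; split; lra.
by have := h _ hs; congr A; rewrite ofRB ofR1; ring.
Qed.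

Lemma reach_end A p q : reach A p q -> A q.
Proof. by move/reach_sym/reach_start. Qed.

Lemma reach_param A p v (a b : R) : a <= b ->
  (forall s : R, a <= s <= b -> A (p + ofR s * v)) -> reach A (p + ofR a * v) (p + ofR b * v).
Proof.
move=> ab h; apply: reach_seg => s /andP[s0 s1].
have hs : a <= a + s * (b - a) <= b.
  have : 0 <= s * (b - a) by rewrite mulr_ge0 // subr_ge0.
  have : s * (b - a) <= b - a by rewrite ler_piMl // subr_ge0.
  by move=> ? ?; apply/andP; split; lra.
by have := h _ hs; congr A; rewrite ofRD ofRM ofRB; ring.
Qed.

Lemma reach_log_const A (l1 l2 : C -> C) p q :
  (forall x y, (forall s : R, 0 <= s <= 1 -> A (x + ofR s * (y - x))) ->
     path_continuous (fun s => l1 (x + ofR s * (y - x))) /\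
     path_continuous (fun s => l2 (x + ofR s * (y - x)))) ->
  (forall t, A t -> cexp (l1 t) = cexp (l2 t)) ->
  reach A p q -> l1 q - l2 q = l1 p - l2 p.
Proof.
move=> hc he; elim=> // p' q' r' h _ ->; have [c1 c2] := hc _ _ h.
have k := path_continuousB c1 c2.
have := path_continuous_exp_const k => /=.
have -> : p' + ofR 1 * (q' - p') = q' by rewrite ofR1; ring.
have -> : p' + ofR 0 * (q' - p') = p' by rewrite ofR0; ring.
apply.
by move=> s hs; rewrite cexpB he ?divff ?cexp_neq0 //; exact: h.
Qed.

Lemma reach_vanish A (f : C -> C) p q :
  (forall t, A t -> exists2 rho : R, 0 < rho & forall u, nm (u - t) < rho -> cdiff f u) ->
  reach A p q -> vanishes_near f p -> vanishes_near f q.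
Proof.
move=> hA; elim=> // p' q' r' h _ IH f0; apply: IH.
have -> : q' = p' + (q' - p') by rewrite addrC subrK.
by apply: identity_segment => // s /h /hA.
Qed.

End Paths.

Section ExpDiag.
Variables (R : realType) (n : nat).
Notation C := (Cplx R).
Implicit Types u v : 'rV[C]_n.

Lemma expdiagD u v : expdiag u *m expdiag v = expdiag (u + v).
Proof.
rewrite /expdiag mulmx_diag; congr diag_mx; apply/rowP => i.
by rewrite !mxE cexpD.
Qed.

Lemma expdiag0 : expdiag (0 : 'rV[C]_n) = 1%:M.
Proof.
apply/matrixP => i j; rewrite !mxE; case: eqP => _; last by rewrite mulr0n.
by rewrite cexp0 mulr1n.
Qed.

Lemma expdiag_unit u : expdiag u \in unitmx.
Proof.
by have /mulmx1_unit[] : expdiag u *m expdiag (- u) = 1%:M by rewrite expdiagD subrr expdiag0.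
Qed.

Lemma invmx_expdiag u : invmx (expdiag u) = expdiag (- u).
Proof.
have h : expdiag u *m expdiag (- u) = 1%:M by rewrite expdiagD subrr expdiag0.
by rewrite -[LHS]mulmx1 -h mulmxA mulVmx ?expdiag_unit // mul1mx.
Qed.

Lemma expdiag_is_diag u : is_diag_mx (expdiag u).
Proof. exact: diag_mx_is_diag. Qed.

Lemma expdiag_ii u i : expdiag u i i = cexp (u ord0 i).
Proof. by rewrite !mxE eqxx mulr1n. Qed.

End ExpDiag.

(** * Logarithms of x(t)^2 - eps near the singular points *)

Section Branches.
Variables (R : realType) (w : Cplx R).
Notation C := (Cplx R).
Notation q := (sqrt_eps w).
Implicit Types t : C.

(* E1 is a branch of log ((x(t)^2 - eps) / (4 eps)) near x_L; t |-> E1 (- t)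
   is one near x_R. *)
Definition reg1 t := 0 < re (1 - cexp (2 * (q * t))).
Definition E1 t := 2 * (q * t) - 2 * clog (1 - cexp (2 * (q * t))).

Lemma cexp_double (z : C) : cexp (2 * z) = cexp z ^+ 2.
Proof. by rewrite expr2 -cexpD; congr cexp; ring. Qed.

Lemma reg1_csinh t : reg1 t -> csinh (q * t) != 0.
Proof.
rewrite /reg1 => h; apply: contraTneq h => h.
have e : cexp (2 * (q * t)) = 1.
  have e1 : cexp (q * t) = cexp (- (q * t)).
    by apply/eqP; rewrite -subr_eq0; move: h; rewrite /csinh => /eqP; rewrite mulf_eq0 invr_eq0 pnatr_eq0 orbF.
  by rewrite cexp_double expr2 {2}e1 -cexpD subrr cexp0.
by rewrite e subrr re0 ltxx.
Qed.

Lemma E1_exp t : reg1 t -> cexp (E1 t) = (4 * csinh (q * t) ^+ 2)^-1.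
Proof.
move=> ht; have s0 := reg1_csinh ht; rewrite /E1 cexpB (cexp_double (clog _)) cexp_clog // cexp_double.
have e1 : cexp (q * t) * cexp (- (q * t)) = 1 by rewrite -cexpD subrr cexp0.
have n1 := cexp_neq0 (q * t); move: s0; rewrite /csinh.
rewrite cexpN; move: (cexp (q * t)) n1 => z z0 s0.
have s1 : z - z^-1 != 0 by apply: contra_neq s0 => ->; rewrite mul0r.
have -> : 1 - z ^+ 2 = - z * (z - z^-1) by field.
by move: (z - z^-1) s1 => y y0; field; rewrite y0 z0.
Qed.

Lemma E1_cdiff t : reg1 t -> cdiff E1 t.
Proof.
move=> ht.
have h1 := cderivZ 2 (cderivZ q (cderiv_id t)).
have h2 := cderivB (cderiv_cst 1 t) (cderiv_comp h1 (cderiv_cexp _)).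
by eexists; exact: cderivB h1 (cderivZ 2 (cderiv_comp h2 (cderiv_clog ht))).
Qed.

Lemma reg1_open t : reg1 t -> exists2 rho : R, 0 < rho & forall u, nm (u - t) < rho -> reg1 u.
Proof.
move=> ht.
have h1 := cderivZ 2 (cderivZ q (cderiv_id t)).
have /cderiv_ccont/ccontP /(_ _ ht)[r r0 hr] :=
  cderivB (cderiv_cst 1 t) (cderiv_comp h1 (cderiv_cexp _)).
exists r => // u /hr hu; have := le_lt_trans (re_nm _) hu.
rewrite /reg1 [X in `|X| < _]reB ltr_norml => /andP[h _]; lra.
Qed.

Lemma reg1_left t : re (q * t) < 0 -> reg1 t.
Proof.
move=> h; rewrite /reg1 reB re1 subr_gt0.
apply: le_lt_trans (ler_norm _) _; apply: le_lt_trans (re_nm _) _.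
rewrite nm_cexp -expR0 ltr_expR -ofR_nat reMofR; lra.
Qed.

Lemma qPhalf : q * (Pper w / 2) = - (ofR pi * iC) / 2.
Proof. by rewrite mulrA sqrt_Pper. Qed.

(** At both points cexp (2 q t) = -1, so the logarithmic terms of E1 agree and only the linear
    terms, pi i and - pi i, differ. The monodromy of the model solutions is computed from this
    difference. *)
Lemma E1_Phalf : [/\ reg1 (Pper w / 2), reg1 (- (Pper w / 2)) &
  E1 (- (Pper w / 2)) - E1 (Pper w / 2) = ofR (2 * pi) * iC].
Proof.
have e1 : 2 * (q * (Pper w / 2)) = - (ofR pi * iC) by rewrite qPhalf; field.
have e2 : 2 * (q * - (Pper w / 2)) = ofR pi * iC by rewrite mulrN qPhalf; field.
have c1 : cexp (- (ofR pi * iC)) = -1 :> C by rewrite cexpN cexp_pi invrN invr1.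
have r2 : 0 < re (1 - -1 : C) by rewrite reB reN re1; lra.
split; rewrite /reg1 /E1 ?e1 ?e2 ?c1 ?cexp_pi //.
by rewrite ofRM ofR_nat; ring.
Qed.

(** sinh^2 is even, so E1 u and E1 (- u) are logarithms of the same function and their difference is
    locally constant. *)
Lemma E1_sub_near t : reg1 t -> reg1 (- t) -> exists2 rho : R, 0 < rho &
  forall u, nm (u - t) < rho -> E1 u - E1 (- u) = E1 t - E1 (- t).
Proof.
move=> h1 h2; have [r1 r10 hr1] := reg1_open h1; have [r2 r20 hr2] := reg1_open h2.
exists (Num.min r1 r2); first by rewrite lt_min r10.
move=> u; rewrite lt_min => /andP[u1 u2].
apply: (@reach_log_const _ (fun v => reg1 v /\ reg1 (- v)) E1 (fun v => E1 (- v))).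
- move=> x y hA; split.
    by apply: ccont_path => s /hA[k _]; exact: cdiff_ccont (E1_cdiff k).
  apply: (@ccont_path _ (fun v => E1 (- v))) => s /hA[_ k].
  apply: (@ccont_comp _ E1 (fun v => - v)); first exact: ccontN (ccont_id _).
  exact: cdiff_ccont (E1_cdiff k).
- by move=> v [k1 k2]; rewrite !E1_exp // mulrN csinhN sqrrN.
- apply: reach_seg => s /andP[s0 s1].
  have hs : nm (t + ofR s * (u - t) - t) <= nm (u - t).
    by rewrite addrC addKr nmM nm_ofR ger0_norm // ler_piMl ?nm_ge0.
  split; [apply: hr1|apply: hr2]; first exact: le_lt_trans u1.
  rewrite (_ : - _ - - t = - (t + ofR s * (u - t) - t)); last by ring.
  by rewrite nmN; exact: le_lt_trans u2.
Qed.

End Branches.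

(** * Neighbourhoods of the points of the middle curve *)

Section Openness.
Variables (R : realType) (g : geometry R) (w : Cplx R).
Notation C := (Cplx R).
Notation gam := (g_gamma g).
Notation m := (nm (sqrt_eps w)).
Notation th := (theta g w).
Notation T := (tan th).
Notation L := (ell T (Pper w)).
Notation sa := (sin (2 * gam ^+ 2 / pi)).
Implicit Types (t : C).

Lemma inside_open t : inside g w t ->
  exists2 rho : R, 0 < rho & forall u, nm (u - t) < rho -> inside g w u.
Proof.
move=> [h1 h2].
have hs := cderiv_comp (cderivZ (sqrt_eps w) (cderiv_id t)) (cderiv_csinh (sqrt_eps w * t)).
have cs := cderiv_ccont hs; have cx := cderiv_ccont (cderiv_xt h1).
have n0 : 0 < nm (csinh (sqrt_eps w * t)) by rewrite nm_gt0.
have d0 : 0 < g_r g - nm (xt w t) by rewrite subr_gt0.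
move/ccontP: cs => /(_ _ n0)[r1 r10 hr1]; move/ccontP: cx => /(_ _ d0)[r2 r20 hr2].
exists (Num.min r1 r2); first by rewrite lt_min r10.
move=> u; rewrite lt_min => /andP[/hr1 u1 /hr2 u2]; split.
  by apply: contraTneq u1 => ->; rewrite sub0r nmN ltxx.
have := nmBl (xt w u) (xt w t); lra.
Qed.

Hypothesis gam0 : 0 < gam.
Hypothesis gam1 : gam * (1 + 2 * gam / pi) < pi / 2.
Hypothesis wS : pi - 2 * gam < im w < 3 * pi + 2 * gam.
Hypothesis c00 : 0 < g_c0 g.
Hypothesis c01 : g_c0 g <= pi / 4 * sa.
Hypothesis h0 : 0 < g_h g.
Hypothesis k0 : 0 < g_kappa g.
Hypothesis r0 : 0 < g_r g.

Lemma curve_ball u : inside g w (curve g w u) ->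
  exists2 rho : R, 0 < rho & forall t, nm (t - curve g w u) < rho ->
    [/\ Gamma g sD w t, Gamma g sU w t & inside g w t].
Proof.
move=> iu; have L0 := L_gt0 gam0 gam1 wS.
have [r1 r10 hr1] := inside_open iu.
pose K := 1 + `|T|; have K0 : 0 < K by rewrite ltr_pwDl.
have kL : 0 < g_kappa g * L by rewrite mulr_gt0.
have hK : 0 < g_h g / K by rewrite divr_gt0.
have LK : 0 < L / 4 / K by rewrite divr_gt0 // divr_gt0.
exists (Num.min r1 (Num.min (g_h g / K) (L / 4 / K))).
  by rewrite !lt_min r10 hK LK.
move=> t; rewrite !lt_min => /and3P[t1 t2 t3].
have it := hr1 _ t1; set d := t - curve g w u in t1 t2 t3.
have rd := re_nm d; have id := im_nm d.
have tE : t = curve g w u + d by rewrite /d addrC subrK.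
have ret : re t = u + re d by rewrite {1}tE reD re_curve.
have imt : im t = sigma g w u + im d by rewrite {1}tE imD im_curve.
rewrite ltr_pdivlMr // in t2; rewrite ltr_pdivlMr // in t3.
have sl := sigma_lip w c00 (re t) u.
rewrite ret [u + _ - u]addrC addKr in sl.
have dK : `|im d| + `|T| * `|re d| <= nm d * K.
  rewrite /K mulrDr mulr1; apply: lerD => //.
  by rewrite mulrC ler_wpM2r.
have key : `|im t - sigma g w (re t)| < g_h g.
  apply: le_lt_trans t2; apply: le_trans dK.
  rewrite imt ret (_ : _ - _ = im d - (sigma g w (u + re d) - sigma g w u)); last by ring.
  by apply: le_trans (ler_normB _ _) _; rewrite lerD2l.
have ellt : `|ell T t| < L / 2.
  rewrite tE ellD; apply: le_lt_trans (ler_normD _ _) _.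
  have e1 := curve_ell gam0 gam1 wS c00 c01 u.
  have e2 : `|ell T d| <= nm d * K.
    apply: le_trans dK; rewrite /ell; apply: le_trans (ler_normB _ _) _.
    by rewrite lerD2l normrM mulrC.
  by have := le_lt_trans e2 t3; lra.
move: key ellt; rewrite !ltr_norml => /andP[k1 k2] /andP[l1 l2].
split => //; [apply: GammaD_intro|apply: GammaU_intro] => //; try lra.
Qed.

(** A whole disc over Omega_R is provided because the identity theorem starts from two functions
    that agree near a point, here F_U and F_D. *)
Lemma curve_OmegaR_ball c2 u : 0 < c2 -> small g w (curve_bound g c2) ->
  u < 0 -> c2 <= m * - u ->
  exists2 rho : R, 0 < rho & forall t, nm (t - curve g w u) < rho ->
    [/\ Gamma g sD w t, Gamma g sU w t, inside g w t & OmegaLR g pR w (xt w t)].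
Proof.
move=> c20 sm u0 hu.
have iu : inside g w (curve g w u).
  by apply: (inside_curve gam0 gam1 wS c00 c01 r0 c20 sm); rewrite ltr0_norm.
have [rho rho0 hr] := curve_ball iu; exists rho => // t ht.
have [h1 h2 h3] := hr _ ht; split => //.
exists t => // M; set A := Gamma g sD w `&` Gamma g sU w.
exists (curve g w (Num.min u (M - 1))); last first.
  by rewrite re_curve gt_min ltrBlDr ltrDl ltr01 orbT.
apply: (@connected_component_trans _ A (curve g w u)).
  pose sg (s : R) := t + ofR s * (curve g w u - t).
  have sc : continuous sg.
    move=> s; apply/cvg_nmP => e e0.
    have K0 : 0 < nm (curve g w u - t) + 1 by rewrite ltr_wpDl ?nm_ge0.
    apply/nbhs_ballP; exists (e / (nm (curve g w u - t) + 1)); first by rewrite /= divr_gt0.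
    move=> s'; rewrite /ball /= ltr_pdivlMr // distrC => hs.
    rewrite affine_lip; apply: le_lt_trans hs.
    by rewrite ler_wpM2l // lerDl.
  pose B := sg @` `[0, 1].
  have tB : B t by exists 0; rewrite /= ?in_itv /= ?lexx ?ler01 // /sg ofR0; ring.
  have cB : B (curve g w u).
    by exists 1; rewrite /= ?in_itv /= ?lexx ?ler01 // /sg ofR1; ring.
  apply: (connected_component_max tB) cB.
    move=> _ [s hs <-]; move: hs; rewrite /= in_itv /= => /andP[s0 s1].
    have hsg : nm (sg s - curve g w u) < rho.
      rewrite /sg (_ : _ - _ = ofR (1 - s) * (t - curve g w u)); last by rewrite ofRB ofR1; ring.
      apply: le_lt_trans ht; rewrite nmM nm_ofR ger0_norm ?subr_ge0 // ler_piMl ?nm_ge0 //.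
      by rewrite lerBlDr lerDl.
    by have [k1 k2 _] := hr _ hsg; split.
  apply: connected_continuous_connected; first exact: segment_connected.
  exact: continuous_subspaceT.
apply: curve_component => // s.
have -> : Num.max u (Num.min u (M - 1)) = u by apply/max_idPl; rewrite ge_min lexx.
move=> /andP[_ us]; apply: (inside_curve gam0 gam1 wS c00 c01 r0 c20 sm).
apply: le_trans hu _; rewrite ler_wpM2l ?nm_ge0 //.
by apply: le_trans (_ : - s <= _); rewrite ?lerN2 // -normrN ler_norm.
Qed.

End Openness.

(** * Branches of the model solutions *)

Section ModelBranches.
Variables (R : realType) (n : nat) (f : prenormal_family R n) (g : geometry R) (w : Cplx R).
Notation C := (Cplx R).
Notation L0 := (pf_L0 f (eps w)).
Notation L1 := (pf_L1 f (eps w)).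
Notation q := (sqrt_eps w).
Notation halfP := (Pper w / 2).
Implicit Types t : C.

Variable F : side -> C -> C -> 'M[C]_n.
Variable lg : C -> C.

Definition model_at (l t : C) : 'M[C]_n := expdiag (t *: L0 + (l / 2) *: L1).

Hypothesis lg_path : forall x y, (forall s : R, 0 <= s <= 1 -> Gamma g sD w (x + ofR s * (y - x))) ->
  path_continuous (fun s => lg (x + ofR s * (y - x))).
Hypothesis lg_exp : forall t, Gamma g sD w t -> cexp (lg t) = xt w t ^+ 2 - eps w.
Hypothesis FD_eq : forall t, Gamma g sD w t -> F sD w (xt w t) = model_at (lg t) t.
Hypothesis FU_an : forall x, Omega g sU w x -> analytic_at (F sU w) x.
Hypothesis FU_cont : forall x, OmegaLR g pR w x -> F sU w x = F sD w x.

Definition zone (s : side) (P : C -> Prop) t := [/\ Gamma g s w t, inside g w t & P t].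
Notation regL := (reg1 w).
Notation regR := (fun t => reg1 w (- t)).

Lemma E1_lift : exists2 K : C, cexp K = 4 * eps w &
  forall t, reg1 w t -> csinh (q * t) != 0 -> cexp (K + E1 w t) = xt w t ^+ 2 - eps w.
Proof.
exists (ofR (ln 4) + w).
  by rewrite cexpD cexp_ofR lnK ?posrE // ofR_nat.
move=> t h s0; rewrite cexpD E1_exp // cexpD cexp_ofR lnK ?posrE // ofR_nat xt2Beps //.
by rewrite -/(eps w); field.
Qed.

Lemma lg_reachL p p' : reach (zone sD regL) p p' -> lg p' - E1 w p' = lg p - E1 w p.
Proof.
have [K _ hK] := E1_lift.
move=> h; have := @reach_log_const _ _ lg (fun t => K + E1 w t) _ _ _ _ h.
move=> H; have -> : lg p' - E1 w p' = (lg p' - (K + E1 w p')) + K by ring.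
rewrite H; first by ring.
  move=> x y hA; split; first by apply: lg_path => s /hA[].
  apply: (@ccont_path _ (fun t => K + E1 w t)) => s /hA[_ _ k].
  exact: ccontD (ccont_cst _ _) (cdiff_ccont (E1_cdiff k)).
by move=> t [k1 [k2 _] k3]; rewrite lg_exp // hK.
Qed.

Lemma cdiff_E1N t : reg1 w (- t) -> cdiff (fun u => E1 w (- u)) t.
Proof.
by move=> /E1_cdiff[d hd]; eexists; exact: cderiv_comp (cderivN (cderiv_id t)) hd.
Qed.

Lemma reg1N_open t : reg1 w (- t) ->
  exists2 rho : R, 0 < rho & forall u, nm (u - t) < rho -> reg1 w (- u).
Proof.
move=> /reg1_open[r r0 hr]; exists r => // u hu; apply: hr.
by rewrite (_ : - u - - t = - (u - t)) ?nmN //; ring.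
Qed.

Lemma lg_reachR p p' : reach (zone sD regR) p p' ->
  lg p' - E1 w (- p') = lg p - E1 w (- p).
Proof.
have [K _ hK] := E1_lift.
move=> h; have := @reach_log_const _ _ lg (fun t => K + E1 w (- t)) _ _ _ _ h.
move=> H; have -> : lg p' - E1 w (- p') = (lg p' - (K + E1 w (- p'))) + K by ring.
rewrite H; first by ring.
  move=> x y hA; split; first by apply: lg_path => s /hA[].
  apply: (@ccont_path _ (fun t => K + E1 w (- t))) => s /hA[_ _ k].
  exact: ccontD (ccont_cst _ _) (cdiff_ccont (cdiff_E1N k)).
move=> t [k1 [k2 _] k3]; rewrite lg_exp // hK ?xtN ?sqrrN //.
by rewrite csinhN_eq0.
Qed.

(** The discrepancy between F_U and the explicit model solution with logarithm K + b. Continuing F_U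
    means carrying its vanishing along a path. *)
Definition FU_defect (b : C -> C) K i j t := F sU w (xt w t) i j - model_at (K + b t) t i j.

Lemma model_at_cdiff (b : C -> C) t i j : cdiff b t -> cdiff (fun t => model_at (b t) t i j) t.
Proof.
move=> [d hd].
have h1 := cderivM (cderiv_id t) (cderiv_cst (L0 ord0 i) t).
have h2 := cderivM (cderivM hd (cderiv_cst (2^-1) t)) (cderiv_cst (L1 ord0 i) t).
have h3 := cderivM (cderiv_comp (cderivD h1 h2) (cderiv_cexp _)) (cderiv_cst ((i == j)%:R) t).
eexists; move: h3; congr cderiv; apply/funext => u.
by rewrite /model_at /expdiag !mxE mulr_natr; congr (cexp _ *+ _).
Qed.

Lemma FU_defect_cdiff (b : C -> C) (P : C -> Prop) K i j t :
  (forall t, P t -> cdiff b t) ->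
  (forall t, P t -> exists2 rho : R, 0 < rho & forall u, nm (u - t) < rho -> P u) ->
  zone sU P t ->
  exists2 rho : R, 0 < rho & forall u, nm (u - t) < rho -> cdiff (FU_defect b K i j) u.
Proof.
move=> hb hP [hU hin hPt].
have [r1 r10 h1] := hP _ hPt; have [r2 r20 h2] := inside_open hin.
have xO : Omega g sU w (xt w t) by exists t.
have /near_nmP[r3 r30 h3] := FU_an xO i j.
have /cderiv_ccont/ccontP /(_ _ r30)[r4 r40 h4] := cderiv_xt hin.1.
exists (Num.min r1 (Num.min r2 r4)); first by rewrite !lt_min r10 r20.
move=> u; rewrite !lt_min => /and3P[/h1 u1 /h2 [u2 _] /h4 u4].
have k1 := cderiv_comp (cderiv_xt u2) (derivable_cderiv (h3 _ u4)).
have [d hd] := hb _ u1.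
have [d2 k2] : cdiff (fun t => model_at (K + b t) t i j) u.
  by apply: (@model_at_cdiff (fun t => K + b t)); eexists; exact: cderivD (cderiv_cst K u) hd.
by eexists; exact: cderivB k1 k2.
Qed.

Lemma FU_defect_reach (b : C -> C) (P : C -> Prop) K i j p p' :
  (forall t, P t -> cdiff b t) ->
  (forall t, P t -> exists2 rho : R, 0 < rho & forall u, nm (u - t) < rho -> P u) ->
  reach (zone sU P) p p' -> vanishes_near (FU_defect b K i j) p ->
  vanishes_near (FU_defect b K i j) p'.
Proof.
by move=> hb hP; apply: reach_vanish => t; exact: FU_defect_cdiff.
Qed.

Lemma vanishes_near_at (h : C -> C) p : vanishes_near h p -> h p = 0.
Proof. by move=> [e e0 ->]; rewrite ?subrr ?nm0. Qed.

(** Two paths from tl to tr, through P/2 in Gamma_U and through - P/2 in Gamma_D. On the half next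
    to tl the branch E1 (- t) is regular, on the half next to tr the branch E1 t is, and both are at
    P/2 and - P/2. *)
Record model_loop (tl tr : C) : Prop := ModelLoop {
  ml_R : exists2 rho : R, 0 < rho & forall t, nm (t - tl) < rho ->
    [/\ Gamma g sD w t, inside g w t & OmegaLR g pR w (xt w t)];
  ml_U2 : reach (zone sU regR) tl halfP;
  ml_U1 : reach (zone sU regL) halfP tr;
  ml_D2 : reach (zone sD regR) tl (- halfP);
  ml_D1 : reach (zone sD regL) (- halfP) tr
}.

Lemma xt_halfP : xt w halfP = 0 /\ xt w (- halfP) = 0.
Proof.
have h : xt w (- halfP) = 0.
  rewrite /xt mulrN qPhalf (_ : - (- _ / 2) = 0 + halfpii R); last first.
    by rewrite /halfpii ofRM ofRV ofR_nat; field.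
  by rewrite ccoshD_halfpii csinh0 mulr0 mul0r mulr0.
by split => //; apply/eqP; rewrite -oppr_eq0 -xtN h.
Qed.

Lemma model_atD l l' t v : model_at l t *m expdiag ((l' / 2) *: L1 + v *: L0) = model_at (l + l') (t + v).
Proof.
rewrite /model_at expdiagD; congr expdiag; apply/rowP => i; rewrite !mxE.
by move: (L0 0 i) (L1 0 i) => x y; ring.
Qed.

(** Both solutions start at tl with the logarithm K2 + E1 (- t). Replacing E1 (- t) by E1 t costs +
    2 pi i at P/2, on the path of F_U, and - 2 pi i at - P/2, on the path of F_D. Over x = 0 the
    logarithms thus differ by 2 pi i and the times by P; at tr the logarithms differ by 4 pi i,
    which is halved in the exponent. *)
Theorem FU_values tl tr : model_loop tl tr ->
  F sU w 0 = F sD w 0 *m expdiag ((ofR (2 * pi) * iC / 2) *: L1 + Pper w *: L0) /\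
  F sU w (xt w tr) = F sD w (xt w tr) *m expdiag ((ofR (2 * pi) * iC) *: L1).
Proof.
move=> [[rho rho0 hR] U2 U1 D2 D1].
have [xp xm] := xt_halfP.
have [pr1 pr2 pE] := E1_Phalf w.
set c := ofR (2 * pi) * iC in pE *.
have lR := lg_reachR D2; have lL := lg_reachL D1; rewrite opprK in lR.
pose K2 := lg tl - E1 w (- tl).
have tl_reg : reg1 w (- tl) by case: (reach_start U2).
have [r1 r10 hr1] := reg1N_open tl_reg.
have v0 i j : vanishes_near (FU_defect (fun t => E1 w (- t)) K2 i j) tl.
  exists (Num.min rho r1); first by rewrite lt_min rho0.
  move=> t; rewrite lt_min => /andP[t1 t2]; have [k1 k2 k3] := hR _ t1.
  rewrite /FU_defect FU_cont // FD_eq //.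
  suff -> : lg t = K2 + E1 w (- t) by rewrite subrr.
  have : reach (zone sD regR) tl t.
    apply: reach_seg => s /andP[s0 s1].
    have hs : nm (tl + ofR s * (t - tl) - tl) <= nm (t - tl).
      by rewrite addrC addKr nmM nm_ofR ger0_norm // ler_piMl ?nm_ge0.
    have [q1 q2 _] := hR _ (le_lt_trans hs t1).
    by split => //; apply: hr1; exact: le_lt_trans t2.
  by move/lg_reachR; rewrite -/K2 => <-; ring.
have v1 i j : vanishes_near (FU_defect (fun t => E1 w (- t)) K2 i j) halfP.
  exact: (FU_defect_reach cdiff_E1N reg1N_open U2 (v0 i j)).
have v2 i j : vanishes_near (FU_defect (E1 w) (K2 + c) i j) halfP.
  have [e e0 he] := v1 i j; have [r2 r20 hr2] := E1_sub_near pr1 pr2.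
  exists (Num.min e r2); first by rewrite lt_min e0.
  move=> u; rewrite lt_min => /andP[u1 /hr2 u2].
  have e1 : K2 + c + E1 w u = K2 + E1 w (- u).
    rewrite -addrA; congr (_ + _); rewrite -pE.
    by move: u2 => /eqP; rewrite subr_eq => /eqP ->; ring.
  have := he _ u1; rewrite /FU_defect e1.
  exact.
have v3 i j : vanishes_near (FU_defect (E1 w) (K2 + c) i j) tr.
  exact: (FU_defect_reach (@E1_cdiff _ w) (@reg1_open _ w) U1 (v2 i j)).
have FU0 : F sU w 0 = model_at (K2 + c + E1 w halfP) halfP.
  apply/matrixP => i j; have := vanishes_near_at (v2 i j).
  by rewrite /FU_defect xp => /eqP; rewrite subr_eq0 => /eqP.
have FUr : F sU w (xt w tr) = model_at (K2 + c + E1 w tr) tr.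
  apply/matrixP => i j; have := vanishes_near_at (v3 i j).
  by rewrite /FU_defect => /eqP; rewrite subr_eq0 => /eqP.
have mD : Gamma g sD w (- halfP) by case: (reach_start D1).
have trD : Gamma g sD w tr by case: (reach_end D1).
have lgm : lg (- halfP) = K2 + E1 w halfP by rewrite -/K2 in lR; rewrite -lR; ring.
have lgr : lg tr = K2 + E1 w halfP - E1 w (- halfP) + E1 w tr.
  by rewrite -lgm; move: lL => /eqP; rewrite subr_eq => /eqP ->; ring.
split.
  have FDm : F sD w 0 = model_at (lg (- halfP)) (- halfP) by rewrite -FD_eq // xm.
  rewrite FU0 FDm model_atD lgm.
  have e1 : K2 + c + E1 w halfP = K2 + E1 w halfP + c by ring.
  have e2 : - halfP + Pper w = halfP by move: (Pper w) => p; field.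
  exact: (congr2 model_at e1 (esym e2)).
rewrite FUr (FD_eq trD) lgr.
have -> : c *: L1 = ((c + c) / 2) *: L1 + 0 *: L0.
  by rewrite scale0r addr0; congr (_ *: _); field.
rewrite model_atD addr0.
have e1 : E1 w (- halfP) = E1 w halfP + c by rewrite -pE; ring.
have e2 : K2 + c + E1 w tr = K2 + E1 w halfP - E1 w (- halfP) + E1 w tr + (c + c).
  by rewrite e1; ring.
exact: (congr2 model_at e2 erefl).
Qed.

End ModelBranches.

(** * Linear systems along paths *)

Section MatrixDerivatives.
Variable R : realType.
Notation C := (Cplx R).
Implicit Types t : C.

Definition mxcdiff (m k : nat) (W : C -> 'M[C]_(m, k)) t := forall i j, cdiff (fun u => W u i j) t.

Lemma mxcdiff_mul (m k l : nat) (V : C -> 'M[C]_(m, k)) (W : C -> 'M[C]_(k, l)) t :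
  mxcdiff V t -> mxcdiff W t -> mxcdiff (fun u => V u *m W u) t.
Proof.
move=> hV hW i j.
have /choice[d hd] : forall x : 'I_k, exists d, cderiv (fun u => V u i x * W u x j) t d.
  by move=> x; have [a ha] := hV i x; have [b hb] := hW x j; eexists; exact: cderivM ha hb.
exists (\sum_x d x).
under eq_fun do rewrite mxE.
by apply: cderiv_sum => x _; exact: hd.
Qed.

Lemma cdiff_det (m : nat) (W : C -> 'M[C]_m) t : mxcdiff W t -> cdiff (fun u => \det (W u)) t.
Proof.
move=> hW; rewrite /determinant.
have /choice[d hd] : forall s : {perm 'I_m}, exists d,
    cderiv (fun u => (-1) ^+ s * \prod_i W u i (s i)) t d.
  move=> s; have [d hd] := @cderiv_prod R _ (index_enum 'I_m) xpredT (fun i u => W u i (s i)) t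
    (fun i _ => hW i (s i)).
  by eexists; exact: cderivZ hd.
exists (\sum_s d s); apply: (@cderiv_sum R _ _ _ (fun (s : {perm 'I_m}) u => (-1) ^+ s * \prod_i W u i (s i))) => s _.
exact: hd.
Qed.

Lemma det_near_unit (m : nat) (W : C -> 'M[C]_m) t : mxcdiff W t -> W t \in unitmx ->
  \forall u \near t, W u \in unitmx.
Proof.
move=> hW; rewrite unitmxE unitfE => d0.
have /cdiff_ccont/ccontP /(_ (nm (\det (W t)))) := cdiff_det hW.
rewrite nm_gt0 => /(_ d0)[r r0 hr]; apply/near_nmP; exists r; first exact: r0.
move=> u /hr hu; rewrite unitmxE unitfE; apply/eqP => e.
by move: hu; rewrite e sub0r nmN ltxx.
Qed.

Lemma mxcdiff_inv (m : nat) (W : C -> 'M[C]_m) t : mxcdiff W t -> W t \in unitmx ->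
  mxcdiff (fun u => invmx (W u)) t.
Proof.
move=> hW uW i j.
have [d hd] : cdiff (fun u => (\det (W u))^-1 * cofactor (W u) j i) t.
  have [a ha] := cdiff_det hW.
  have hC : mxcdiff (fun u => row' j (col' i (W u))) t.
    by move=> x y; have [b hb] := hW (lift j x) (lift i y); exists b;
       under eq_fun do rewrite !mxE.
  have [b hb] := cdiff_det hC.
  have d0 : \det (W t) != 0 by rewrite -unitfE -unitmxE.
  by eexists; exact: cderivM (cderivV d0 ha) (cderivZ _ hb).
exists d; apply: cderiv_near hd; apply: filterS (det_near_unit hW uW) => u uu.
by rewrite /invmx uu !mxE.
Qed.

Definition mxsol (n : nat) (B : C -> 'M[C]_n) (W : C -> 'M[C]_n) t :=
  forall i j, cderiv (fun u => W u i j) t ((B t *m W t) i j).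

Lemma mxsol_mxcdiff (n : nat) (B W : C -> 'M[C]_n) t : mxsol B W t -> mxcdiff W t.
Proof. by move=> h i j; eexists; exact: h. Qed.

(* W^-1 V has derivative - W^-1 B V + W^-1 B V = 0. *)
Lemma mxsol_quotient (n : nat) (B W V : C -> 'M[C]_n) t i j : mxsol B W t -> mxsol B V t ->
  W t \in unitmx -> cderiv (fun u => (invmx (W u) *m V u) i j) t 0.
Proof.
move=> hW hV uW; have hI := mxcdiff_inv (mxsol_mxcdiff hW) uW.
have /choice[Z' hZ'] : forall x : 'I_n, exists d : 'I_n -> C, forall y, cderiv (fun u => invmx (W u) x y) t (d y).
  by move=> x; have /choice[d hd] := hI x; exists d.
pose Z : 'M[C]_n := \matrix_(x, y) Z' x y.
have hZ x y : cderiv (fun u => invmx (W u) x y) t (Z x y) by rewrite mxE; exact: hZ'.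
have prod (Y : C -> 'M[C]_n) (Y1 : 'M[C]_n) : (forall x y, cderiv (fun u => Y u x y) t (Y1 x y)) ->
    forall x y, cderiv (fun u => (invmx (W u) *m Y u) x y) t ((Z *m Y t + invmx (W t) *m Y1) x y).
  move=> hY x y; under eq_fun do rewrite mxE.
  have -> : (Z *m Y t + invmx (W t) *m Y1) x y =
      \sum_k (Z x k * Y t k y + invmx (W t) x k * Y1 k y).
    by rewrite !mxE -big_split.
  by apply: cderiv_sum => k _; exact: cderivM.
have eZ : Z *m W t + invmx (W t) *m (B t *m W t) = 0.
  apply/matrixP => x y; rewrite [RHS]mxE.
  apply: cderiv_unique (prod _ _ hW x y) _.
  apply: cderiv_near (cderiv_cst ((1%:M : 'M[C]_n) x y) t).
  apply: filterS (det_near_unit (mxsol_mxcdiff hW) uW) => u uu.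
  by rewrite mulVmx.
have ZE : Z = - (invmx (W t) *m B t).
  have : (Z *m W t + invmx (W t) *m (B t *m W t)) *m invmx (W t) = 0 by rewrite eZ mul0mx.
  rewrite mulmxDl mulmxA -!mulmxA mulmxV // !mulmx1 => /eqP.
  by rewrite addr_eq0 => /eqP.
have := prod _ _ hV i j.
by rewrite ZE mulNmx -mulmxA addrC subrr [X in cderiv _ _ X]mxE.
Qed.

Lemma solution_reach (n : nat) (A : C -> Prop) (B W V : C -> 'M[C]_n) p q (X : 'M[C]_n) :
  (forall t, A t -> [/\ mxsol B W t, mxsol B V t & W t \in unitmx]) ->
  reach A p q -> V p = W p *m X -> V q = W q *m X.
Proof.
move=> hA; elim=> // p' q' r' h _ IH e; apply: IH.
have e1 : p' + ofR 1 * (q' - p') = q' by rewrite ofR1; ring.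
have e0 : p' + ofR 0 * (q' - p') = p' by rewrite ofR0; ring.
have h0 := h 0; have h1 := h 1; rewrite e0 in h0; rewrite e1 in h1.
have [|_ _ u0] := hA _ (h0 _); first by rewrite lexx ler01.
have [|_ _ u1] := hA _ (h1 _); first by rewrite ler01 lexx.
have c : invmx (W q') *m V q' = invmx (W p') *m V p'.
  apply/matrixP => i j.
  have := @cderiv0_const R (fun u => (invmx (W u) *m V u) i j) p' (q' - p').
  have E : p' + (q' - p') = q' by ring.
  rewrite /= E; apply=> s hs.
  by have [a b c] := hA _ (h _ hs); exact: (mxsol_quotient i j a b c).
have : W q' *m (invmx (W q') *m V q') = W q' *m (invmx (W p') *m V p') by rewrite c.
by rewrite (mulKVmx u1) => ->; rewrite e (mulKmx u0).
Qed.

End MatrixDerivatives.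

(** * The loop around the two singular points *)

Section Loops.
Variables (R : realType) (g : geometry R) (w1 w2 : Cplx R).
Notation C := (Cplx R).
Notation gam := (g_gamma g).
Notation sa := (sin (2 * gam ^+ 2 / pi)).
Notation T1 := (tan (theta g w1)).
Notation T2 := (tan (theta g w2)).
Notation L1 := (ell T1 (Pper w1)).
Notation L2 := (ell T2 (Pper w2)).
Notation e12 := (edge g w1 w2).
Notation e21 := (edge g w2 w1).

Hypothesis gam0 : 0 < gam.
Hypothesis gam1 : gam * (1 + 2 * gam / pi) < pi / 2.
Hypothesis S1 : pi - 2 * gam < im w1 < 3 * pi + 2 * gam.
Hypothesis S2 : pi - 2 * gam < im w2 < 3 * pi + 2 * gam.
Hypothesis c00 : 0 < g_c0 g.
Hypothesis c01 : g_c0 g <= pi / 4 * sa.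
Hypothesis h0 : 0 < g_h g.
Hypothesis k0 : 0 < g_kappa g.
Hypothesis r0 : 0 < g_r g.
Hypothesis opp : sqrt_eps w2 = - sqrt_eps w1.
Hypothesis signs : 0 < T1 /\ T2 < 0 \/ T1 < 0 /\ 0 < T2.
Hypothesis small_c : small g w1 (curve_bound g (c2 g)).

Lemma opp_sym : sqrt_eps w1 = - sqrt_eps w2. Proof. by rewrite opp opprK. Qed.

(** The edge from - P1 / 2 and the edge of the exchanged pair, which starts at - P2 / 2 = P1 / 2,
    thus end in the same point. *)
Lemma apex_sym : apex g w1 w2 = apex g w2 w1.
Proof.
have TT : T1 - T2 != 0 by case: signs => -[? ?]; [rewrite gt_eqF|rewrite lt_eqF]; lra.
have E (x y u v : R) : x - y != 0 -> (v - u) / 2 / (x - y) = (u - v) / 2 / (y - x) /\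
    x * ((v - u) / 2 / (x - y)) + u / 2 = y * ((u - v) / 2 / (y - x)) + v / 2.
  move=> h; have h' : y - x != 0 by rewrite -opprB oppr_eq0.
  by split; field; rewrite ?h ?h'.
by have [a b] := E _ _ L1 L2 TT; rewrite /apex /= b a.
Qed.

Lemma edge0 : e12 0 = - (Pper w1 / 2).
Proof. by rewrite /edge ofR0 mul0r addr0. Qed.
Lemma edge1 : e12 1 = apex g w1 w2.
Proof. by rewrite /edge ofR1; ring. Qed.

(** The edge has slope T2, so in the oblique coordinates of [w2] its image under sqrt eps is a
    multiple of e^{i (ph + th)}, whose real part is negative. The sign tells which of E1 t and E1 (-
    t) is regular along the edge. *)
Lemma edge_re : (0 < T1 -> re (sqrt_eps w1 * (apex g w1 w2 + Pper w1 / 2)) < 0) /\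
  (T1 < 0 -> 0 < re (sqrt_eps w1 * (apex g w1 w2 + Pper w1 / 2))).
Proof.
have L10 := L_gt0 gam0 gam1 S1; set v := apex g w1 w2 + Pper w1 / 2.
have v1 : ell T1 v = L1 by rewrite /v ellD apex_ell1 half_ofR ellZ; field.
have v2 : ell T2 v = 0 * L2.
  rewrite /v ellD (apex_ell2 signs) half_ofR ellZ (opp_Pper opp) ellN.
  by move: (ell T2 _) => x; field.
have [rho [hr _ hrho]] := sqrt_t_coord gam0 gam1 S2 v2.
have c0 := cos_th gam0 gam1 S2; have Sge := S_ge gam0 gam1 S2; have sa0 := sa_gt0 gam0 gam1.
have m0 := sqrt_eps_gt0 w2.
have rev : re v * (T2 - T1) = L1.
  by move: v2; rewrite mul0r {1}/ell => v2'; move: v1; rewrite {1}/ell => v1'; lra.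
have qv : re (sqrt_eps w1 * v) = - (rho * cos (arg_sqrt w2 + theta g w2)).
  by rewrite -hr opp mulNr reN opprK.
rewrite mul0r subr0 in hrho.
have cn : cos (arg_sqrt w2 + theta g w2) < 0 by lra.
have key (c : R) : (0 < re v * c -> 0 < rho * c).
  by move=> h; rewrite -(pmulr_lgt0 _ c0) mulrAC hrho -mulrA mulr_gt0.
split=> t1; rewrite qv.
  have t2 : T2 < 0 by case: signs => -[]//; lra.
  have : re v < 0 by rewrite -(nmulr_lgt0 _ (_ : T2 - T1 < 0)) ?rev //; lra.
  move=> rv; have : 0 < rho * -1 by apply: key; lra.
  by move=> rn; rewrite oppr_lt0 nmulr_rgt0 //; lra.
have t2 : 0 < T2 by case: signs => -[]//; lra.
have : 0 < re v by rewrite -(pmulr_lgt0 _ (_ : 0 < T2 - T1)) ?rev //; lra.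
move=> rv; have : 0 < rho * 1 by apply: key; lra.
by rewrite mulr1 => rn; rewrite oppr_gt0 pmulr_rlt0.
Qed.

Lemma edge_reg s : 0 <= s -> (0 < T1 -> reg1 w1 (e12 s)) /\ (T1 < 0 -> reg1 w1 (- e12 s)).
Proof.
move=> s0; have [p1 p2 _] := E1_Phalf w1; have [r1 r2] := edge_re.
have [->|sn] := eqVneq s 0; first by rewrite edge0 opprK.
have sp : 0 < s by rewrite lt_neqAle eq_sym sn.
have E : re (sqrt_eps w1 * e12 s) = s * re (sqrt_eps w1 * (apex g w1 w2 + Pper w1 / 2)).
  rewrite /edge mulrDr mulrN qPhalf mulrCA reD reMofR.
  rewrite (_ : re (- (- _ / 2)) = 0) ?add0r //.
  by rewrite mulNr opprK half_ofR !reMofR re_iC; ring.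
split=> [/r1|/r2] h; apply: reg1_left; first by rewrite E pmulr_rlt0.
by rewrite mulrN reN E oppr_lt0 pmulr_rgt0.
Qed.

Lemma reach_edge (A : C -> Prop) (a b : R) : a <= b ->
  (forall s, a <= s <= b -> A (e12 s)) -> reach A (e12 a) (e12 b).
Proof. by move=> ab h; apply: reach_param. Qed.

Lemma reach_edgeN (A : C -> Prop) (a b : R) : a <= b ->
  (forall s, a <= s <= b -> A (- e12 s)) -> reach A (- e12 a) (- e12 b).
Proof.
have E s : - e12 s = Pper w1 / 2 + ofR s * - (apex g w1 w2 + Pper w1 / 2).
  by rewrite /edge; ring.
by move=> ab h; rewrite !E; apply: reach_param => // s /h; rewrite E.
Qed.

End Loops.

Section Loops2.
Variables (R : realType) (g : geometry R) (w1 w2 : Cplx R).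
Notation C := (Cplx R).
Notation gam := (g_gamma g).
Notation sa := (sin (2 * gam ^+ 2 / pi)).
Notation T1 := (tan (theta g w1)).
Notation T2 := (tan (theta g w2)).
Notation e12 := (edge g w1 w2).
Notation e21 := (edge g w2 w1).

Hypothesis gam0 : 0 < gam.
Hypothesis gam1 : gam * (1 + 2 * gam / pi) < pi / 2.
Hypothesis S1 : pi - 2 * gam < im w1 < 3 * pi + 2 * gam.
Hypothesis S2 : pi - 2 * gam < im w2 < 3 * pi + 2 * gam.
Hypothesis c00 : 0 < g_c0 g.
Hypothesis c01 : g_c0 g <= pi / 4 * sa.
Hypothesis h0 : 0 < g_h g.
Hypothesis k0 : 0 < g_kappa g.
Hypothesis r0 : 0 < g_r g.
Hypothesis opp : sqrt_eps w2 = - sqrt_eps w1.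
Hypothesis signs : 0 < T1 /\ T2 < 0 \/ T1 < 0 /\ 0 < T2.
Hypothesis small_c : small g w1 (curve_bound g (c2 g)).
Variables (s1 u1 s2 u2 : R).
Hypothesis sp12 : edge_spec g w1 w2 s1 u1.
Hypothesis sp21 : edge_spec g w2 w1 s2 u2.

Let opp' := opp_sym opp.
Let signs' : 0 < T2 /\ T1 < 0 \/ T2 < 0 /\ 0 < T1.
Proof. by case: signs => -[a b]; [right|left]. Qed.

Let e21_0 : e21 0 = Pper w1 / 2.
Proof. by rewrite edge0 (opp_Pper opp) mulNr opprK. Qed.
Let e21_1 : e21 1 = e12 1.
Proof. by rewrite !edge1 (apex_sym signs). Qed.

Let in12 (s : R) : 0 <= s <= 1 -> inside g w1 (e12 s).
Proof. exact: (ss_in sp12). Qed.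
Let in21 (s : R) : 0 <= s <= 1 -> inside g w1 (e21 s).
Proof. by move=> hs; apply: (opp_inside opp'); exact: (ss_in sp21 hs). Qed.

Let re21 (s : R) : 0 <= s -> (0 < T1 -> reg1 w1 (e21 s)) /\ (T1 < 0 -> reg1 w1 (- e21 s)).
Proof.
move=> s0; have [p1 p2 _] := E1_Phalf w1.
have [r1 r2] := edge_re gam0 gam1 S2 S1 opp' signs'.
have [->|sn] := eqVneq s 0; first by rewrite e21_0.
have sp : 0 < s by rewrite lt_neqAle eq_sym sn.
have E : re (sqrt_eps w1 * e21 s) = - (s * re (sqrt_eps w2 * (apex g w2 w1 + Pper w2 / 2))).
  rewrite opp' mulNr reN; congr (- _).
  rewrite /edge mulrDr mulrN qPhalf mulrCA reD reMofR.
  rewrite (_ : re (- (- _ / 2)) = 0) ?add0r //.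
  by rewrite mulNr opprK half_ofR !reMofR re_iC; ring.
split=> t1; apply: reg1_left.
  have t2 : T2 < 0 by case: signs => -[]//; lra.
  by rewrite E oppr_lt0 pmulr_rgt0 ?r2.
have t2 : 0 < T2 by case: signs => -[]//; lra.
by rewrite mulrN reN E opprK pmulr_rlt0 ?r1.
Qed.

(* The loop around the two singular points is made of the edges from the
   points +-P/2 to the apexes +-apex, where Gamma_D and Gamma_U exchange. *)
Lemma model_loop_exists : model_loop g w1 (if 0 < T1 then - e12 s1 else e12 s1)
  (if 0 < T1 then e12 s1 else - e12 s1).
Proof.
have /andP[s10 s11] := ss_01 sp12.
have I0 (s : R) : 0 <= s <= s1 -> 0 <= s <= 1.
  by move=> /andP[a b]; rewrite a (le_trans b s11).
have I1 s : s1 <= s <= 1 -> 0 <= s <= 1.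
  by move=> /andP[a b]; rewrite b (le_trans s10 a).
have e0 : e12 0 = - (Pper w1 / 2) := edge0 g w1 w2.
have en0 : - e12 0 = Pper w1 / 2 by rewrite e0 opprK.
have [cE cEN] := ss_curve sp12; have ub := ss_u1 sp12; have us := ss_sign sp12.
have c20 := c2_gt0 gam0 gam1.
have g0 (s : R) : 0 <= s <= 1 -> 0 <= s by move=> /andP[].
have r12 (s : R) (hs : 0 <= s <= 1) := edge_reg gam0 gam1 S1 S2 opp signs (g0 s hs).
have r21 (s : R) (hs : 0 <= s <= 1) := re21 (g0 s hs).
(* For T1 > 0 both edges have Re (sqrt eps t) <= 0 and carry the branch E1 t, their opposites the
   branch E1 (- t). For T1 < 0 the roles are exchanged. *)
case: ifPn => t1.
  have u10 : 0 < u1 by move: us; rewrite pmulr_rgt0.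
  have D0 (s : R) : 0 <= s <= s1 -> zone g w1 sD (reg1 w1) (e12 s).
    by move=> hs; split; [exact: (ss_D sp12 hs).1|exact/in12/I0|exact: (r12 s (I0 s hs)).1].
  have U0 (s : R) : 0 <= s <= s1 -> zone g w1 sU (fun t => reg1 w1 (- t)) (- e12 s).
    move=> hs; split; [exact: (ss_D sp12 hs).2|exact/insideN/in12/I0|rewrite opprK].
    exact: (r12 s (I0 s hs)).1.
  have U1 (s : R) : s1 <= s <= 1 -> zone g w1 sU (reg1 w1) (e12 s).
    by move=> hs; split; [exact: (ss_U sp12 hs).1|exact/in12/I1|exact: (r12 s (I1 s hs)).1].
  have D1 (s : R) : s1 <= s <= 1 -> zone g w1 sD (fun t => reg1 w1 (- t)) (- e12 s).
    move=> hs; split; [exact: (ss_U sp12 hs).2|exact/insideN/in12/I1|rewrite opprK].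
    exact: (r12 s (I1 s hs)).1.
  have U2 (s : R) : 0 <= s <= 1 -> zone g w1 sU (reg1 w1) (e21 s).
    by move=> hs; split; [exact: (ss_2 sp21 hs).1|exact: in21|exact: (r21 s hs).1].
  have D2 (s : R) : 0 <= s <= 1 -> zone g w1 sD (fun t => reg1 w1 (- t)) (- e21 s).
    move=> hs; split; [exact: (ss_2 sp21 hs).2|exact/insideN/in21|rewrite opprK].
    exact: (r21 s hs).1.
  split.
  - rewrite cEN; have [||rho rho0 hr] := curve_OmegaR_ball gam0 gam1 S1 c00 c01 h0 k0 r0 c20 small_c (u := - u1).
    + by rewrite oppr_lt0.
    + by rewrite opprK; move: ub; rewrite (gtr0_norm u10).
    by exists rho => // t /hr[].
  - by apply: reach_sym; rewrite -en0; exact: (reach_edgeN s10 U0).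
  - apply: reach_trans (_ : reach _ _ (e12 1)) (reach_sym (reach_edge s11 U1)).
    by rewrite -e21_0 -e21_1; exact: (reach_edge ler01 U2).
  - apply: reach_trans (reach_edgeN s11 D1) _.
    by rewrite -e21_0 -e21_1; apply: reach_sym; exact: (reach_edgeN ler01 D2).
  - by rewrite -e0; exact: (reach_edge s10 D0).
have {}t1 : T1 < 0 by case: signs t1 => -[] // ->.
have u10 : u1 < 0 by move: us; rewrite nmulr_rgt0.
have D0 (s : R) : 0 <= s <= s1 -> zone g w1 sD (fun t => reg1 w1 (- t)) (e12 s).
  by move=> hs; split; [exact: (ss_D sp12 hs).1|exact/in12/I0|exact: (r12 s (I0 s hs)).2].
have U0 (s : R) : 0 <= s <= s1 -> zone g w1 sU (reg1 w1) (- e12 s).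
  move=> hs; split; [exact: (ss_D sp12 hs).2|exact/insideN/in12/I0|].
  exact: (r12 s (I0 s hs)).2.
have U1 (s : R) : s1 <= s <= 1 -> zone g w1 sU (fun t => reg1 w1 (- t)) (e12 s).
  by move=> hs; split; [exact: (ss_U sp12 hs).1|exact/in12/I1|exact: (r12 s (I1 s hs)).2].
have D1 (s : R) : s1 <= s <= 1 -> zone g w1 sD (reg1 w1) (- e12 s).
  move=> hs; split; [exact: (ss_U sp12 hs).2|exact/insideN/in12/I1|].
  exact: (r12 s (I1 s hs)).2.
have U2 (s : R) : 0 <= s <= 1 -> zone g w1 sU (fun t => reg1 w1 (- t)) (e21 s).
  by move=> hs; split; [exact: (ss_2 sp21 hs).1|exact: in21|exact: (r21 s hs).2].
have D2 (s : R) : 0 <= s <= 1 -> zone g w1 sD (reg1 w1) (- e21 s).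
  move=> hs; split; [exact: (ss_2 sp21 hs).2|exact/insideN/in21|].
  exact: (r21 s hs).2.
split.
- rewrite cE; have [||rho rho0 hr] := curve_OmegaR_ball gam0 gam1 S1 c00 c01 h0 k0 r0 c20 small_c (u := u1).
  + exact: u10.
  + by move: ub; rewrite (ltr0_norm u10).
  by exists rho => // t /hr[].
- apply: reach_trans (reach_edge s11 U1) _.
  by rewrite -e21_0 -e21_1; apply: reach_sym; exact: (reach_edge ler01 U2).
- by rewrite -en0; exact: (reach_edgeN s10 U0).
- by apply: reach_sym; rewrite -e0; exact: (reach_edge s10 D0).
- apply: reach_trans (_ : reach _ _ (- e12 1)) (reach_sym (reach_edgeN s11 D1)).
  by rewrite -e21_0 -e21_1; exact: (reach_edgeN ler01 D2).
Qed.

End Loops2.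

(** * Jumps between W_D and W_U for one parameter *)

Lemma mulmx_unitlr (K : comUnitRingType) (n : nat) (A B : 'M[K]_n) :
  A *m B \in unitmx -> A \in unitmx /\ B \in unitmx.
Proof. by rewrite unitmx_mul => /andP. Qed.

(** Expresses the factors of [FU_values] by the formal monodromy: F_U = F_D D_R^-1 over x = 0, and
    F_U = F_D D_L D_R^-1 at tr. *)
Lemma sqrt_D (R : realType) (n : nat) (f : prenormal_family R n) (w : Cplx R) :
  Dmx f pR w = expdiag (- ((ofR (2 * pi) * iC / 2) *: pf_L1 f (eps w) + Pper w *: pf_L0 f (eps w))) /\
  Dmx f pL w = expdiag ((ofR (2 * pi) * iC) *: pf_L1 f (eps w)) *m Dmx f pR w.
Proof.
have q0 := sqrt_eps_neq0 w; set q := sqrt_eps w in q0.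
have e1 : Dmx f pR w = expdiag (- ((ofR (2 * pi) * iC / 2) *: pf_L1 f (eps w) + Pper w *: pf_L0 f (eps w))).
  rewrite /Dmx /Uexp /lam /hatx -/q; congr expdiag; apply/rowP => i; rewrite !mxE /Pper -/q.
  by rewrite ofRM ofR_nat; move: (pf_L0 _ _ _ _) (pf_L1 _ _ _ _) => x y; field.
split=> //; rewrite e1 expdiagD.
rewrite /Dmx /Uexp /lam /hatx -/q; congr expdiag; apply/rowP => i; rewrite !mxE /Pper -/q.
by rewrite ofRM ofR_nat; move: (pf_L0 _ _ _ _) (pf_L1 _ _ _ _) => x y; field.
Qed.

Section OneParameter.
Variables (R : realType) (n : nat) (f : prenormal_family R n) (g : geometry R).
Variables (rho delta : R) (F H : side -> Cplx R -> Cplx R -> 'M[Cplx R]_n).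
Notation C := (Cplx R).
Hypothesis hF : model_solutions f g delta rho F.
Hypothesis hH : unfolded_transformations f g rho F H.
Variable w : C.
Hypothesis wS : sectorS (g_gamma g) rho w.

Definition system_at (w t : C) : 'M[C]_n := Bmx f (eps w) (xt w t).
Definition sol (s : side) (w t : C) : 'M[C]_n := H s w (xt w t) *m F s w (xt w t).

Lemma sol_mxsol s t : Gamma g s w t -> inside g w t ->
  mxsol (system_at w) (sol s w) t /\ sol s w t \in unitmx.
Proof.
move=> Gt it; have xO : Omega g s w (xt w t) by exists t.
have [an de un] := H_solution hH wS xO; split => // i j.
have /near_nmP[r r0 hr] := an i j.
have hd : derivable (fun v => (H s w v *m F s w v) i j) (xt w t) 1.
  by apply: hr; rewrite subrr nm0.
have := cderiv_comp (cderiv_xt it.1) (derivable_cderiv hd).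
rewrite (_ : _ * (xt w t ^+ 2 - eps w) = (system_at w t *m sol s w t) i j) //.
rewrite /system_at /sol -de !mxE mulrC; congr (_ * _).
Qed.

Lemma sol_units s t : Gamma g s w t -> inside g w t ->
  H s w (xt w t) \in unitmx /\ F s w (xt w t) \in unitmx.
Proof. by move=> Gt it; have [_ /mulmx_unitlr] := sol_mxsol Gt it. Qed.

Lemma log_branch : exists lg : C -> C,
  [/\ forall x y, (forall s : R, 0 <= s <= 1 -> Gamma g sD w (x + ofR s * (y - x))) ->
        path_continuous (fun s => lg (x + ofR s * (y - x))),
      forall t, Gamma g sD w t -> cexp (lg t) = xt w t ^+ 2 - eps w &
      forall t, Gamma g sD w t -> F sD w (xt w t) = model_at f w (lg t) t].
Proof.
have [lg [cl el _ Fl]] := FD_branch hF; exists (lg w); split.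
- move=> x y hA.
  apply: (@within_path _ _ (fun p => lg p.1 p.2) (fun=> w) (fun s => x + ofR s * (y - x)) cl).
  + by move=> s hs; split => //=; exact: hA.
  + by move=> s _ e e0; exists 1 => // s' _ _; rewrite subrr nm0.
  + by apply: (@ccont_path _ (fun t => t)) => s _; exact: ccont_id.
- by move=> t; exact: el.
- by move=> t; exact: Fl.
Qed.

Variable St : sing -> C -> 'M[C]_n.
Hypothesis hS : unfolded_Stokes_matrices g rho F H St.

Lemma stokes_jump l t : OmegaLR g l w (xt w t) -> Gamma g sD w t -> inside g w t ->
  sol sU w t = sol sD w t *m (St l w *m (invmx (F sD w (xt w t)) *m F sU w (xt w t))).
Proof.
move=> hO Gt it; have [uH uF] := sol_units Gt it.
have := Stokes_LR hS wS hO => e.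
rewrite /sol -[H sU w _](mulKVmx uH) e.
by rewrite !mulmxA.
Qed.

Lemma stokes_unit l : St l w \in unitmx.
Proof.
have : unipotent_at l (St l w) := Stokes_unipotent hS l wS.
have det_low (A : 'M[C]_n) : lower_unipotent A -> A \in unitmx.
  move=> [tA dA]; rewrite unitmxE det_trig // big1 ?unitr1 //.
by case: l => [/det_low//|/det_low]; rewrite unitmx_tr.
Qed.

Section Loop.
Variables tl tr : C.
Hypothesis loop : model_loop g w tl tr.
Hypothesis trL : OmegaLR g pL w (xt w tr).
Notation halfP := (Pper w / 2).

(** Over x = 0, which lies in Omega_C, H_U = H_D and only the model solutions contribute, at times
    P/2 and - P/2. At tl, over Omega_R, F_U = F_D and only the Stokes matrix contributes. At tr,
    over Omega_L, both do. *)
Lemma loop_values : 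
  [/\ sol sU w halfP = sol sD w (- halfP) *m invmx (Dmx f pR w),
      sol sU w tl = sol sD w tl *m St pR w &
      sol sU w tr = sol sD w tr *m (St pL w *m Dmx f pL w *m invmx (Dmx f pR w))].
Proof.
have [lg [l1 l2 l3]] := log_branch.
have [v1 v2] := FU_values l1 l2 l3 (fun x => FU_analytic hF wS (x := x))
  (fun x => FU_continuation hF wS (x := x)) loop.
have [DR DL] := sqrt_D f w.
have [x0 x0'] := xt_halfP w.
have [kU _ _] : zone g w sU (reg1 w) halfP by exact: reach_start (ml_U1 loop).
have [kD kin _] : zone g w sD (fun t => reg1 w (- t)) (- halfP) by exact: reach_end (ml_D2 loop).
have [r r0 hr] := ml_R loop.
split.
- rewrite /sol x0 x0' v1 DR invmx_expdiag opprK.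
  have OC : OmegaC g w (xt w (- halfP)).
    exists (- halfP) => //; split => //.
    by have -> : - halfP + Pper w = halfP by move: (Pper w) => p; field.
  have [uH uF] := sol_units kD kin; rewrite x0' in uH uF OC.
  have := Stokes_C hS wS OC => e.
  by rewrite -[H sU w _](mulKVmx uH) e mulmx1 mulmxA.
- have htl : nm (tl - tl) < r by rewrite subrr nm0.
  have [kl kin' kO] := hr tl htl.
  have [uH uF] := sol_units kl kin'.
  rewrite (stokes_jump kO kl kin') (FU_continuation hF wS kO) mulVmx //.
  by rewrite mulmx1.
- have [kl kin' _] := reach_end (ml_D1 loop).
  have [uH uF] := sol_units kl kin'.
  rewrite (stokes_jump trL kl kin') v2 mulKmx // DL -!mulmxA mulmxV ?mulmx1 //.
  by rewrite DR expdiag_unit.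
Qed.

End Loop.
End OneParameter.

Lemma unitmx_mul3 (K : comUnitRingType) (n : nat) (A B D : 'M[K]_n) :
  A \in unitmx -> B \in unitmx -> D \in unitmx -> A *m B *m invmx D \in unitmx.
Proof. by move=> uA uB uD; rewrite !unitmx_mul unitmx_inv uA uB uD. Qed.

Lemma unitmx_quotient (K : comUnitRingType) (n : nat) (A B : 'M[K]_n) :
  A \in unitmx -> B \in unitmx -> invmx A *m B \in unitmx.
Proof. by move=> uA uB; rewrite unitmx_mul unitmx_inv uA uB. Qed.

Section ConnectionAlgebra.
Variables (K : comUnitRingType) (n : nat).
Implicit Types A C D E S X Y Z : 'M[K]_n.

Lemma mulmx_solve X Y Z A D : D \in unitmx -> X = Y *m invmx D -> Z = Y *m A -> Z = X *m (D *m A).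
Proof. by move=> uD -> ->; rewrite mulmxA mulmxKV. Qed.

Lemma mulmx_solveV X Y Z A D : A \in unitmx -> D \in unitmx ->
  X = Y *m invmx D -> Y = Z *m A -> Z = X *m (D *m invmx A).
Proof. by move=> uA uD -> ->; rewrite mulmxA mulmxKV // mulmxK. Qed.

Lemma mulmx_chain X Y Z A D : X = Y *m D -> Y = Z *m A -> X = Z *m (A *m D).
Proof. by move=> -> ->; rewrite mulmxA. Qed.

Lemma mulmx_moveR X Y A : A \in unitmx -> X = Y *m A -> Y = X *m invmx A.
Proof. by move=> uA ->; rewrite mulmxK. Qed.

Lemma mulmx_return X Y A D : X \in unitmx -> Y = X *m A -> X = Y *m D -> A *m D = 1%:M.
Proof.
move=> uX -> e; apply: (can_inj (mulKmx uX)).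
by rewrite mulmx1 mulmxA; exact: esym e.
Qed.

(** The hypothesis is the product of the two half paths, which must be the identity; a cyclic shift
    of the factors isolates [A]. *)
Lemma upper_connection A C D1 D2 E S : A \in unitmx -> D1 \in unitmx ->
  D2 *m A *m (C *m E *m invmx D1) *m (D1 *m invmx A *m S) = 1%:M ->
  A = S *m D2 *m A *m C *m E.
Proof.
move=> uA uD h.
have {}h : S *m (D2 *m A *m (C *m E *m invmx D1) *m (D1 *m invmx A)) = 1%:M.
  by apply: mulmx1C; rewrite -h !mulmxA.
by rewrite -[LHS]mul1mx -h !mulmxA (mulmxKV uD) (mulmxKV uA).
Qed.

Lemma lower_connection A C D1 D2 E S : A \in unitmx -> D1 \in unitmx -> D2 \in unitmx ->
  S \in unitmx -> S *m E *m invmx D2 \in unitmx -> C \in unitmx ->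
  A *m invmx D1 *m invmx C *m (invmx A *m invmx D2 *m invmx (S *m E *m invmx D2)) = 1%:M ->
  S *m E *m A *m C *m D1 = A.
Proof.
move=> uA u1 u2 uS uZ uC h.
have -> : S *m E = S *m E *m invmx D2 *m D2 by rewrite mulmxKV.
move: uZ h; move: (S *m E *m invmx D2) => Z uZ h.
have k : A *m invmx D1 *m invmx C = Z *m D2 *m A.
  have : A *m invmx D1 *m invmx C *m (invmx A *m invmx D2 *m invmx Z) *m (Z *m D2 *m A) =
    Z *m D2 *m A by rewrite h mul1mx.
  by rewrite !mulmxA (mulmxKV uZ) (mulmxKV u2) (mulmxKV uA).
by rewrite -k (mulmxKV uC) mulmxKV.
Qed.

End ConnectionAlgebra.

Lemma Dmx_unit (R : realType) (n : nat) (f : prenormal_family R n) l w : Dmx f l w \in unitmx.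
Proof. by case: l; exact: expdiag_unit. Qed.

(** * Connection matrix on the auto-intersection *)

Section Half.
Variables (R : realType) (n : nat) (f : prenormal_family R n) (g : geometry R).
Variables (rho : R) (F H : side -> Cplx R -> Cplx R -> 'M[Cplx R]_n).
Notation C := (Cplx R).
Notation sol := (sol F H).
Hypothesis hH : unfolded_transformations f g rho F H.
Variables w1 w2 : C.
Hypothesis wS1 : sectorS (g_gamma g) rho w1.
Hypothesis wS2 : sectorS (g_gamma g) rho w2.
Hypothesis opp : sqrt_eps w2 = - sqrt_eps w1.

Lemma opp_system : system_at f w2 = system_at f w1.
Proof.
by apply/funext => t; rewrite /system_at (xt_opp _ opp) !eps_sqr opp sqrrN.
Qed.

Lemma sol_transport s1 s2 (A : C -> Prop) p q X :
  (forall t, A t -> [/\ Gamma g s1 w1 t, Gamma g s2 w2 t & inside g w1 t]) ->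
  reach A p q -> sol s1 w1 p = sol s2 w2 p *m X -> sol s1 w1 q = sol s2 w2 q *m X.
Proof.
move=> hA; apply: (@solution_reach _ _ A (system_at f w1)) => t /hA[k1 k2 k3].
have [a _] := sol_mxsol hH wS1 k1 k3.
have [b c] := sol_mxsol hH wS2 k2 (opp_inside opp k3).
by split; [rewrite -opp_system; exact: b|exact: a|exact: c].
Qed.

Notation e12 := (edge g w1 w2).
Variables (s1 u1 : R).
Hypothesis sp12 : edge_spec g w1 w2 s1 u1.

(** On the edge W_U of [w2] is available throughout. It is compared with W_D of [w1] up to s1 and
    with W_U of [w1] afterwards; the change of solution at s1 inserts Z. *)
Lemma half_upper X Z : sol sU w1 (e12 s1) = sol sD w1 (e12 s1) *m Z ->
  sol sD w1 (e12 0) = sol sU w2 (e12 0) *m X ->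
  sol sU w1 (e12 1) = sol sU w2 (e12 1) *m (X *m Z).
Proof.
have /andP[s10 s11] := ss_01 sp12 => hZ hX.
have I0 (s : R) : 0 <= s <= s1 -> 0 <= s <= 1 by move=> /andP[a b]; rewrite a (le_trans b s11).
have I1 (s : R) : s1 <= s <= 1 -> 0 <= s <= 1 by move=> /andP[a b]; rewrite b (le_trans s10 a).
have k : sol sD w1 (e12 s1) = sol sU w2 (e12 s1) *m X.
  apply: (@sol_transport _ _ (fun t => [/\ Gamma g sD w1 t, Gamma g sU w2 t & inside g w1 t]) (e12 0)) => //.
  apply: reach_edge => // s hs.
  by split; [exact: (ss_D sp12 hs).1|exact: (ss_2 sp12 (I0 s hs)).1|exact: (ss_in sp12 (I0 s hs))].
apply: (@sol_transport _ _ (fun t => [/\ Gamma g sU w1 t, Gamma g sU w2 t & inside g w1 t]) (e12 s1)) => //.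
  apply: reach_edge => // s hs.
  by split; [exact: (ss_U sp12 hs).1|exact: (ss_2 sp12 (I1 s hs)).1|exact: (ss_in sp12 (I1 s hs))].
by rewrite hZ k mulmxA.
Qed.

(** On the opposite edge W_D of [w2] is available throughout, while for [w1] one starts with W_U and
    ends with W_D, so Z enters inverted. *)
Lemma half_lower X Z : Z \in unitmx -> sol sU w1 (- e12 s1) = sol sD w1 (- e12 s1) *m Z ->
  sol sU w1 (- e12 0) = sol sD w2 (- e12 0) *m X ->
  sol sD w1 (- e12 1) = sol sD w2 (- e12 1) *m (X *m invmx Z).
Proof.
have /andP[s10 s11] := ss_01 sp12 => uZ hZ hX.
have I0 (s : R) : 0 <= s <= s1 -> 0 <= s <= 1 by move=> /andP[a b]; rewrite a (le_trans b s11).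
have I1 (s : R) : s1 <= s <= 1 -> 0 <= s <= 1 by move=> /andP[a b]; rewrite b (le_trans s10 a).
have k : sol sU w1 (- e12 s1) = sol sD w2 (- e12 s1) *m X.
  apply: (@sol_transport _ _ (fun t => [/\ Gamma g sU w1 t, Gamma g sD w2 t & inside g w1 t]) (- e12 0)) => //.
  apply: reach_edgeN => // s hs.
  by split; [exact: (ss_D sp12 hs).2|exact: (ss_2 sp12 (I0 s hs)).2|exact/insideN/(ss_in sp12 (I0 s hs))].
apply: (@sol_transport _ _ (fun t => [/\ Gamma g sD w1 t, Gamma g sD w2 t & inside g w1 t]) (- e12 s1)) => //.
  apply: reach_edgeN => // s hs.
  by split; [exact: (ss_U sp12 hs).2|exact: (ss_2 sp12 (I1 s hs)).2|exact/insideN/(ss_in sp12 (I1 s hs))].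
have -> : sol sD w1 (- e12 s1) = sol sU w1 (- e12 s1) *m invmx Z by rewrite hZ mulmxK.
by rewrite k mulmxA.
Qed.

End Half.

Section Monodromy.
Variables (R : realType) (n : nat) (f : prenormal_family R n) (g : geometry R).
Variables (rho delta : R) (F H : side -> Cplx R -> Cplx R -> 'M[Cplx R]_n).
Variable St : sing -> Cplx R -> 'M[Cplx R]_n.
Notation C := (Cplx R).
Notation sol := (sol F H).
Notation gam := (g_gamma g).
Notation sa := (sin (2 * gam ^+ 2 / pi)).
Hypothesis gam0 : 0 < gam.
Hypothesis gam1 : gam * (1 + 2 * gam / pi) < pi / 2.
Hypothesis c00 : 0 < g_c0 g.
Hypothesis c01 : g_c0 g <= pi / 4 * sa.
Hypothesis h0 : 0 < g_h g.
Hypothesis k0 : 0 < g_kappa g.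
Hypothesis r0 : 0 < g_r g.
Hypothesis hF : model_solutions f g delta rho F.
Hypothesis hH : unfolded_transformations f g rho F H.
Hypothesis hS : unfolded_Stokes_matrices g rho F H St.
Variables w1 w2 : C.
Hypothesis wS1 : sectorS gam rho w1.
Hypothesis wS2 : sectorS gam rho w2.
Hypothesis opp : sqrt_eps w2 = - sqrt_eps w1.
Notation T1 := (tan (theta g w1)).
Notation T2 := (tan (theta g w2)).
Hypothesis T10 : 0 < T1.
Hypothesis T20 : T2 < 0.
Hypothesis small_mid : small g w1 (sa ^+ 2 / 64).
Hypothesis small_c : small g w1 (curve_bound g (c2 g)).
Notation e12 := (edge g w1 w2).
Notation e21 := (edge g w2 w1).
Notation DR w := (Dmx f pR w).
Notation DL w := (Dmx f pL w).

(* Both solutions are taken at x = 0, which is t = P/2 for w2, t = - P/2 for w1. *)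
Definition connection : 'M[C]_n :=
  invmx (sol sD w2 (Pper w1 / 2)) *m sol sD w1 (- (Pper w1 / 2)).

(* The two solutions are compared along - P/2 -> apex -> P/2, which crosses
   Omega_L of w1 and Omega_R of w2; the second relation comes from the path
   symmetric about 0. *)
Theorem monodromy_relations : [/\ connection \in unitmx,
  connection = St pR w2 *m DR w2 *m connection *m St pL w1 *m DL w1 &
  St pL w2 *m DL w2 *m connection *m St pR w1 *m DR w1 = connection].
Proof.
have S1 : pi - 2 * gam < im w1 < 3 * pi + 2 * gam by case: wS1.
have S2 : pi - 2 * gam < im w2 < 3 * pi + 2 * gam by case: wS2.
have opp' := opp_sym opp.
have sg : 0 < T1 /\ T2 < 0 \/ T1 < 0 /\ 0 < T2 by left.
have sg' : 0 < T2 /\ T1 < 0 \/ T2 < 0 /\ 0 < T1 by right.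
have small_mid' : small g w2 (sa ^+ 2 / 64) by rewrite /small nm_eps (opp_nm opp) -nm_eps.
have small_c' : small g w2 (curve_bound g (c2 g)) by rewrite /small nm_eps (opp_nm opp) -nm_eps.
have [s1 [u1 sp12]] := edge_spec_exists gam0 gam1 S1 S2 c00 c01 h0 k0 r0 opp sg small_mid.
have [s2 [u2 sp21]] := edge_spec_exists gam0 gam1 S2 S1 c00 c01 h0 k0 r0 opp' sg' small_mid'.
have i01 : (0 : R) <= (0 : R) <= 1 by rewrite lexx ler01.
have i11 : (0 : R) <= (1 : R) <= 1 by rewrite ler01 lexx.
have h1 : (0 : R) <= (0 : R) <= s1 by rewrite lexx (andP (ss_01 sp12)).1.
have h2 : (0 : R) <= (0 : R) <= s2 by rewrite lexx (andP (ss_01 sp21)).1.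
have c20 := c2_gt0 gam0 gam1.
have loop1 := model_loop_exists gam0 gam1 S1 S2 c00 c01 h0 k0 r0 opp sg small_c sp12 sp21.
have loop2 := model_loop_exists gam0 gam1 S2 S1 c00 c01 h0 k0 r0 opp' sg' small_c' sp21 sp12.
have T20' : (0 < T2) = false by apply/negbTE; rewrite -leNgt ltW.
rewrite T10 in loop1; rewrite T20' in loop2.
have [cE1 _] := ss_curve sp12; have [_ cE2] := ss_curve sp21.
have O1 : OmegaLR g pL w1 (xt w1 (e12 s1)).
  have u10 : 0 < u1 by have := ss_sign sp12; rewrite pmulr_rgt0.
  rewrite cE1; apply: (curve_OmegaL gam0 gam1 S1 c00 c01 h0 k0 r0 c20 small_c u10).
  by have := ss_u1 sp12; rewrite (gtr0_norm u10).
have O2 : OmegaLR g pL w2 (xt w2 (- e21 s2)).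
  have u20 : u2 < 0 by have := ss_sign sp21; rewrite nmulr_rgt0.
  rewrite cE2; apply: (curve_OmegaL gam0 gam1 S2 c00 c01 h0 k0 r0 c20 small_c').
    by rewrite oppr_gt0.
  by have := ss_u1 sp21; rewrite (ltr0_norm u20).
have [a1 b1 d1] := loop_values hF hH wS1 hS loop1 O1.
have [a2 b2 d2] := loop_values hF hH wS2 hS loop2 O2.
have P21 : Pper w2 / 2 = - (Pper w1 / 2) by rewrite (opp_Pper opp) mulNr.
have P21' : - (Pper w2 / 2) = Pper w1 / 2 by rewrite P21 opprK.
rewrite P21' P21 in a2.
have E10 : e12 0 = - (Pper w1 / 2) := edge0 g w1 w2.
have E20 : e21 0 = Pper w1 / 2 by rewrite edge0.
have E1 : e21 1 = e12 1 by rewrite !edge1 (apex_sym sg).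
have Z1u : St pL w1 *m DL w1 *m invmx (DR w1) \in unitmx.
  by apply: unitmx_mul3; [exact: (stokes_unit wS1 hS pL)|exact: Dmx_unit|exact: Dmx_unit].
have Z2u : St pL w2 *m DL w2 *m invmx (DR w2) \in unitmx.
  by apply: unitmx_mul3; [exact: (stokes_unit wS2 hS pL)|exact: Dmx_unit|exact: Dmx_unit].
have in1 := ss_in sp12 i01; have in2 := ss_in sp21 i01.
have G1 : Gamma g sD w1 (- (Pper w1 / 2)) by rewrite -E10; exact: (ss_D sp12 h1).1.
have G2 : Gamma g sD w2 (Pper w1 / 2) by rewrite -E20; exact: (ss_D sp21 h2).1.
rewrite E10 in in1; rewrite E20 in in2.
have [_ us1] := sol_mxsol hH wS1 G1 in1; have [_ us2] := sol_mxsol hH wS2 G2 in2.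
have Au : connection \in unitmx := unitmx_quotient us2 us1.
have dA : sol sD w1 (- (Pper w1 / 2)) = sol sD w2 (Pper w1 / 2) *m connection.
  by rewrite /connection (mulKVmx us2).
move: connection Au dA => A Au dA.
have dRu := Dmx_unit f pR.
split; first exact: Au.
- have i1 : sol sD w1 (e12 0) = sol sU w2 (e12 0) *m (DR w2 *m A).
    by rewrite E10; exact: (mulmx_solve (dRu w2) a2 dA).
  have i2 : sol sD w2 (e21 0) = sol sU w1 (e21 0) *m (DR w1 *m invmx A).
    by rewrite E20; exact: (mulmx_solveV Au (dRu w1) a1 dA).
  (* The half paths from - P/2 and from P/2 meet at the apex. There [j1] expresses W_U of [w1] by
     W_U of [w2] and [j2] conversely, so the product of the two constants is the identity. *)
  have j1 := half_upper hH wS1 wS2 opp sp12 d1 i1.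
  have j2 := half_upper hH wS2 wS1 opp' sp21 b2 i2.
  rewrite E1 in j2.
  have e11 : inside g w2 (e12 1) := opp_inside opp (ss_in sp12 i11).
  have [_ us] := sol_mxsol hH wS2 (ss_2 sp12 i11).1 e11.
  have key := mulmx_return us j1 j2.
  exact: (upper_connection Au (dRu w1) key).
have i1 : sol sU w1 (- e12 0) = sol sD w2 (- e12 0) *m (A *m invmx (DR w1)).
  by rewrite E10 opprK; exact: (mulmx_chain a1 dA).
have i2 : sol sU w2 (- e21 0) = sol sD w1 (- e21 0) *m (invmx A *m invmx (DR w2)).
  by rewrite E20; exact: (mulmx_chain a2 (mulmx_moveR Au dA)).
have uR := stokes_unit wS1 hS pR.
have j1 := half_lower hH wS1 wS2 opp sp12 uR b1 i1.
have j2 := half_lower hH wS2 wS1 opp' sp21 Z2u d2 i2.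
rewrite E1 in j2.
have e11 : inside g w2 (- e12 1) := insideN (opp_inside opp (ss_in sp12 i11)).
have [_ us] := sol_mxsol hH wS2 (ss_2 sp12 i11).2 e11.
have key := mulmx_return us j1 j2.
exact: (lower_connection Au (dRu w1) (dRu w2) (stokes_unit wS2 hS pL) Z2u uR key).
Qed.

End Monodromy.

(** * Slopes, exponents and model solutions on the auto-intersection *)

Section CapSigns.
Variables (R : realType) (g : geometry R) (rho : R) (w : Cplx R).
Notation C := (Cplx R).
Notation gam := (g_gamma g).
Hypothesis gam0 : 0 < gam.
Hypothesis gam1 : gam * (1 + 2 * gam / pi) < pi / 2.
Hypothesis wcap : capS gam rho w.

Lemma im_turn (v : C) : im (turn v) = im v + 2 * pi.
Proof. by rewrite /turn imD imMofR im_iC mulr1. Qed.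

Lemma capS_im : pi - 2 * gam < im w < pi + 2 * gam.
Proof.
case: wcap => -[_ /andP[h1 _]] [_ /andP[_ h2]]; rewrite im_turn in h2.
by rewrite h1; lra.
Qed.

(** theta has the sign of pi - arg sqrt eps, and arg sqrt eps is below pi / 2 + gam < pi at bar-eps
    but above 3 pi / 2 - gam > pi at tilde-eps. *)
Lemma capS_tan : 0 < tan (theta g w) /\ tan (theta g (turn w)) < 0.
Proof.
have p0 := pi_gt0 R; case: wcap => -[_ S1] [_ S2].
have c1 := cos_th gam0 gam1 S1; have c2 := cos_th gam0 gam1 S2.
have b1 := th_bound gam0 S1; have b2 := th_bound gam0 S2.
have g2 : 2 * gam < pi.
  have := al0_lt gam0 gam1; have := gam1; rewrite gamE; have := al0_gt0 gam0; lra.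
have k0 : 0 < 2 * gam / pi by rewrite divr_gt0 // mulr_gt0.
have t1 : 0 < theta g w.
  by rewrite /theta /arg_sqrt mulr_gt0 // subr_gt0; have /andP[_ h] := capS_im; lra.
have t2 : theta g (turn w) < 0.
  rewrite /theta /arg_sqrt pmulr_rlt0 // subr_lt0 im_turn.
  by have /andP[h _] := capS_im; lra.
split; rewrite /tan.
  rewrite divr_gt0 // sin_gt0_pi //; move/andP: b1 => [_ b1]; have := gam1.
  by move=> ?; apply/andP; split; lra.
rewrite ltr_pdivrMr // mul0r -oppr_gt0 -sinN sin_gt0_pi //.
by move/andP: b2 => [b2 _]; have := gam1; move=> ?; apply/andP; split; lra.
Qed.

End CapSigns.

Lemma cexp_polar (R : realType) (a : R) :
  cexp (ofR a * iC) = ofR (cos a) + ofR (sin a) * iC.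
Proof.
have r0 : re (ofR a * iC) = 0 by rewrite reMofR re_iC mulr0.
have i0 : im (ofR a * iC) = a by rewrite imMofR im_iC mulr1.
apply: Cplx_eq; rewrite ?re_cexp ?im_cexp r0 i0 expR0 mul1r.
  by rewrite reD reMofR re_iC re_ofR mulr0 addr0.
by rewrite imD imMofR im_iC im_ofR mulr1 add0r.
Qed.

Section GapRotation.
Variables (R : realType) (n : nat) (f : prenormal_family R n) (gam rho : R).
Notation C := (Cplx R).
Notation a0 := (gam * (1 + 2 * gam / pi)).
Hypothesis gam0 : 0 < gam.
Hypothesis gam1 : a0 < pi / 2.
Hypothesis hgap : gap_on_sector f gam rho.

Lemma re_rot (b : R) (z : C) : re (cexp (ofR b * iC) * z) = cos b * re z - sin b * im z.
Proof.
by rewrite reM re_cexp im_cexp reMofR imMofR re_iC im_iC mulr0 mulr1 expR0 !mul1r.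
Qed.

(** The two extreme rotations by a0 and - a0 together say that the gap lies in the cone sin a0 |Im|
    < cos a0 Re, which remains in the right half-plane under every rotation by at most a0. *)
Lemma gap_rot (b : R) w l (q j : 'I_n) : `|b| <= a0 -> sectorS gam rho w -> (q < j)%N ->
  0 < re (cexp (ofR b * iC) * gap f q j (eps w) (hatx l w)).
Proof.
move=> hb wS qj; have [c cp /(_ w l q j wS qj)[h1 h2]] := hgap.
have p0 := pi_gt0 R.
have a00 : 0 < a0 by rewrite mulr_gt0 // addr_gt0 // divr_gt0 // mulr_gt0.
move: h1 h2; rewrite -mulNr -ofRN !re_rot cosN sinN.
move: (re _) (im _) hb a00 (gam1); move: a0 => a x y hb a00 a1 h1 h2.
have ca : 0 < cos a by apply: cos_gt0_pihalf; apply/andP; split; lra.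
have sap : 0 <= sin a by apply: sin_ge0_pi; apply/andP; split; lra.
have x0 : 0 < x by rewrite -(pmulr_rgt0 _ ca); lra.
have absN (v : R) : cos `|v| = cos v by case: (leP 0 v) => h; rewrite ?(ger0_norm h) ?(ltr0_norm h) ?cosN.
have b1 : cos a <= cos b.
  rewrite -(absN b); move: hb; rewrite le_eqVlt => /orP[/eqP -> //|lt]; apply: ltW.
  rewrite ltr_cos // in_itv /=; apply/andP; split; have := normr_ge0 b; lra.
have sb : `|sin b| = sin `|b|.
  have sb0 : 0 <= sin `|b| by apply: sin_ge0_pi; rewrite normr_ge0 /=; lra.
  by case: (leP 0 b) sb0 => h; rewrite ?(ger0_norm h) ?(ltr0_norm h) ?sinN => k; rewrite ?(ger0_norm k) //;
     rewrite ler0_norm //; lra.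
have b2 : `|sin b| <= sin a.
  rewrite sb; have := @ltr_sin R.
  move: hb; rewrite le_eqVlt => /orP[/eqP -> //|lt] _; apply: ltW.
  rewrite ltr_sin // in_itv /=; apply/andP; split; have := normr_ge0 b; lra.
have yb : sin a * `|y| < cos a * x.
  by case: (leP 0 y) => y0; rewrite ?(ger0_norm y0) ?(ltr0_norm y0); lra.
have : `|sin b * y| <= sin a * `|y| by rewrite normrM ler_wpM2r.
have : cos a * x <= cos b * x by rewrite ler_wpM2r // ltW.
have := ler_norm (sin b * y); lra.
Qed.

(** The turn exchanges x_L and x_R, and the exponents of D_L and D_R carry opposite signs. *)
Lemma Dmx_turn w : Dmx f pR (turn w) *m Dmx f pL w = 1%:M /\
  Dmx f pL (turn w) *m Dmx f pR w = 1%:M.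
Proof.
have hR : hatx pR (turn w) = hatx pL w by rewrite /hatx sqrt_eps_turn opprK.
have hL : hatx pL (turn w) = hatx pR w by rewrite /hatx sqrt_eps_turn.
have e1 : Uexp f pR (turn w) = Uexp f pL w by rewrite /Uexp hR eps_turn.
have e2 : Uexp f pL (turn w) = Uexp f pR w by rewrite /Uexp hL eps_turn.
by split; rewrite /Dmx ?e1 ?e2 expdiagD scaleNr ?addNr ?subrr expdiag0.
Qed.

(* On the auto-intersection i / sqrt eps is a positive multiple of e^{i b}
   with |b| < gamma. *)
Lemma Dmx_distinct w l (q j : 'I_n) : capS gam rho w -> q != j ->
  Dmx f l w q q != Dmx f l w j j.
Proof.
move=> wc; have [wS _] := wc.
wlog lt : q j / (q < j)%N.
  move=> h qj; have [lt|] := ltnP q j; first exact: h.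
  rewrite leq_eqVlt => /orP[/eqP/val_inj e|lt]; first by rewrite e eqxx in qj.
  by rewrite eq_sym; apply: h => //; rewrite eq_sym.
move=> _; pose b := pi / 2 - arg_sqrt w; have p0 := pi_gt0 R.
have m0 := sqrt_eps_gt0 w.
have hb : `|b| <= a0.
  have e : a0 = gam + 2 * gam ^+ 2 / pi by rewrite mulrDr mulr1; congr (_ + _); rewrite expr2; ring.
  have : 0 < 2 * gam ^+ 2 / pi by rewrite divr_gt0 // mulr_gt0 // exprn_gt0.
  have cw := @capS_im R (Geometry gam 1 1 1 1) rho w wc.
  move: cw => /andP[/= c1 c2]; rewrite e ler_norml /b /arg_sqrt => ?; apply/andP; split; lra.
have k := gap_rot l hb wS lt.
pose c := ofR (2 * pi) * iC / (2 * sqrt_eps w) : C.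
have DE i : Dmx f l w i i = cexp (c * lam f (eps w) (hatx l w) ord0 i).
  have q0 := sqrt_eps_neq0 w.
  by case: l {k}; rewrite /Dmx expdiag_ii /Uexp !mxE /c /=; congr cexp; field.
have cE : c = ofR (pi / nm (sqrt_eps w)) * cexp (ofR b * iC).
  have q0 := sqrt_eps_neq0 w.
  have sE : sqrt_eps w = ofR (nm (sqrt_eps w)) * cexp (ofR (arg_sqrt w) * iC).
    by rewrite cexp_polar {1}sqrt_epsE.
  have iE' : cexp (ofR (pi / 2) * iC) = iC :> C.
    by rewrite cexp_polar cos_pihalf sin_pihalf add0r mul1r.
  have bE : cexp (ofR b * iC) = iC / cexp (ofR (arg_sqrt w) * iC).
    by rewrite -[X in _ = X / _]iE' -cexpB; congr cexp; rewrite /b ofRB; ring.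
  rewrite bE /c {1}sE ofRM ofRM ofRV ofR_nat.
  have n0 : ofR (nm (sqrt_eps w)) != 0 :> C by rewrite ofR_eq0 gt_eqF.
  by move: (cexp_neq0 (ofR (arg_sqrt w) * iC)) n0; move: (cexp _) (ofR (nm _)) => x y x0 y0; field; rewrite x0 y0.
rewrite !DE; apply/eqP => e.
have : nm (cexp (c * gap f q j (eps w) (hatx l w))) = 1.
  by rewrite /gap mulrBr cexpB e divff ?nm1 // cexp_neq0.
rewrite nm_cexp cE -mulrA reMofR => /eqP; rewrite -expR0 => /eqP/expR_inj.
by apply/eqP; rewrite gt_eqF // mulr_gt0 // divr_gt0.
Qed.

End GapRotation.

Section ModelTurn.
Variables (R : realType) (n : nat) (f : prenormal_family R n) (g : geometry R).
Variables (rho delta : R) (F : side -> Cplx R -> Cplx R -> 'M[Cplx R]_n).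
Notation C := (Cplx R).
Notation gam := (g_gamma g).
Notation sa := (sin (2 * gam ^+ 2 / pi)).
Hypothesis gam0 : 0 < gam.
Hypothesis gam1 : gam * (1 + 2 * gam / pi) < pi / 2.
Hypothesis c00 : 0 < g_c0 g.
Hypothesis c01 : g_c0 g <= pi / 4 * sa.
Hypothesis h0 : 0 < g_h g.
Hypothesis k0 : 0 < g_kappa g.
Hypothesis r0 : 0 < g_r g.
Hypothesis hF : model_solutions f g delta rho F.
Variable w : C.
Hypothesis wcap : capS gam rho w.
Hypothesis small_mid : small g w (sa ^+ 2 / 64).

Lemma halfP_mem v : pi - 2 * gam < im v < 3 * pi + 2 * gam -> small g v (sa ^+ 2 / 64) ->
  inside g v (- (Pper v / 2)) /\ Gamma g sD v (- (Pper v / 2)).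
Proof.
move=> vS sv; have L0 := L_gt0 gam0 gam1 vS.
have e : ell (tan (theta g v)) (- (Pper v / 2)) = - (ell (tan (theta g v)) (Pper v) / 2).
  by rewrite ellN half_ofR ellZ mulrC.
have iv : inside g v (- (Pper v / 2)).
  by apply: inside_midline => //; rewrite e normrN gtr0_norm // divr_gt0.
by split => //; apply: GammaD_midline.
Qed.

Lemma ccont_halfP v : ccont (fun v : C => - (Pper v / 2)) v.
Proof.
have h1 := cderivM (cderiv_id v) (cderiv_cst (2^-1) v).
have h2 := cderiv_comp h1 (cderiv_cexp _).
have h3 := cderivV (sqrt_eps_neq0 v) h2.
exact: cderiv_ccont (cderivN (cderivM (cderivM (cderiv_cst (- (ofR pi * iC)) v) h3) (cderiv_cst (2^-1) v))).
Qed.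

(* Along the segment from w to turn w the point t = - P/2 is mapped to x = 0, so
   that cexp lg = - eps there and lg increases by 2 pi i. *)
Lemma FD_turn : F sD w 0 = F sD (turn w) 0 *m Dmx f pR w.
Proof.
have [lg [cl el _ Fl]] := FD_branch hF.
pose c : C := ofR (2 * pi) * iC.
pose ws (s : R) := w + ofR s * c.
pose ts s := - (Pper (ws s) / 2).
have rews s : re (ws s) = re w.
  by rewrite /ws reD reMofR /c reMofR re_iC !mulr0 addr0.
have imws s : im (ws s) = im w + s * (2 * pi).
  by rewrite /ws imD imMofR /c imMofR im_iC mulr1.
have nmws s : nm (eps (ws s)) = nm (eps w) by rewrite !nm_cexp rews.
have p0 := pi_gt0 R.
have wsS s : 0 <= s <= 1 -> sectorS gam rho (ws s).
  move=> /andP[s0 s1]; have [[a /andP[b1 b2]] [_ /andP[b3 b4]]] := wcap; split.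
    by rewrite norm_nm nmws -norm_nm.
  have i0 : 0 <= s * (2 * pi) by rewrite mulr_ge0 // mulr_ge0 // ltW.
  have i1 : s * (2 * pi) <= 2 * pi by rewrite ler_piMl // mulr_ge0 // ltW.
  by rewrite im_turn in b4; rewrite imws; apply/andP; split; lra.
have mem s : 0 <= s <= 1 -> Gamma g sD (ws s) (ts s).
  move=> /wsS[_ hs]; have [] // := halfP_mem hs.
  by rewrite /small nmws.
have pw : path_continuous ws.
  by apply: (@ccont_path _ (fun t => t)) => s _; exact: ccont_id.
have pt : path_continuous ts.
  by apply: (@ccont_path _ (fun v : C => - (Pper v / 2))) => s _; exact: ccont_halfP.
have pl : path_continuous (fun s => lg (ws s) (ts s)).
  apply: (@within_path _ _ (fun p => lg p.1 p.2) ws ts cl) => // s hs.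
  by split; [exact: wsS|exact: mem].
have elw s : 0 <= s <= 1 -> cexp (lg (ws s) (ts s)) = - cexp (ws s).
  by move=> hs; rewrite el //; [rewrite (xt_halfP (ws s)).2 expr0n sub0r|exact: wsS|exact: mem].
(* ws s + pi i is the explicit logarithm of - eps with which lg is compared along the segment. *)
have pw' : path_continuous (fun s => ws s + ofR pi * iC).
  apply: (@ccont_path _ (fun t => t + ofR pi * iC)) => s _.
  exact: ccontD (ccont_id _) (ccont_cst _ _).
have H := path_continuous_exp_const (path_continuousB pl pw').
have {}H : lg (ws 1) (ts 1) - ws 1 = lg (ws 0) (ts 0) - ws 0.
  have : lg (ws 1) (ts 1) - (ws 1 + ofR pi * iC) = lg (ws 0) (ts 0) - (ws 0 + ofR pi * iC).
    by apply: H => s hs; rewrite cexpB elw // cexpD cexp_pi mulrN1 divff ?oppr_eq0 ?cexp_neq0.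
  by rewrite !opprD !addrA => /addIr.
have i0 : 0 <= (0 : R) <= 1 by rewrite lexx ler01.
have i1 : 0 <= (1 : R) <= 1 by rewrite ler01 lexx.
have w0 : ws 0 = w by rewrite /ws ofR0 mul0r addr0.
have w1 : ws 1 = turn w by rewrite /ws ofR1 mul1r.
have F0 := Fl _ _ (wsS _ i0) (mem _ i0); have F1 := Fl _ _ (wsS _ i1) (mem _ i1).
rewrite (xt_halfP _).2 in F0; rewrite (xt_halfP _).2 in F1.
have t1 : ts 1 = Pper w / 2 by rewrite /ts w1 Pper_turn mulNr opprK.
rewrite t1 w1 eps_turn in F1; rewrite t1 w1 w0 in H; rewrite w0 in F0.
have t0 : ts 0 = - (Pper w / 2) by rewrite /ts w0.
rewrite t0 in H F0; rewrite F0 F1 (sqrt_D f w).1 expdiagD; congr expdiag.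
have -> : lg (turn w) (Pper w / 2) = lg w (- (Pper w / 2)) + c.
  by move: H => /eqP; rewrite subr_eq => /eqP ->; rewrite /turn -/c; ring.
apply/rowP => i; rewrite !mxE -/c; move: (pf_L0 _ _ _ _) (pf_L1 _ _ _ _) (Pper w) => x y P.
by field.
Qed.

End ModelTurn.

(** * Triangular factorizations and minors *)

Section DiagonalMatrices.
Variables (K : fieldType) (n : nat).
Implicit Types A D M Q T S X Y : 'M[K]_n.

Lemma is_diagE D : is_diag_mx D -> D = diag_mx (\row_i D i i).
Proof.
move=> /is_diag_mxP hD; apply/matrixP => i j; rewrite !mxE.
by have [->|ij] := eqVneq i j; rewrite ?mulr1n // mulr0n hD.
Qed.

Lemma diag_commute D Q : is_diag_mx D -> is_diag_mx Q -> D *m Q = Q *m D.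
Proof. by move=> /is_diagE -> /is_diagE ->; rewrite !mulmx_diag; congr diag_mx; apply/rowP => i; rewrite !mxE mulrC. Qed.

Lemma commute_is_diag D A : is_diag_mx D -> (forall q j, q != j -> D q q != D j j) ->
  D *m A = A *m D -> is_diag_mx A.
Proof.
move=> dD hd e; apply/is_diag_mxP => i j ij.
have := congr1 (fun M : 'M[K]_n => M i j) e; rewrite {1 2}(is_diagE dD) mul_diag_mx mul_mx_diag !mxE.
move=> /eqP; rewrite mulrC -subr_eq0 -mulrBr mulf_eq0 subr_eq0 (negbTE (hd _ _ ij)) orbF.
by move/eqP.
Qed.

Lemma diag_mul D Q : is_diag_mx D -> is_diag_mx Q -> is_diag_mx (D *m Q).
Proof. by move=> /is_diagE -> /is_diagE ->; rewrite mulmx_diag diag_mx_is_diag. Qed.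

Lemma diag_inv D : is_diag_mx D -> D \in unitmx ->
  is_diag_mx (invmx D) /\ forall i, invmx D i i = (D i i)^-1.
Proof.
move=> dD uD; have d0 i : D i i != 0.
  have : \det D != 0 by rewrite -unitfE -unitmxE.
  by rewrite {1}(is_diagE dD) det_diag => /prodf_neq0 h; have := h i isT; rewrite mxE.
have e : invmx D = diag_mx (\row_i (D i i)^-1).
  have e1 : D *m diag_mx (\row_i (D i i)^-1) = 1%:M.
    rewrite {1}(is_diagE dD) mulmx_diag; apply/matrixP => i j; rewrite !mxE.
    by rewrite divff.
  by rewrite -[RHS](mulKmx uD) e1 mulmx1.
by rewrite e diag_mx_is_diag; split => // i; rewrite !mxE eqxx.
Qed.

Section Transition.
Variables (A DR DL DR' DL' CR CL CR' CL' TR TL TR' TL' : 'M[K]_n).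
Hypotheses (uA : A \in unitmx) (dDR : is_diag_mx DR) (dDL : is_diag_mx DL).
Hypotheses (uDR : DR \in unitmx) (uDL : DL \in unitmx).
Hypotheses (sDR : forall q j, q != j -> DR q q != DR j j) (sDL : forall q j, q != j -> DL q q != DL j j).
Hypotheses (eR : DR' *m DL = 1%:M) (eL : DL' *m DR = 1%:M).
Hypotheses (uTR : TR \in unitmx) (uTL : TL \in unitmx) (uTR' : TR' \in unitmx) (uTL' : TL' \in unitmx).
Hypothesis tR : invmx TR *m CR *m DR *m TR = DR.
Hypothesis tL : invmx TL *m CL *m DL *m TL = DL.
Hypothesis tR' : invmx TR' *m CR' *m DR' *m TR' = DR'.
Hypothesis tL' : invmx TL' *m CL' *m DL' *m TL' = DL'.
Hypothesis m1 : A = CR' *m DR' *m A *m CL *m DL.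
Hypothesis m2 : CL' *m DL' *m A *m CR *m DR = A.

(** For B = T'^-1 A T the three relations combine to D' B D = B, and D' is the inverse of D. *)
Lemma conj_intertwines (D T D' T' S S' : 'M[K]_n) : T \in unitmx -> T' \in unitmx -> D' *m D = 1%:M ->
  invmx T *m S *m D *m T = D -> invmx T' *m S' *m D' *m T' = D' ->
  S' *m D' *m A *m S *m D = A -> D *m (invmx T' *m A *m T) = (invmx T' *m A *m T) *m D.
Proof.
move=> uT uT' e t t' m.
have h : (invmx T' *m S' *m D' *m T') *m (invmx T' *m A *m T) *m (invmx T *m S *m D *m T) =
    invmx T' *m A *m T.
  by rewrite -[in RHS]m !mulmxA (mulmxK uT') (mulmxK uT).
rewrite t' t in h.
have e' : D *m D' = 1%:M by apply: mulmx1C.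
by rewrite -[in LHS]h !mulmxA e' mul1mx.
Qed.

(** The factor D_R^-1 accounts for F_D (bar, 0) = F_D (tilde, 0) D_R; with it the diagonal matrix
    belongs to a conjugate of G, which is close to I. *)
Definition QU := invmx TR' *m A *m TL *m invmx DR.
Definition QD := invmx TL' *m A *m TR *m invmx DR.

Lemma transition_matrices : [/\ is_diag_mx QU, is_diag_mx QD, QU \in unitmx, QD \in unitmx &
  [/\ QD *m (DR *m invmx TR *m TL *m invmx DR) = invmx TL' *m TR' *m QU,
      QD *m (invmx TR *m TL) = DL' *m invmx TL' *m TR' *m invmx DL' *m QU,
      A *m invmx DR = TR' *m QU *m (DR *m invmx TL *m invmx DR) &
      A *m invmx DR = TL' *m QD *m (DR *m invmx TR *m invmx DR)]].
Proof.
have [dV _] := diag_inv dDR uDR.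
have k1 : is_diag_mx (invmx TR' *m A *m TL).
  by apply: (commute_is_diag dDL sDL); exact: (conj_intertwines uTL uTR' eR tL tR' (esym m1)).
have k2 : is_diag_mx (invmx TL' *m A *m TR).
  by apply: (commute_is_diag dDR sDR); exact: (conj_intertwines uTR uTL' eL tR tL' m2).
have eLV : DL' = invmx DR by rewrite -[DL'](mulmxK uDR) eL mul1mx.
have q1 : is_diag_mx QU by exact: diag_mul.
have q2 : is_diag_mx QD by exact: diag_mul.
split => //; try by rewrite !unitmx_mul !unitmx_inv uA ?uTR' ?uTL' ?uTR ?uTL ?uDR.
split.
- by rewrite /QD /QU !mulmxA (mulmxKV uDR) (mulmxK uTR) (mulmxK uTR').
- rewrite eLV invmxK /QU -(diag_commute dV k1) /QD -(diag_commute dV k2) !mulmxA.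
  by rewrite (mulmxK uTR) (mulmxK uDR) (mulmxK uTR').
- by rewrite /QU !mulmxA (mulmxKV uDR) (mulmxK uTL) (mulmxV uTR') mul1mx.
- by rewrite /QD !mulmxA (mulmxKV uDR) (mulmxK uTR) (mulmxV uTL') mul1mx.
Qed.

End Transition.

Section Masks.
Variable p : pred 'I_n.

(** The principal submatrix on the indices in [p], padded with an identity block. Its determinant is
    the principal minor, and no matrix changes its size. *)
Definition maskmx (A : 'M[K]_n) : 'M[K]_n :=
  \matrix_(i, j) if p i && p j then A i j else (i == j)%:R.

Lemma maskmx_mulL A Q : (forall i m, p i -> ~~ p m -> A i m = 0) -> maskmx (A *m Q) = maskmx A *m maskmx Q.
Proof.
move=> hA; apply/matrixP => i j; rewrite !mxE.
case pi: (p i) => /=; last first.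
  rewrite (bigD1 i) //= big1 ?addr0; last first.
    by move=> k ki; rewrite !mxE pi /= eq_sym (negbTE ki) mul0r.
  by rewrite !mxE pi /= eqxx mul1r.
case pj: (p j).
  apply: eq_bigr => k _; rewrite !mxE pi pj /=; case pk: (p k) => //=.
  have ik : (i == k) = false by apply/eqP => e; rewrite -e pi in pk.
  by rewrite hA ?pk // ik !mul0r.
rewrite (bigD1 i) //= big1 ?addr0; last first.
  move=> k ki; rewrite !mxE pi pj andbF /=; have [->|kj] := eqVneq k j; last by rewrite mulr0.
  have ij : (i == j) = false by apply/eqP => e; rewrite e pj in pi.
  by rewrite pj ij mul0r.
have ij : (i == j) = false by apply/eqP => e; rewrite e pj in pi.
by rewrite !mxE pi pj /= ij mulr0.
Qed.

Lemma maskmx_mulR A Q : (forall m j, p j -> ~~ p m -> Q m j = 0) -> maskmx (A *m Q) = maskmx A *m maskmx Q.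
Proof.
move=> hQ; apply/matrixP => i j; rewrite !mxE.
case pj: (p j); rewrite ?andbT ?andbF; last first.
  rewrite (bigD1 j) //= big1 ?addr0; last first.
    by move=> k kj; rewrite !mxE pj andbF (negbTE kj) mulr0.
  by rewrite !mxE pj andbF /= eqxx mulr1.
case pi: (p i).
  apply: eq_bigr => k _; rewrite !mxE pi pj /=; case pk: (p k) => //=.
  have ik : (i == k) = false by apply/eqP => e; rewrite -e pi in pk.
  by rewrite hQ ?pk // ik mulr0 mul0r.
rewrite (bigD1 i) //= big1 ?addr0; last first.
  by move=> k ki; rewrite !mxE pi /= eq_sym (negbTE ki) mul0r.
have ij : (i == j) = false by apply/eqP => e; rewrite e pj in pi.
by rewrite !mxE pi pj /= ij mulr0.
Qed.

Lemma maskmx_diag_zero D i m : is_diag_mx D -> p i -> ~~ p m -> D i m = 0 /\ D m i = 0.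
Proof.
by move=> /is_diag_mxP hD pi pm; split; apply: hD; apply: contraNneq pm => /val_inj; [move=> <-|move=> ->].
Qed.

Lemma det_mask_trig A : is_trig_mx A -> \det (maskmx A) = \prod_(i | p i) A i i.
Proof.
move=> /is_trig_mxP hA; rewrite det_trig.
  rewrite [RHS]big_mkcond /=; apply: eq_bigr => i _; rewrite mxE eqxx andbb.
  by case: (p i).
apply/is_trig_mxP => i j ij; rewrite mxE; case: ifP => _; first exact: hA.
by case: eqP ij => // ->; rewrite ltnn.
Qed.

Lemma maskmx_tr A : maskmx A^T = (maskmx A)^T.
Proof. by apply/matrixP => i j; rewrite !mxE andbC eq_sym. Qed.

Lemma maskmx1 : maskmx 1%:M = 1%:M.
Proof. by apply/matrixP => i j; rewrite !mxE; case: ifP. Qed.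

(** Restriction to [p] is multiplicative when one factor is diagonal, so the two determinants of D
    cancel. This passes from F^-1 G F to G, whatever the size of F. *)
Lemma det_mask_conj D A : is_diag_mx D -> D \in unitmx ->
  \det (maskmx (invmx D *m A *m D)) = \det (maskmx A).
Proof.
move=> dD uD; have [dV _] := diag_inv dD uD.
have hD m j : p j -> ~~ p m -> D m j = 0 by move=> a b; exact: (maskmx_diag_zero dD a b).2.
have hV i m : p i -> ~~ p m -> invmx D i m = 0 by move=> a b; exact: (maskmx_diag_zero dV a b).1.
rewrite (maskmx_mulR _ hD) (maskmx_mulL _ hV) !det_mulmx mulrAC -det_mulmx -(maskmx_mulL _ hV) mulVmx //.
by rewrite maskmx1 det1 mul1r.
Qed.

(** X keeps rows in [p] inside [p] and Y does so with columns, hence restriction to [p] is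
    multiplicative on both sides of M Y = X Q. *)
Lemma det_mask_factor M X Q Y : is_diag_mx Q -> M *m Y = X *m Q ->
  (forall i m, p i -> ~~ p m -> X i m = 0) -> (forall m j, p j -> ~~ p m -> Y m j = 0) ->
  \det (maskmx X) = 1 -> \det (maskmx Y) = 1 ->
  \det (maskmx M) = \prod_(i | p i) Q i i.
Proof.
move=> dQ e hX hY dX dY.
rewrite -[LHS]mulr1 -[X in _ * X = _]dY -det_mulmx -(maskmx_mulR _ hY) e (maskmx_mulL _ hX) det_mulmx dX mul1r.
by apply: det_mask_trig; exact: is_diag_mx_is_trig.
Qed.

End Masks.

Definition from (k : nat) : pred 'I_n := fun i => (k <= i)%N.
Definition upto (k : nat) : pred 'I_n := fun i => (i < k)%N.

Lemma det_mask_lower p A : lower_unipotent A -> \det (maskmx p A) = 1.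
Proof. by move=> [tA dA]; rewrite det_mask_trig // big1. Qed.

Lemma det_mask_upper p A : upper_unipotent A -> \det (maskmx p A) = 1.
Proof. by move=> uA; rewrite -det_tr -maskmx_tr det_mask_lower. Qed.

Lemma conj_lower D A : is_diag_mx D -> D \in unitmx -> lower_unipotent A ->
  lower_unipotent (D *m A *m invmx D).
Proof.
move=> dD uD [/is_trig_mxP tA dA]; have [dV eV] := diag_inv dD uD.
have E i j : (D *m A *m invmx D) i j = D i i * A i j * (D j j)^-1.
  by rewrite {1}(is_diagE dD) (is_diagE dV) mul_diag_mx mul_mx_diag !mxE eV.
split; first by apply/is_trig_mxP => i j ij; rewrite E tA // mulr0 mul0r.
move=> i; rewrite E dA mulr1 divff //; apply: contraTneq uD => d0.
by rewrite unitmxE unitfE (is_diagE dD) det_diag (bigD1 i) //= mxE d0 mul0r eqxx.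
Qed.

Lemma conj_upper D A : is_diag_mx D -> D \in unitmx -> upper_unipotent A ->
  upper_unipotent (D *m A *m invmx D).
Proof.
move=> dD uD [/is_trig_mxP tA dA]; have [dV eV] := diag_inv dD uD.
have E i j : (D *m A *m invmx D) i j = D i i * A i j * (D j j)^-1.
  by rewrite {1}(is_diagE dD) (is_diagE dV) mul_diag_mx mul_mx_diag !mxE eV.
have dA' i : A i i = 1 by have := dA i; rewrite mxE.
split.
  apply/is_trig_mxP => i j ij; rewrite mxE E.
  by have := tA i j ij; rewrite mxE => ->; rewrite mulr0 mul0r.
move=> i; rewrite mxE E dA' mulr1 divff //; apply: contraTneq uD => d0.
by rewrite unitmxE unitfE (is_diagE dD) det_diag (bigD1 i) //= mxE d0 mul0r eqxx.
Qed.

Lemma det_mask_UDL k M X Q Y : is_diag_mx Q -> M *m Y = X *m Q ->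
  upper_unipotent X -> lower_unipotent Y ->
  \det (maskmx (from k) M) = \prod_(i | from k i) Q i i.
Proof.
move=> dQ e uX uY; apply: (det_mask_factor dQ e _ _ (det_mask_upper _ uX) (det_mask_lower _ uY)).
- move=> i m; rewrite /from -ltnNge => ki mk; case: uX => /is_trig_mxP tX _.
  by have := tX m i (leq_trans mk ki); rewrite mxE.
- move=> m j; rewrite /from -ltnNge => kj mk; case: uY => /is_trig_mxP tY _.
  exact: tY (leq_trans mk kj).
Qed.

Lemma det_mask_LDU k M X Q Y : is_diag_mx Q -> M *m Y = X *m Q ->
  lower_unipotent X -> upper_unipotent Y ->
  \det (maskmx (upto k) M) = \prod_(i | upto k i) Q i i.
Proof.
move=> dQ e uX uY; apply: (det_mask_factor dQ e _ _ (det_mask_lower _ uX) (det_mask_upper _ uY)).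
- move=> i m; rewrite /upto -leqNgt => ik km; case: uX => /is_trig_mxP tX _.
  exact: tX (leq_trans ik km).
- move=> m j; rewrite /upto -leqNgt => jk km; case: uY => /is_trig_mxP tY _.
  by have := tY j m (leq_trans jk km); rewrite mxE.
Qed.

Lemma prod_from Q (k : 'I_n) : \prod_(i | from k i) Q i i = Q k k * \prod_(i | from k.+1 i) Q i i.
Proof.
rewrite (bigD1 k) /=; last exact: leqnn.
by congr (_ * _); apply: eq_bigl => i; rewrite /from andbC ltn_neqAle eq_sym.
Qed.

Lemma prod_upto Q (k : 'I_n) : \prod_(i | upto k.+1 i) Q i i = Q k k * \prod_(i | upto k i) Q i i.
Proof.
rewrite (bigD1 k) /=; last exact: leqnn.
by congr (_ * _); apply: eq_bigl => i; rewrite /upto andbC ltnS ltn_neqAle.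
Qed.

End DiagonalMatrices.

Section MinorQuotients.
Variables (K : fieldType) (n : nat).
Implicit Types G Q : 'M[K]_n.

(* For U Q L with Q diagonal, U upper and L lower unipotent, the minors on
   the last indices are partial products of Q; for L Q U, those on the first. *)
Definition minor_quotients (s : side) G : 'M[K]_n := diag_mx (\row_k
  match s with
  | sU => \det (maskmx (from k) G) / \det (maskmx (from k.+1) G)
  | sD => \det (maskmx (upto k.+1) G) / \det (maskmx (upto k) G)
  end).

Definition minors_neq0 G := forall k, \det (maskmx (from k) G) != 0 /\ \det (maskmx (upto k) G) != 0.

Lemma diag_entries_neq0 Q i : is_diag_mx Q -> Q \in unitmx -> Q i i != 0.
Proof.
move=> dQ uQ; apply: contraTneq uQ => q0.
by rewrite unitmxE unitfE (is_diagE dQ) det_diag (bigD1 i) //= mxE q0 mul0r eqxx.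
Qed.

Lemma minor_quotientsU G Q : is_diag_mx Q -> Q \in unitmx ->
  (forall k, \det (maskmx (from k) G) = \prod_(i | from k i) Q i i) ->
  (forall k, \det (maskmx (from k) G) != 0) /\ minor_quotients sU G = Q.
Proof.
move=> dQ uQ h; have nz k : \det (maskmx (from k) G) != 0.
  by rewrite h; apply/prodf_neq0 => i _; exact: diag_entries_neq0.
split => //; rewrite [RHS](is_diagE dQ); congr diag_mx; apply/rowP => k; rewrite !mxE.
by have := nz k.+1; rewrite !h prod_from => z; rewrite mulfK.
Qed.

Lemma minor_quotientsD G Q : is_diag_mx Q -> Q \in unitmx ->
  (forall k, \det (maskmx (upto k) G) = \prod_(i | upto k i) Q i i) ->
  (forall k, \det (maskmx (upto k) G) != 0) /\ minor_quotients sD G = Q.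
Proof.
move=> dQ uQ h; have nz k : \det (maskmx (upto k) G) != 0.
  by rewrite h; apply/prodf_neq0 => i _; exact: diag_entries_neq0.
split => //; rewrite [RHS](is_diagE dQ); congr diag_mx; apply/rowP => k; rewrite !mxE.
by have := nz k; rewrite !h prod_upto => z; rewrite mulfK.
Qed.

End MinorQuotients.

Lemma factor_move (K : fieldType) (n : nat) (G F A D X Q T : 'M[K]_n) :
  F \in unitmx -> D \in unitmx -> T \in unitmx ->
  A = invmx F *m G *m (F *m D) -> A *m invmx D = X *m Q *m (D *m invmx T *m invmx D) ->
  invmx F *m G *m F *m (D *m T *m invmx D) = X *m Q.
Proof.
move=> uF uD uT eA e.
have -> : invmx F *m G *m F = A *m invmx D by rewrite eA !mulmxA (mulmxK uD).
by rewrite e !mulmxA (mulmxKV uD) (mulmxKV uT) (mulmxK uD).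
Qed.

Lemma invmx_pair (K : fieldType) (n : nat) (H1 F1 H2 F2 : 'M[K]_n) :
  H2 \in unitmx -> F2 \in unitmx ->
  invmx (H2 *m F2) *m (H1 *m F1) = invmx F2 *m (invmx H2 *m H1) *m F1.
Proof.
move=> uH uF; have uHF : H2 *m F2 \in unitmx by rewrite unitmx_mul uH.
rewrite -[RHS](mulKmx uHF) !mulmxA (mulmxK uF).
by rewrite (mulmxK uH).
Qed.

(** * The relation at one point of the auto-intersection *)

Section AutoIntersection.
Variables (R : realType) (n : nat) (f : prenormal_family R n) (g : geometry R).
Variables (rho delta : R) (F H : side -> Cplx R -> Cplx R -> 'M[Cplx R]_n).
Variable St : sing -> Cplx R -> 'M[Cplx R]_n.
Notation C := (Cplx R).
Notation gam := (g_gamma g).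
Notation sa := (sin (2 * gam ^+ 2 / pi)).
Hypothesis gam0 : 0 < gam.
Hypothesis gam1 : gam * (1 + 2 * gam / pi) < pi / 2.
Hypothesis c00 : 0 < g_c0 g.
Hypothesis c01 : g_c0 g <= pi / 4 * sa.
Hypothesis h0 : 0 < g_h g.
Hypothesis k0 : 0 < g_kappa g.
Hypothesis r0 : 0 < g_r g.
Hypothesis hgap : gap_on_sector f gam rho.
Hypothesis hF : model_solutions f g delta rho F.
Hypothesis hH : unfolded_transformations f g rho F H.
Hypothesis hS : unfolded_Stokes_matrices g rho F H St.

Definition jump_at_0 (w : C) : 'M[C]_n := invmx (H sD (turn w) 0) *m H sD w 0.

Variable w : C.
Hypothesis wcap : capS gam rho w.
Hypothesis small_mid : small g w (sa ^+ 2 / 64).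
Hypothesis small_c : small g w (curve_bound g (c2 g)).
Variable T : sing -> C -> 'M[C]_n.
Hypothesis hT : forall l, diagonalizes f l St T w /\ diagonalizes f l St T (turn w).

Lemma unipotent_unit l (A : 'M[C]_n) : unipotent_at l A -> A \in unitmx.
Proof.
have low (B : 'M[C]_n) : lower_unipotent B -> B \in unitmx.
  by move=> [tB dB]; rewrite unitmxE det_trig // big1 ?unitr1.
by case: l => [/low//|/low]; rewrite unitmx_tr.
Qed.

Lemma small_turn s : small g (turn w) s = small g w s.
Proof. by rewrite /small eps_turn. Qed.

Lemma HF_unit v : pi - 2 * gam < im v < 3 * pi + 2 * gam -> sectorS gam rho v ->
  small g v (sa ^+ 2 / 64) -> H sD v 0 \in unitmx /\ F sD v 0 \in unitmx.
Proof.
move=> vS vS' sv; have [i1 i2] := halfP_mem gam0 gam1 c00 c01 h0 k0 r0 vS sv.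
by have := sol_units hH vS' i2 i1; rewrite (xt_halfP v).2.
Qed.

(** Q is given by a formula in G rather than by existence at each point, so that analyticity and
    estimates can be read off from those of G. *)
Theorem relation_at : let G := jump_at_0 w in let Q s := minor_quotients s G in
  [/\ minors_neq0 G, forall s, Q s \in unitmx &
    Q sD *m (Dmx f pR w *m invmx (T pR w) *m T pL w *m invmx (Dmx f pR w)) =
        invmx (T pL (turn w)) *m T pR (turn w) *m Q sU /\
    forall l : sing, Q sD *m Nbar f T l w = Ntilde f T l w *m Q sU].
Proof.
have [wS1 wS2] := wcap; have [_ S1] := wS1; have [_ S2] := wS2.
have [t1 t2] := capS_tan gam0 gam1 wcap.
have [uA m1 m2] := monodromy_relations gam0 gam1 c00 c01 h0 k0 r0 hF hH hS wS1 wS2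
  (sqrt_eps_turn w) t1 t2 small_mid small_c.
have sm2 : small g (turn w) (sa ^+ 2 / 64) by rewrite small_turn.
have [uH1 uF1] := HF_unit S1 wS1 small_mid; have [uH2 uF2] := HF_unit S2 wS2 sm2.
have eF := FD_turn gam0 gam1 c00 c01 h0 k0 r0 hF wcap small_mid.
have eA : connection F H w (turn w) = invmx (F sD (turn w) 0) *m jump_at_0 w *m
    (F sD (turn w) 0 *m Dmx f pR w).
  rewrite -eF /connection /sol /jump_at_0.
  have [x1 x2] := xt_halfP w; rewrite (xt_opp _ (sqrt_eps_turn w)) x1 x2.
  exact: (invmx_pair _ _ uH2 uF2).
have [eR eL] := Dmx_turn f w.
have [[vR tR] [vR' tR']] := hT pR; have [[vL tL] [vL' tL']] := hT pL.
have dR : is_diag_mx (Dmx f pR w) by exact: expdiag_is_diag.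
have dL : is_diag_mx (Dmx f pL w) by exact: expdiag_is_diag.
have [q1 q2 q3 q4 [r1 r2 r3 r4]] := transition_matrices uA dR dL (Dmx_unit f pR w)
  (fun q j => Dmx_distinct gam0 gam1 hgap pR wcap (q := q) (j := j))
  (fun q j => Dmx_distinct gam0 gam1 hgap pL wcap (q := q) (j := j)) eR eL
  (unipotent_unit vR) (unipotent_unit vL) (unipotent_unit vR') (unipotent_unit vL') tR tL tR' tL' m1 m2.
have fU := factor_move uF2 (Dmx_unit f pR w) (unipotent_unit vL) eA r3.
have fD := factor_move uF2 (Dmx_unit f pR w) (unipotent_unit vR) eA r4.
have dF : is_diag_mx (F sD (turn w) 0).
  have [lg [_ _ _ Fl]] := FD_branch hF.
  have [i1 i2] := halfP_mem gam0 gam1 c00 c01 h0 k0 r0 S2 sm2.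
  by have := Fl _ _ wS2 i2; rewrite (xt_halfP (turn w)).2 => ->; exact: expdiag_is_diag.
have mU k := det_mask_UDL k q1 fU vR' (conj_lower dR (Dmx_unit f pR w) vL).
have mD k := det_mask_LDU k q2 fD vL' (conj_upper dR (Dmx_unit f pR w) vR).
have mU' k : \det (maskmx (from k) (jump_at_0 w)) = \prod_(i | from k i) QU (connection F H w (turn w)) (Dmx f pR w) (T pL w) (T pR (turn w)) i i.
  by rewrite -mU det_mask_conj.
have mD' k : \det (maskmx (upto k) (jump_at_0 w)) = \prod_(i | upto k i) QD (connection F H w (turn w)) (Dmx f pR w) (T pR w) (T pL (turn w)) i i.
  by rewrite -mD det_mask_conj.
have [z1 E1] := minor_quotientsU q1 q3 mU'; have [z2 E2] := minor_quotientsD q2 q4 mD'.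
split.
- by move=> k; split; [exact: z1|exact: z2].
- by case; [rewrite E2; exact: q4|rewrite E1; exact: q3].
rewrite E1 E2; split; first exact: r1.
case; [exact: r2|exact: r1].
Qed.

End AutoIntersection.

(** * Uniqueness of the transformation up to a diagonal factor *)

Section MatrixNorm.
Variable R : realType.
Notation C := (Cplx R).

Lemma mx_norm_entry (m k : nat) (A : 'M[C]_(m, k)) i j (M : R) : `|A| <= ofR M -> nm (A i j) <= M.
Proof.
move=> h; rewrite -ofR_le -norm_nm; apply: le_trans h.
rewrite [leRHS]/Num.norm /= mx_normE.
have -> : `|A i j| = (`|A (i, j).1 (i, j).2|%:nng)%:num by [].
by rewrite num_le; apply: (le_bigmax (0%:nng) (fun p : 'I_m * 'I_k => `|A p.1 p.2|%:nng)).
Qed.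

Lemma mx_norm_le (m k : nat) (A : 'M[C]_(m, k)) (M : R) : 0 <= M ->
  (forall i j, nm (A i j) <= M) -> `|A| <= ofR M.
Proof.
move=> M0 h; have M0' : 0 <= ofR M :> C by rewrite -ofR0 ofR_le.
rewrite [leLHS]/Num.norm /= mx_normE.
rewrite (_ : ofR M = (NngNum M0')%:num) // num_le; apply/bigmax_leP; split.
  by rewrite -num_le.
by move=> [i j] _ /=; rewrite -num_le /= norm_nm ofR_le.
Qed.

Lemma nm_sum (I : Type) (r : seq I) (P : pred I) (F : I -> C) :
  nm (\sum_(i <- r | P i) F i) <= \sum_(i <- r | P i) nm (F i).
Proof.
elim/big_ind2: _ => [|x1 x2 y1 y2 h1 h2|//]; first by rewrite nm0.
by apply: le_trans (nmD _ _) _; exact: lerD.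
Qed.

Lemma nm_mulmx (m k l : nat) (A : 'M[C]_(m, k)) (B : 'M[C]_(k, l)) (a b : R) :
  (forall i j, nm (A i j) <= a) -> (forall i j, nm (B i j) <= b) ->
  forall i j, nm ((A *m B) i j) <= k%:R * (a * b).
Proof.
move=> hA hB i j; rewrite mxE; apply: le_trans (nm_sum _ _ _) _.
apply: le_trans (_ : \sum_(x < k) (a * b) <= _); last by rewrite sumr_const card_ord mulr_natl.
apply: ler_sum => x _; rewrite (nmM (A i x) (B x j)).
by apply: ler_pM; rewrite ?nm_ge0.
Qed.

Lemma prod_bound (I : Type) (r : seq I) (a : I -> C) (M : R) : 0 <= M ->
  (forall i, nm (a i) <= M) -> nm (\prod_(i <- r) a i) <= M ^+ size r.
Proof.
move=> M0 h; elim: r => [|i r IH]; first by rewrite big_nil nm1 expr0.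
by rewrite big_cons (nmM (a i)) /= exprS ler_pM ?nm_ge0.
Qed.

Lemma prod_diff (I : Type) (r : seq I) (a b : I -> C) (M e : R) : 1 <= M -> 0 <= e ->
  (forall i, nm (a i) <= M) -> (forall i, nm (b i) <= M) -> (forall i, nm (a i - b i) <= e) ->
  nm (\prod_(i <- r) a i - \prod_(i <- r) b i) <= (size r)%:R * M ^+ size r * e.
Proof.
move=> M1 e0 ha hb hab; have M0 : 0 <= M by apply: le_trans M1; exact: ler01.
elim: r => [|i r IH]; first by rewrite !big_nil subrr nm0 !mul0r.
rewrite !big_cons; set pa := \prod_(j <- r) a j in IH *; set pb := \prod_(j <- r) b j in IH *.
rewrite (_ : _ - _ = a i * (pa - pb) + (a i - b i) * pb); last by ring.
apply: le_trans (nmD _ _) _; rewrite (nmM (a i)) (nmM (a i - b i)).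
have h1 : nm (a i) * nm (pa - pb) <= M * ((size r)%:R * M ^+ size r * e) by rewrite ler_pM ?nm_ge0.
have h2 : nm (a i - b i) * nm pb <= e * M ^+ size r by rewrite ler_pM ?nm_ge0 ?prod_bound.
apply: le_trans (lerD h1 h2) _ => /=.
rewrite -natr1 exprS mulrDl mulrDl mul1r.
have -> : M * ((size r)%:R * M ^+ size r * e) = (size r)%:R * (M * M ^+ size r) * e by ring.
rewrite lerD2l mulrC ler_wpM2r // ler_peMl // exprn_ge0 //.
Qed.

(** A Lipschitz constant of the determinant, for the largest entry, on matrices with entries of
    modulus at most M (for M >= 1): each permutation contributes m M^m. *)
Definition det_lip (m : nat) (M : R) : R := \sum_(s : {perm 'I_m}) (m%:R * M ^+ m).

Lemma det_lip_ge0 m M : 0 <= M -> 0 <= det_lip m M.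
Proof. by move=> M0; apply: sumr_ge0 => s _; rewrite mulr_ge0 ?ler0n ?exprn_ge0. Qed.

Lemma det_diff (m : nat) (A B : 'M[C]_m) (M e : R) : 1 <= M -> 0 <= e ->
  (forall i j, nm (A i j) <= M) -> (forall i j, nm (B i j) <= M) ->
  (forall i j, nm (A i j - B i j) <= e) ->
  nm (\det A - \det B) <= det_lip m M * e.
Proof.
move=> M1 e0 hA hB hAB; rewrite /determinant -sumrB; apply: le_trans (nm_sum _ _ _) _.
rewrite /det_lip mulr_suml; apply: ler_sum => s _; rewrite -mulrBr nmM nmX nmN nm1 expr1n mul1r.
have := @prod_diff _ (index_enum 'I_m) (fun i => A i (s i)) (fun i => B i (s i)) M e M1 e0.
have -> : size (index_enum 'I_m) = m by rewrite /index_enum -enumT size_enum_ord.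
by apply.
Qed.

End MatrixNorm.

(** With u = e^{2 sqrt eps t}, x(t) - sqrt eps = - 2 sqrt eps u / (u - 1), and |u - 1| >= 1 / 2. *)
Lemma xt_near_sing (R : realType) (w t : Cplx R) : expR (2 * re (sqrt_eps w * t)) <= 2^-1 ->
  nm (xt w t - sqrt_eps w) <= 4 * nm (sqrt_eps w) * expR (2 * re (sqrt_eps w * t)).
Proof.
set q := sqrt_eps w; set z := q * t; set E := expR _ => hE.
have nE : nm (cexp (2 * z)) = E by rewrite nm_cexp -ofR_nat reMofR.
set u := cexp (2 * z) in nE.
have u1 : 2^-1 <= nm (u - 1).
  have := nmBl 1 u; rewrite nm1 nmC nE => h; apply: le_trans h; have := hE; lra.
have u0 : u - 1 != 0 by rewrite -nm_gt0; apply: lt_le_trans u1; rewrite invr_gt0.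
have key : xt w t - q = - q * (2 * u / (u - 1)).
  have : cexp z != 0 := cexp_neq0 z.
  rewrite /xt -/q -/z /ccosh /csinh cexpN; move: u0; rewrite /u cexp_double; move: (cexp z) => y.
  move=> y1 y0; have ey : y ^+ 2 - 1 = y * (y - y^-1) by field.
  have y2 : y - y^-1 != 0 by apply: contra_neq y1; rewrite ey => ->; rewrite mulr0.
  rewrite ey.
  have e : y + y^-1 = 2 * y - (y - y^-1) by ring.
  rewrite e; move: (y - y^-1) y2 => v v0; field.
  by rewrite y0 v0.
rewrite key (nmM (- q)) nmN (nmM (2 * u)) (nmM 2) nmV nE -ofR_nat nm_ofR (ger0_norm (ler0n _ _)).
have m0 := nm_ge0 q; have E0 : 0 < E := expR_gt0 _.
rewrite (_ : 4 * nm q * E = nm q * (2 * E * 2)); last by ring.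
rewrite ler_wpM2l // ler_wpM2l ?mulr_ge0 ?(ltW E0) //.
by rewrite -[leRHS]invrK lef_pV2 ?posrE ?invr_gt0 // (lt_le_trans _ u1) // invr_gt0.
Qed.

Lemma nm_clog_bound (R : realType) (z : Cplx R) : 2^-1 <= nm z -> nm z <= 2 ->
  nm (clog z) <= ln 2 + pi.
Proof.
move=> h1 h2; apply: le_trans (nm_le _) _; apply: lerD; last exact: im_clog_bound.
have n0 : 0 < nm z by apply: lt_le_trans h1; rewrite invr_gt0.
rewrite re_clog ler_norml -lnV ?posrE //.
by rewrite !ler_ln ?posrE ?invr_gt0 // h1.
Qed.

(** * The midline of Gamma_D and its two ends *)

Section Midline.
Variables (R : realType) (g : geometry R) (w : Cplx R).
Notation C := (Cplx R).
Notation gam := (g_gamma g).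
Notation th := (theta g w).
Notation T := (tan th).
Notation sa := (sin (2 * gam ^+ 2 / pi)).
Hypothesis gam0 : 0 < gam.
Hypothesis gam1 : gam * (1 + 2 * gam / pi) < pi / 2.
Hypothesis wS : pi - 2 * gam < im w < 3 * pi + 2 * gam.
Hypothesis c00 : 0 < g_c0 g.
Hypothesis c01 : g_c0 g <= pi / 4 * sa.
Hypothesis h0 : 0 < g_h g.
Hypothesis k0 : 0 < g_kappa g.
Hypothesis r0 : 0 < g_r g.
Hypothesis small_mid : small g w (sa ^+ 2 / 64).

Definition slope : C := ofR 1 + ofR T * iC.
(** The lower midline, through - P/2 with slope T: a straight line inside Gamma_D that passes over x
    = 0 and joins x_R, for s -> -oo, to x_L, for s -> +oo. *)
Definition midline (s : R) : C := - (Pper w / 2) + ofR s * slope.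
Definition decay : R := nm (sqrt_eps w) * - cos (arg_sqrt w + th) / cos th.

Lemma re_slope : re slope = 1.
Proof. by rewrite reD reMofR re_iC re_ofR mulr0 addr0. Qed.
Lemma im_slope : im slope = T.
Proof. by rewrite imD imMofR im_iC im_ofR mulr1 add0r. Qed.

Lemma midline_mem s : inside g w (midline s) /\ Gamma g sD w (midline s).
Proof.
have L0 := L_gt0 gam0 gam1 wS.
have e : ell T (midline s) = - (ell T (Pper w) / 2).
  rewrite /midline ellD ellZ ellN half_ofR ellZ {2}/ell re_slope im_slope; ring.
have i : inside g w (midline s).
  by apply: inside_midline => //; rewrite e normrN gtr0_norm // divr_gt0.
by split => //; apply: GammaD_midline.
Qed.

Lemma decay_gt0 : 0 < decay.
Proof.
have m0 := sqrt_eps_gt0 w; have c0 := cos_th gam0 gam1 wS.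
have S0 := lt_le_trans (sa_gt0 gam0 gam1) (S_ge gam0 gam1 wS).
by rewrite /decay !mulr_gt0 // invr_gt0.
Qed.

Lemma re_q_midline s : re (sqrt_eps w * midline s) = - decay * s.
Proof.
have c0 := cos_th gam0 gam1 wS; have m0 := sqrt_eps_gt0 w.
have e : ell T (midline s) = - 2^-1 * ell T (Pper w).
  rewrite /midline ellD ellZ ellN half_ofR ellZ {2}/ell re_slope im_slope; ring.
have [rho [-> _ hrho]] := sqrt_t_coord gam0 gam1 wS e.
have reM' : re (midline s) - - 2^-1 * re (Pper w) = s.
  rewrite /midline reD reMofR re_slope reN half_ofR reMofR; ring.
rewrite reM' in hrho; rewrite /decay.
have -> : rho = nm (sqrt_eps w) * s / cos th by rewrite -hrho mulfK // gt_eqF.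
move: (cos _) (nm _) c0 => x y c0'; ring.
Qed.

Lemma slope_polar : slope = ofR (cos th)^-1 * cexp (ofR th * iC).
Proof.
have c0 := cos_th gam0 gam1 wS.
rewrite cexp_polar mulrDr mulrA -!ofRM mulVf ?gt_eqF // /slope; congr (_ + ofR _ * _).
by rewrite /tan mulrC.
Qed.

Lemma re_midline_mul (s : R) (c : C) : 0 <= s -> 0 <= re (cexp (ofR th * iC) * c) ->
  - nm (Pper w / 2 * c) <= re (midline s * c).
Proof.
move=> s0 hc; rewrite /midline mulrDl reD mulNr reN.
have e : 0 <= re (ofR s * slope * c).
  rewrite slope_polar -!mulrA !reMofR mulr_ge0 // mulr_ge0 // invr_ge0 ltW //.
  exact: cos_th.
have := re_nm (Pper w / 2 * c); rewrite ler_norml => /andP[_ h]; lra.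
Qed.

Lemma re_midline_mulN (s : R) (c : C) : s <= 0 -> re (cexp (ofR th * iC) * c) <= 0 ->
  - nm (Pper w / 2 * c) <= re (midline s * c).
Proof.
move=> s0 hc; rewrite /midline mulrDl reD mulNr reN.
have e : 0 <= re (ofR s * slope * c).
  rewrite slope_polar -!mulrA !reMofR mulr_le0 // mulr_ge0_le0 // invr_ge0 ltW //.
  exact: cos_th.
have := re_nm (Pper w / 2 * c); rewrite ler_norml => /andP[_ h]; lra.
Qed.

Lemma reach_midline (A : C -> Prop) (a b : R) : a <= b ->
  (forall s, a <= s <= b -> A (midline s)) -> reach A (midline a) (midline b).
Proof. by move=> ab h; apply: reach_param. Qed.

Lemma expR_decay (e : R) : 0 < e -> exists2 s0 : R, 0 < s0 & forall s, s0 <= s -> expR (2 * (- decay * s)) <= e.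
Proof.
move=> e0; have d0 := decay_gt0.
exists (Num.max 1 (- ln e / (2 * decay))); first by rewrite lt_max ltr01.
move=> s; rewrite ge_max => /andP[_ hs].
rewrite -[leRHS](lnK (x := e)) ?posrE // ler_expR.
have d2 : 0 < 2 * decay by move: decay d0 => d d0; lra.
move: hs; rewrite (ler_pdivrMr _ _ d2); move: decay => d hs; lra.
Qed.

Lemma midline_cvg_L (e : R) : 0 < e -> exists2 s0 : R, 0 < s0 & forall s, s0 <= s ->
  nm (xt w (midline s) - hatx pL w) < e.
Proof.
move=> e0; have m0 := sqrt_eps_gt0 w.
have K0 : 0 < 4 * nm (sqrt_eps w) + 1 by rewrite ltr_wpDl // mulr_ge0 // nm_ge0.
have b0 : 0 < Num.min 2^-1 (e / 2 / (4 * nm (sqrt_eps w) + 1)).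
  by rewrite lt_min invr_gt0 ltr0n !divr_gt0.
have [s0 s00 h] := expR_decay b0; exists s0 => // s /h; rewrite le_min -re_q_midline => /andP[h1 h2].
apply: le_lt_trans (xt_near_sing h1) _.
rewrite ler_pdivlMr // in h2; have E0 := expR_gt0 (2 * re (sqrt_eps w * midline s)).
lra.
Qed.

Lemma midline_cvg_R (e : R) : 0 < e -> exists2 s0 : R, 0 < s0 & forall s, s0 <= s ->
  nm (xt w (midline (- s)) - hatx pR w) < e.
Proof.
move=> e0; have m0 := sqrt_eps_gt0 w.
have K0 : 0 < 4 * nm (sqrt_eps w) + 1 by rewrite ltr_wpDl // mulr_ge0 // nm_ge0.
have b0 : 0 < Num.min 2^-1 (e / 2 / (4 * nm (sqrt_eps w) + 1)).
  by rewrite lt_min invr_gt0 ltr0n !divr_gt0.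
have [s0 s00 h] := expR_decay b0; exists s0 => // s /h.
have -> : - decay * s = re (sqrt_eps w * - midline (- s)).
  by rewrite mulrN reN re_q_midline; ring.
rewrite le_min => /andP[h1 h2].
have := xt_near_sing h1; rewrite xtN /= -opprD nmN opprK => h3.
apply: le_lt_trans h3 _.
rewrite ler_pdivlMr // in h2; have E0 := expR_gt0 (2 * re (sqrt_eps w * - midline (- s))).
lra.
Qed.

End Midline.

Section MatrixLimits.
Variables (R : realType) (T : Type) (F : set_system T).
Context {FF : Filter F}.
Notation C := (Cplx R).

Definition mxclim (m k : nat) (f : T -> 'M[C]_(m, k)) (l : 'M[C]_(m, k)) :=
  forall i j, clim F (fun x => f x i j) (l i j).

Lemma mxclim_cvg (m k : nat) (f : T -> 'M[C]_(m, k)) (l : 'M[C]_(m, k)) :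
  f x @[x --> F] --> l -> mxclim f l.
Proof.
move=> h i j; split; apply/cvg_nmP => e e0.
have e2 : 0 < e / 2 by rewrite divr_gt0.
have e2' : 0 < ofR (e / 2) :> C by rewrite -ofR0 ofR_lt.
move/cvgrPdist_lt: h => /(_ _ e2'); apply: filterS => x hx.
have := mx_norm_entry i j (ltW hx); rewrite !mxE nmC => hx'.
by apply: le_lt_trans hx' _; lra.
Qed.

Lemma clim_det (m : nat) (f : T -> 'M[C]_m) (l : 'M[C]_m) : mxclim f l ->
  clim F (fun x => \det (f x)) (\det l).
Proof.
move=> h; rewrite /determinant.
apply: (@clim_sum _ _ _ _ _ _ xpredT (fun (s : {perm 'I_m}) x => (-1) ^+ s * \prod_i f x i (s i))
  (fun s => (-1) ^+ s * \prod_i l i (s i))) => s _.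
apply: climM; first exact: clim_cst.
by apply: (@clim_prod _ _ _ _ _ _ xpredT (fun i x => f x i (s i)) (fun i => l i (s i))) => i _; exact: h.
Qed.

(** The inverse is written out by cofactors because [invmx] returns a non-invertible matrix
    unchanged, so its entries have no common formula along the filter. *)
Lemma clim_solve (m : nat) (f h : T -> 'M[C]_m) (l k : 'M[C]_m) i j :
  mxclim f l -> mxclim h k -> l \in unitmx ->
  clim F (fun x => \sum_y (\det (f x))^-1 * cofactor (f x) y i * h x y j) ((invmx l *m k) i j).
Proof.
move=> hf hh ul; rewrite mxE.
apply: (@clim_sum _ _ _ _ _ _ xpredT (fun y x => (\det (f x))^-1 * cofactor (f x) y i * h x y j)
  (fun y => invmx l i y * k y j)) => y _.
apply: climM; last exact: hh.
rewrite /invmx ul 2!mxE; apply: climM.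
  apply: climV; last exact: clim_det.
  by rewrite -unitfE -unitmxE.
rewrite /cofactor; apply: climM; first exact: clim_cst.
apply: clim_det => a b.
have := hf (lift y a) (lift i b); congr clim; [apply/funext => x|]; by rewrite !mxE.
Qed.

End MatrixLimits.

Lemma quotient_move (K : comUnitRingType) (n : nat) (H H1 F F1 X A : 'M[K]_n) :
  H1 \in unitmx -> F \in unitmx -> F1 = F *m X -> H *m F = H1 *m F1 *m A ->
  invmx H1 *m H = F *m (X *m A) *m invmx F.
Proof.
move=> uH uF eX e; rewrite -[H](mulmxK uF) e eX !mulmxA.
by rewrite (mulVmx uH) mul1mx.
Qed.

Section Uniqueness.
Variables (R : realType) (n : nat) (f : prenormal_family R n) (g : geometry R) (delta : R).
Notation C := (Cplx R).
Notation gam := (g_gamma g).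
Notation sa := (sin (2 * gam ^+ 2 / pi)).
Hypothesis gam0 : 0 < gam.
Hypothesis gam1 : gam * (1 + 2 * gam / pi) < pi / 2.
Hypothesis c00 : 0 < g_c0 g.
Hypothesis c01 : g_c0 g <= pi / 4 * sa.
Hypothesis h0 : 0 < g_h g.
Hypothesis k0 : 0 < g_kappa g.
Hypothesis r0 : 0 < g_r g.
Variable w : C.
Hypothesis small_mid : small g w (sa ^+ 2 / 64).
Variables (rho rho1 : R) (F H F1 H1 : side -> C -> C -> 'M[C]_n).
Hypothesis hgap : gap_on_sector f gam rho.
Hypothesis hF : model_solutions f g delta rho F.
Hypothesis hH : unfolded_transformations f g rho F H.
Hypothesis hF1 : model_solutions f g delta rho1 F1.
Hypothesis hH1 : unfolded_transformations f g rho1 F1 H1.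
Hypothesis wS : sectorS gam rho w.
Hypothesis wS1 : sectorS gam rho1 w.
Notation mid := (midline g w).
Notation L0 := (pf_L0 f (eps w)).
Notation L1 := (pf_L1 f (eps w)).
Notation q := (sqrt_eps w).

Let imS : pi - 2 * gam < im w < 3 * pi + 2 * gam. Proof. by case: wS. Qed.
Let mem s : inside g w (mid s) /\ Gamma g sD w (mid s) :=
  midline_mem gam0 gam1 imS c00 c01 h0 k0 r0 small_mid s.

Definition quotient_at (t : C) : 'M[C]_n := invmx (H1 sD w (xt w t)) *m H sD w (xt w t).

Definition exponent (l t : C) (i : 'I_n) : C := t * L0 ord0 i + l / 2 * L1 ord0 i.

(** W1^-1 W is constant along the midline. The logarithms used for F and F1 differ there by a
    constant c, which goes into a diagonal factor X, so that both transformations are expressed with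
    the same model solution. *)
Lemma quotient_form : exists lg A,
  [/\ forall x y, (forall s : R, 0 <= s <= 1 -> Gamma g sD w (x + ofR s * (y - x))) ->
        path_continuous (fun s => lg (x + ofR s * (y - x))),
      forall t, Gamma g sD w t -> cexp (lg t) = xt w t ^+ 2 - eps w,
      forall s, quotient_at (mid s) = model_at f w (lg (mid s)) (mid s) *m A *m
        invmx (model_at f w (lg (mid s)) (mid s)) &
      forall s i j, quotient_at (mid s) i j = A i j *
        cexp (exponent (lg (mid s)) (mid s) i - exponent (lg (mid s)) (mid s) j)].
Proof.
have [lg [l1 l2 l3]] := log_branch hF wS.
have [lg1 [k1 k2 k3]] := log_branch hF1 wS1.
pose Z t := Gamma g sD w t /\ inside g w t.
have R0 s : reach Z (mid 0) (mid s).
  have [s0|s0] := leP 0 s.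
    by apply: reach_midline => // u _; have [a b] := mem u.
  by apply: reach_sym; apply: reach_midline; [exact: ltW|move=> u _; have [a b] := mem u].
have Lg s : lg1 (mid s) = lg (mid s) + (lg1 (mid 0) - lg (mid 0)).
  have := @reach_log_const _ _ lg1 lg _ _ _ _ (R0 s) => E.
  apply/eqP; rewrite addrC -subr_eq; apply/eqP; apply: E.
    by move=> x y h; split; [apply: k1|apply: l1] => u /h[].
  by move=> t [a _]; rewrite k2 // l2.
set c := lg1 (mid 0) - lg (mid 0) in Lg.
pose X := expdiag ((c / 2) *: L1 + 0 *: L0).
pose A0 := invmx (sol F1 H1 sD w (mid 0)) *m sol F H sD w (mid 0).
have hsol s : sol F H sD w (mid s) = sol F1 H1 sD w (mid s) *m A0.
  apply: (@solution_reach _ _ Z (system_at f w) _ _ (mid 0)).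
  - move=> t [a b]; have [x1 x2] := sol_mxsol hH wS a b; have [y1 y2] := sol_mxsol hH1 wS1 a b.
    by split; [exact: y1|exact: x1|exact: y2].
  - exact: R0.
  - have [a b] := mem 0; have [_ y2] := sol_mxsol hH1 wS1 b a.
    by rewrite /A0 (mulKVmx y2).
have form s : quotient_at (mid s) = model_at f w (lg (mid s)) (mid s) *m (X *m A0) *m
        invmx (model_at f w (lg (mid s)) (mid s)).
  have [a b] := mem s; have [uH uF] := sol_units hH wS b a; have [uH1 uF1] := sol_units hH1 wS1 b a.
  have e := hsol s; rewrite /sol in e.
  have eF := l3 _ b; have eF1 := k3 _ b; rewrite Lg in eF1.
  have eX : F1 sD w (xt w (mid s)) = F sD w (xt w (mid s)) *m X.
    by rewrite eF eF1 /X model_atD addr0.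
  rewrite /quotient_at -eF; exact: quotient_move uH1 uF eX e.
exists lg, (X *m A0); split=> //.
move=> s i j; rewrite form /model_at invmx_expdiag.
have E (u v : 'rV[C]_n) (M : 'M[C]_n) : (expdiag u *m M *m expdiag v) i j = M i j * cexp (u ord0 i + v ord0 j).
  by rewrite /expdiag mul_diag_mx mul_mx_diag !mxE cexpD; ring.
rewrite E !mxE /exponent; congr (_ * cexp _).
Qed.

Lemma bounded_below (c d y z : C) (K : R) : nm (cexp z) <= 2^-1 -> - K <= re y ->
  - (K + nm (c / 2 * d) + (ln 2 + pi) * nm d) <= re (y + (c / 2 - clog (1 - cexp z)) * d).
Proof.
move=> hz hK; rewrite reD mulrBl reB.
have h1 := re_nm (c / 2 * d); have h2 := re_nm (clog (1 - cexp z) * d).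
have b1 : 2^-1 <= nm (1 - cexp z) by have := nmBl 1 (cexp z); rewrite nm1; lra.
have b2 : nm (1 - cexp z) <= 2 by apply: le_trans (nmB _ _) _; rewrite nm1; lra.
have h3 : nm (clog (1 - cexp z) * d) <= (ln 2 + pi) * nm d.
  by rewrite (nmM (clog _)) ler_wpM2r ?nm_ge0 // nm_clog_bound.
move: h1 h2; rewrite !ler_norml => /andP[h1 _] /andP[_ h2]; lra.
Qed.

Section Growth.
Variable lg : C -> C.
Hypothesis l1 : forall x y, (forall s : R, 0 <= s <= 1 -> Gamma g sD w (x + ofR s * (y - x))) ->
  path_continuous (fun s => lg (x + ofR s * (y - x))).
Hypothesis l2 : forall t, Gamma g sD w t -> cexp (lg t) = xt w t ^+ 2 - eps w.
Notation diff s i j := (exponent (lg (mid s)) (mid s) i - exponent (lg (mid s)) (mid s) j).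

Let th_le : `|theta g w| <= gam * (1 + 2 * gam / pi).
Proof. by have /andP[a b] := th_bound gam0 imS; rewrite ler_norml !ltW. Qed.

(** Writing lg through E1 turns the difference of exponents into t times the gap at x_L plus terms
    that stay bounded as x -> x_L. The direction e^{i theta} of the midline keeps the real part of
    the gap positive, since |theta| < a0. *)
Lemma growth_L (i j : 'I_n) : (i < j)%N -> exists M s0 : R,
  forall s, s0 <= s -> - M <= re (diff s i j).
Proof.
move=> ij; have dc := decay_gt0 gam0 gam1 imS.
have h20 : 0 < 2^-1 :> R by rewrite invr_gt0.
have [s0 s00 hs0] := expR_decay gam0 gam1 imS h20.
pose G := gap f i j (eps w) (hatx pL w).
pose c := lg (mid 1) - E1 w (mid 1).
exists (nm (Pper w / 2 * G) + nm (c / 2 * (L1 ord0 i - L1 ord0 j)) + (ln 2 + pi) * nm (L1 ord0 i - L1 ord0 j)).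
exists (Num.max 1 s0) => s; rewrite ge_max => /andP[s1 ss].
have E : lg (mid s) - E1 w (mid s) = c.
  apply: (lg_reachL l1 l2); apply: reach_midline => // u /andP[u1 _].
  have [a b] := mem u; split => //; apply: reg1_left.
  by rewrite re_q_midline // mulNr oppr_lt0 mulr_gt0 //; lra.
have zE : nm (cexp (2 * (q * mid s))) <= 2^-1.
  by rewrite nm_cexp -ofR_nat reMofR re_q_midline //; exact: hs0.
have -> : diff s i j = mid s * G + (c / 2 - clog (1 - cexp (2 * (q * mid s)))) * (L1 ord0 i - L1 ord0 j).
  have -> : lg (mid s) = c + (2 * (q * mid s) - 2 * clog (1 - cexp (2 * (q * mid s)))).
    by rewrite -E /E1; ring.
  rewrite /exponent /G /gap /lam !mxE /=; by field.
apply: bounded_below => //; apply: (re_midline_mul gam0 gam1 imS); first by lra.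
by apply: ltW; exact: (gap_rot gam0 gam1 hgap pL th_le wS ij).
Qed.

(** The same at x_R. The midline is run backwards, which reverses the order of the indices; thus
    each off-diagonal entry is controlled at exactly one of the two ends. *)
Lemma growth_R (i j : 'I_n) : (j < i)%N -> exists M s0 : R,
  forall s, s0 <= s -> - M <= re (diff (- s) i j).
Proof.
move=> ij; have dc := decay_gt0 gam0 gam1 imS.
have h20 : 0 < 2^-1 :> R by rewrite invr_gt0.
have [s0 s00 hs0] := expR_decay gam0 gam1 imS h20.
pose G := gap f i j (eps w) (hatx pR w).
pose c := lg (mid (- 1)) - E1 w (- mid (- 1)).
have reN' u : re (q * - mid (- u)) = - decay g w * u.
  by rewrite mulrN reN re_q_midline //; ring.
exists (nm (Pper w / 2 * G) + nm (c / 2 * (L1 ord0 i - L1 ord0 j)) + (ln 2 + pi) * nm (L1 ord0 i - L1 ord0 j)).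
exists (Num.max 1 s0) => s; rewrite ge_max => /andP[s1 ss].
have E : lg (mid (- s)) - E1 w (- mid (- s)) = c.
  apply: (lg_reachR l1 l2); apply: reach_sym; apply: reach_midline; first by rewrite lerN2.
  move=> u /andP[_ u1].
  have [a b] := mem u; split => //; apply: reg1_left.
  by rewrite -[u]opprK reN' mulNr oppr_lt0 mulr_gt0 //; lra.
have zE : nm (cexp (2 * (q * - mid (- s)))) <= 2^-1.
  by rewrite nm_cexp -ofR_nat reMofR reN' //; exact: hs0.
have -> : diff (- s) i j = mid (- s) * G + (c / 2 - clog (1 - cexp (2 * (q * - mid (- s))))) * (L1 ord0 i - L1 ord0 j).
  have -> : lg (mid (- s)) = c + (2 * (q * - mid (- s)) - 2 * clog (1 - cexp (2 * (q * - mid (- s))))).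
    by rewrite -E /E1; ring.
  rewrite /exponent /G /gap /lam !mxE /=; by field.
apply: bounded_below => //; apply: (re_midline_mulN gam0 gam1 imS); first by lra.
have := gap_rot gam0 gam1 hgap pR th_le wS ij.
rewrite (_ : gap f j i _ _ = - G) ?mulrN ?reN; last by rewrite /G /gap opprB.
by lra.
Qed.

End Growth.

Lemma quotient_limit l : exists2 l0 : 'M[C]_n, is_diag_mx l0 & forall i j (e : R), 0 < e ->
  exists2 r : R, 0 < r & forall t, inside g w t -> Gamma g sD w t ->
    nm (xt w t - hatx l w) < r -> nm (quotient_at t i j - l0 i j) < e.
Proof.
have [K [hK _ kH]] := H_limit hH l; have [K1 [hK1 _ kH1]] := H_limit hH1 l.
have [dK uK _] := hK _ wS; have [dK1 uK1 _] := hK1 _ wS1.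
have cH := mxclim_cvg (kH sD _ wS); have cH1 := mxclim_cvg (kH1 sD _ wS1).
exists (invmx (K1 w) *m K w).
  by apply: diag_mul => //; have [] := diag_inv dK1 uK1.
have FF : Filter (within (Omega g sD w) (nbhs (hatx l w))) by exact: within_filter.
move=> i j e e0; have [cl] := clim_solve i j (cH1 FF) (cH FF) uK1.
move/(cvg_nmP FF): cl => /(_ _ e0); rewrite near_withinE => /near_nmP[r rp hr].
exists r => // t it Gt hx; have [uH1 _] := sol_units hH1 wS1 Gt it.
have := hr _ hx; rewrite /= => k; have {k} := k (ex_intro2 _ _ t Gt erefl).
congr (nm (_ - _) < e); rewrite /quotient_at mxE; apply: eq_bigr => y _.
by rewrite /invmx uH1 !mxE.
Qed.

(* On the midline H1^-1 H = F A F^-1 with A constant. It tends to a diagonal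
   matrix at both singular points, while each off-diagonal entry of
   F A F^-1 stays away from 0 at one of the two ends unless it vanishes. *)
Theorem transformation_unique : exists2 E : 'M[C]_n, is_diag_mx E & H sD w 0 = H1 sD w 0 *m E.
Proof.
have [lg [A [l1 l2 form entry]]] := quotient_form.
have key l i j (x : R -> R) : i != j -> (exists M s0 : R, forall s, s0 <= s ->
     - M <= re (exponent (lg (mid (x s))) (mid (x s)) i - exponent (lg (mid (x s))) (mid (x s)) j)) ->
   (forall e : R, 0 < e -> exists2 s0 : R, 0 < s0 & forall s, s0 <= s ->
      nm (xt w (mid (x s)) - hatx l w) < e) -> A i j = 0.
  move=> ij [M [s0 hM]] hx; apply/eqP; apply/negP => /negP A0.
  have [l0 /is_diag_mxP dl hl] := quotient_limit l.
  have e0 : 0 < nm (A i j) * expR (- M) by rewrite mulr_gt0 ?expR_gt0 // nm_gt0.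
  have [r rp hr] := hl i j _ e0; have [s1 _ hs1] := hx _ rp.
  pose s := Num.max s0 s1; have [a b] := mem (x s).
  have := hr _ a b (hs1 s _); rewrite le_max lexx orbT dl // subr0 entry => /(_ isT).
  rewrite (nmM (A i j)) nm_cexp ltr_pM2l ?nm_gt0 // ltr_expR ltNge.
  by rewrite hM // le_max lexx.
have dA : is_diag_mx A.
  apply/is_diag_mxP => i j ij.
  have [lt|lt|/val_inj e] := ltngtP i j.
  - apply: (key pL _ _ id) => //; first exact: growth_L.
    exact: midline_cvg_L gam0 gam1 imS.
  - apply: (key pR _ _ -%R) => //; first exact: growth_R.
    exact: midline_cvg_R gam0 gam1 imS.
  - by rewrite e eqxx in ij.
exists A => //; have := form 0.
have m0 : mid 0 = - (Pper w / 2) by rewrite /midline ofR0 mul0r addr0.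
have [a b] := mem 0; have [uH1 _] := sol_units hH1 wS1 b a; move: uH1.
have [x1 x2] := xt_halfP w; rewrite /quotient_at m0 x2 => uH1 e.
have dX := expdiag_is_diag (- (Pper w / 2) *: L0 + (lg (- (Pper w / 2)) / 2) *: L1).
have uX := expdiag_unit (- (Pper w / 2) *: L0 + (lg (- (Pper w / 2)) / 2) *: L1).
move: e; rewrite /model_at (diag_commute dX dA) (mulmxK uX) => <-.
by rewrite (mulKVmx uH1).
Qed.

End Uniqueness.

(** * Analyticity and uniform bounds on the auto-intersection *)

Lemma analytic2_mxcdiff (R : realType) (m k : nat) (f : Cplx R -> Cplx R -> 'M[Cplx R]_(m, k)) z x :
  analytic2_at f z x -> mxcdiff (fun u => f u x) z.
Proof.
move=> h i j; have /nbhs_singleton hd := h i j.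
have := diff_derivable hd => /(_ ((1, 0) : Cplx R * Cplx R)).
move=> hv; eexists; apply: derivable_cderiv.
have E : (fun t : Cplx R => t^-1 *: (((fun q : Cplx R * Cplx R => f q.1 q.2 i j) \o shift (z, x))
      (t *: ((1, 0) : Cplx R * Cplx R)) - f z x i j)) =
    (fun t : Cplx R => t^-1 *: (((fun u => f u x i j) \o shift z) (t *: (1 : Cplx R)) - f z x i j)).
  by apply/funext => t /=; rewrite scaler0 add0r.
exact: (eq_ind _ (fun q : Cplx R -> Cplx R => cvg (q t @[t --> 0^'])) hv _ E).
Qed.

Section CapAnalytic.
Variables (R : realType) (gam rho : R).
Notation C := (Cplx R).

Lemma capS_open w : capS gam rho w ->
  exists2 r : R, 0 < r & forall u, nm (u - w) < r -> capS gam rho u.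
Proof.
move=> [[a1 /andP[b1 b2]] [a2 /andP[b3 b4]]].
have nE u : (`|eps u| < ofR rho) = (nm (eps u) < rho) by rewrite norm_nm ofR_lt.
rewrite nE in a1; rewrite !im_turn in b3 b4.
have e0 : 0 < rho - nm (eps w) by rewrite subr_gt0.
have /cderiv_ccont/ccontP /(_ _ e0)[r1 r10 hr1] := cderiv_cexp w.
pose m := Num.min (im w - (pi - 2 * gam)) (3 * pi + 2 * gam - (im w + 2 * pi)).
have m0 : 0 < m by rewrite lt_min !subr_gt0 b1.
exists (Num.min r1 m); first by rewrite lt_min r10.
move=> u; rewrite !lt_min => /and3P[/hr1 h1 h2 h3].
have hu : nm (eps u) < rho by have := nmBl (eps u) (eps w); lra.
have := im_nm (u - w); rewrite imB ler_norml => /andP[i1 i2].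
have p0 := pi_gt0 R.
by split; split; rewrite ?nE ?eps_turn //= ?im_turn; apply/andP; split; lra.
Qed.

End CapAnalytic.

Section MinorAnalytic.
Variables (R : realType) (n : nat).
Notation C := (Cplx R).
Implicit Types (G : C -> 'M[C]_n).

Lemma cdiff_minor (p : pred 'I_n) G w : mxcdiff G w -> cdiff (fun u => \det (maskmx p (G u))) w.
Proof.
move=> hG; apply: (@cdiff_det _ _ (fun u => maskmx p (G u))) => i j.
have [hp|/negbTE hp] := boolP (p i && p j).
  by have [d hd] := hG i j; exists d; move: hd; congr cderiv; apply/funext => u; rewrite mxE hp.
exists 0; move: (cderiv_cst ((i == j)%:R : C) w); congr cderiv.
by apply/funext => u; rewrite mxE hp.
Qed.

Lemma mxcdiff_minor_quotients s G w : mxcdiff G w -> minors_neq0 (G w) ->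
  mxcdiff (fun u => minor_quotients s (G u)) w.
Proof.
move=> hG nz i j.
have [<-|/negbTE ij] := eqVneq i j; last first.
  exists 0; move: (cderiv_cst (0 : C) w); congr cderiv.
  by apply/funext => u; rewrite !mxE ij mulr0n.
have quo (p p' : pred 'I_n) : \det (maskmx p' (G w)) != 0 ->
    cdiff (fun u => \det (maskmx p (G u)) / \det (maskmx p' (G u))) w.
  move=> h; have [a ha] := cdiff_minor p hG; have [b hb] := cdiff_minor p' hG.
  by eexists; exact: cderiv_div h ha hb.
case: s.
  have [d hd] := quo (upto i.+1) _ (nz i).2; exists d; move: hd; congr cderiv.
  by apply/funext => u; rewrite !mxE eqxx mulr1n.
have [d hd] := quo (from i) _ (nz i.+1).1; exists d; move: hd; congr cderiv.
by apply/funext => u; rewrite !mxE eqxx mulr1n.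
Qed.

End MinorAnalytic.

Lemma prod_lower (R : realType) (I : Type) (r : seq I) (P : pred I) (a : I -> Cplx R) (b : R) :
  0 < b <= 1 -> (forall i, b <= nm (a i)) -> b ^+ size r <= nm (\prod_(i <- r | P i) a i).
Proof.
move=> /andP[b0 b1] h; elim: r => [|i r IH]; first by rewrite big_nil nm1 expr0.
rewrite big_cons /= exprS; case: ifP => _.
  by rewrite (nmM (a i)) ler_pM // ?exprn_ge0 // ltW.
by apply: le_trans IH; rewrite ler_piMl // exprn_ge0 // ltW.
Qed.

Lemma diag_minor_lower (R : realType) (n : nat) (p : pred 'I_n) (D : 'M[Cplx R]_n) (b : R) :
  is_diag_mx D -> 0 < b <= 1 -> (forall i, b <= nm (D i i)) -> b ^+ n <= nm (\det (maskmx p D)).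
Proof.
move=> dD hb h; rewrite det_mask_trig; last exact: is_diag_mx_is_trig.
have := @prod_lower R _ (index_enum 'I_n) p (fun i => D i i) b hb h.
by rewrite /index_enum -enumT size_enum_ord.
Qed.

Section Bounds.
Variables (R : realType) (n : nat) (f : prenormal_family R n) (g : geometry R).
Notation C := (Cplx R).
Notation gam := (g_gamma g).
Notation sa := (sin (2 * gam ^+ 2 / pi)).
Hypothesis gam0 : 0 < gam.
Hypothesis gam1 : gam * (1 + 2 * gam / pi) < pi / 2.
Hypothesis c00 : 0 < g_c0 g.
Hypothesis c01 : g_c0 g <= pi / 4 * sa.
Hypothesis h0 : 0 < g_h g.
Hypothesis k0 : 0 < g_kappa g.
Hypothesis r0 : 0 < g_r g.
Variables (rho delta : R) (F H : side -> C -> C -> 'M[C]_n).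
Hypothesis hH : unfolded_transformations f g rho F H.

Lemma H_unit w : sectorS gam rho w -> small g w (sa ^+ 2 / 64) -> H sD w 0 \in unitmx.
Proof.
move=> wS sw; have [_ imS] := wS.
have [i1 i2] := halfP_mem gam0 gam1 c00 c01 h0 k0 r0 imS sw.
by have := sol_units hH wS i2 i1; rewrite (xt_halfP w).2 => -[].
Qed.

Lemma H_mxcdiff w : sectorS gam rho w -> small g w (sa ^+ 2 / 64) ->
  mxcdiff (fun u => H sD u 0) w.
Proof.
move=> wS sw; have [_ imS] := wS.
have [_ i2] := halfP_mem gam0 gam1 c00 c01 h0 k0 r0 imS sw.
apply: (@analytic2_mxcdiff _ _ _ (H sD)); apply: (H_analytic hH wS).
by exists (- (Pper w / 2)); last exact: (xt_halfP w).2.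
Qed.

Lemma jump_mxcdiff w : capS gam rho w -> small g w (sa ^+ 2 / 64) -> mxcdiff (jump_at_0 H) w.
Proof.
move=> [wS wS'] sw; have sw' : small g (turn w) (sa ^+ 2 / 64) by rewrite small_turn.
apply: (@mxcdiff_mul _ _ _ _ (fun u => invmx (H sD (turn u) 0)) (fun u => H sD u 0)); last exact: H_mxcdiff.
apply: (@mxcdiff_inv _ _ (fun u => H sD (turn u) 0)); last exact: H_unit.
move=> i j; have [d hd] := H_mxcdiff wS' sw' i j.
have ht : cderiv (@turn R) w (1 + 0) := cderivD (cderiv_id w) (cderiv_cst _ w).
by eexists; exact: cderiv_comp ht hd.
Qed.

Lemma H_entries_bound : exists2 M : R, 1 <= M & forall w, capS gam rho w -> forall i j,
  [/\ nm (H sD w 0 i j) <= M, nm (invmx (H sD w 0) i j) <= M,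
      nm (H sD (turn w) 0 i j) <= M & nm (invmx (H sD (turn w) 0) i j) <= M].
Proof.
have [M hM] := H_bounded hH sD; exists (Num.max 1 M); first by rewrite le_max lexx.
move=> w /hM[b1 b2 b3 b4] i j.
by split; rewrite le_max; apply/orP; right; exact: mx_norm_entry.
Qed.

(** G - I = H_D (tilde, 0)^-1 (H_D (bar, 0) - H_D (tilde, 0)) is O(eps), and minors are Lipschitz on
    bounded matrices. *)
Lemma minor_close : (forall w, sectorS gam rho w -> small g w (sa ^+ 2 / 64)) ->
  exists2 L : R, 0 <= L & forall w, capS gam rho w -> forall p : pred 'I_n,
    nm (\det (maskmx p (jump_at_0 H w)) - 1) <= L * nm (eps w).
Proof.
move=> hsm; have [M M1 hM] := H_entries_bound; have [c cp hc] := H_close hH sD.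
have M0 : 0 <= M by apply: le_trans M1; exact: ler01.
pose B := Num.max 1 (n%:R * (M * M)); have B1 : 1 <= B by rewrite le_max lexx.
pose L := det_lip n B * (n%:R * (M * c)).
exists L; first by rewrite mulr_ge0 ?det_lip_ge0 ?mulr_ge0 ?ler0n // (le_trans ler01).
move=> w wc p; have [wS wS'] := wc.
have uH := H_unit wS' (hsm _ wS').
set G := jump_at_0 H w.
have hG i j : nm (G i j) <= n%:R * (M * M).
  by apply: nm_mulmx => a b; have [h1 h2 h3 h4] := hM w wc a b.
have e0 : 0 <= n%:R * (M * (c * nm (eps w))) by rewrite !mulr_ge0 ?nm_ge0 ?ler0n.
have hG1 i j : nm (G i j - (1%:M : 'M[C]_n) i j) <= n%:R * (M * (c * nm (eps w))).
  have -> : G i j - (1%:M : 'M[C]_n) i j = (invmx (H sD (turn w) 0) *m (H sD w 0 - H sD (turn w) 0)) i j.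
    by rewrite mulmxBr (mulVmx uH) /G /jump_at_0 !mxE.
  apply: nm_mulmx => a b; first by have [] := hM w wc a b.
  by apply: mx_norm_entry; rewrite ofRM -norm_nm; exact: hc.
have m1 : \det (maskmx p (1%:M : 'M[C]_n)) = 1 by rewrite maskmx1 det1.
rewrite -[X in nm (_ - X)]m1 (_ : L * nm (eps w) = det_lip n B * (n%:R * (M * (c * nm (eps w))))); last first.
  by rewrite /L; ring.
have mE (A : 'M[C]_n) i j : maskmx p A i j = if p i && p j then A i j else (i == j)%:R by rewrite mxE.
have dB (i j : 'I_n) : nm ((i == j)%:R : C) <= B.
  by apply: le_trans B1; case: eqP => _; rewrite ?nm1 ?nm0 ?ler01.
apply: (det_diff B1 e0) => i j; rewrite !mE; case: ifP => _; try exact: dB.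
- by rewrite le_max hG orbT.
- by rewrite mxE; exact: dB.
- exact: hG1.
- by rewrite subrr nm0.
Qed.

End Bounds.

Lemma conj_quotient (K : fieldType) (n : nat) (H H' H1 H1' E E' : 'M[K]_n) :
  H1' \in unitmx -> E' \in unitmx -> H = H1 *m E -> H' = H1' *m E' ->
  invmx H' *m H = invmx E' *m (invmx H1' *m H1) *m E.
Proof.
move=> u1 uE -> ->; have uHE : H1' *m E' \in unitmx by rewrite unitmx_mul u1.
rewrite -[RHS](mulKmx uHE) !mulmxA (mulmxK uE) (mulmxK u1).
by [].
Qed.

Section Comparison.
Variables (R : realType) (n : nat) (f : prenormal_family R n) (g : geometry R) (delta : R).
Notation C := (Cplx R).
Notation gam := (g_gamma g).
Notation sa := (sin (2 * gam ^+ 2 / pi)).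
Hypothesis gam0 : 0 < gam.
Hypothesis gam1 : gam * (1 + 2 * gam / pi) < pi / 2.
Hypothesis c00 : 0 < g_c0 g.
Hypothesis c01 : g_c0 g <= pi / 4 * sa.
Hypothesis h0 : 0 < g_h g.
Hypothesis k0 : 0 < g_kappa g.
Hypothesis r0 : 0 < g_r g.
Variables (rho rho1 : R) (F H F1 H1 : side -> C -> C -> 'M[C]_n).
Hypothesis hgap : gap_on_sector f gam rho.
Hypothesis hF : model_solutions f g delta rho F.
Hypothesis hH : unfolded_transformations f g rho F H.
Hypothesis hF1 : model_solutions f g delta rho1 F1.
Hypothesis hH1 : unfolded_transformations f g rho1 F1 H1.
Hypothesis le_rho : rho <= rho1.
Hypothesis hsm : forall w, sectorS gam rho w -> small g w (sa ^+ 2 / 64).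

Lemma sectorS_le w : sectorS gam rho w -> sectorS gam rho1 w.
Proof. by move=> [a b]; split => //; apply: lt_le_trans a _; rewrite ofR_le. Qed.

Lemma comparison_matrix w : sectorS gam rho w -> exists2 E : 'M[C]_n,
  [/\ is_diag_mx E, E \in unitmx, E = invmx (H1 sD w 0) *m H sD w 0 &
      invmx E = invmx (H sD w 0) *m H1 sD w 0] & H sD w 0 = H1 sD w 0 *m E.
Proof.
move=> wS; have wS1 := sectorS_le wS; have sw := hsm wS.
have [E dE e] := transformation_unique gam0 gam1 c00 c01 h0 k0 r0 sw hgap hF hH hF1 hH1 wS wS1.
have uH := H_unit gam0 gam1 c00 c01 h0 k0 r0 hH wS sw.
have uH1 := H_unit gam0 gam1 c00 c01 h0 k0 r0 hH1 wS1 sw.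
have EE : E = invmx (H1 sD w 0) *m H sD w 0 by rewrite e (mulKmx uH1).
have uE : E \in unitmx by rewrite EE; exact: unitmx_quotient.
exists E => //; split => //.
have k : invmx (H sD w 0) *m H1 sD w 0 *m E = 1%:M by rewrite -mulmxA -e (mulVmx uH).
by rewrite -[RHS](mulmxK uE) k mul1mx.
Qed.

(** G = E'^-1 G1 E with E and E' diagonal, so the minors differ by products of at most n entries of
    E and of E'^-1. These are bounded below because E^-1 and E' are products of the bounded values
    of H, H1 and their inverses. The constant may depend on H, while the radius does not. *)
Lemma minor_lower : (forall w, capS gam rho w -> forall p : pred 'I_n,
    2^-1 <= nm (\det (maskmx p (jump_at_0 H1 w)))) ->
  exists2 nu : R, 0 < nu & forall w, capS gam rho w -> forall p : pred 'I_n,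
    nu <= nm (\det (maskmx p (jump_at_0 H w))).
Proof.
move=> half; have [M M1 hM] := H_entries_bound hH; have [M' M1' hM'] := H_entries_bound hH1.
have M0 : 0 < M by apply: lt_le_trans M1; exact: ltr01.
have M0' : 0 < M' by apply: lt_le_trans M1'; exact: ltr01.
pose B := Num.max 1 (n%:R * (M * M')).
have B1 : 1 <= B by rewrite le_max lexx.
have B0 : 0 < B by apply: lt_le_trans B1; exact: ltr01.
have Bv : 0 < B^-1 <= 1 by rewrite invr_gt0 B0 invf_le1.
have Bp : 0 < B^-1 ^+ n by rewrite exprn_gt0 // invr_gt0.
exists (B^-1 ^+ n * 2^-1 * B^-1 ^+ n).
  by rewrite !mulr_gt0 // invr_gt0.
move=> w wc p; have [wS wS'] := wc.
have wc1 : capS gam rho1 w by split; exact: sectorS_le.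
have [E [dE uE EE EV] e] := comparison_matrix wS.
have [E' [dE' uE' EE' EV'] e'] := comparison_matrix wS'.
have uH1 := H_unit gam0 gam1 c00 c01 h0 k0 r0 hH1 (sectorS_le wS') (hsm wS').
have [dV vE] := diag_inv dE uE; have [dV' vE'] := diag_inv dE' uE'.
have lowE i : B^-1 <= nm (E i i).
  have : nm (invmx E i i) <= B.
    rewrite EV le_max; apply/orP; right; apply: nm_mulmx => a b.
      by have [] := hM w wc a b.
    by have [] := hM' w wc1 a b.
  have n0 : 0 < nm (E i i) by rewrite nm_gt0 diag_entries_neq0.
  by rewrite vE nmV -[leRHS]invrK lef_pV2 // posrE // invr_gt0.
have lowV i : B^-1 <= nm (invmx E' i i).
  have : nm (E' i i) <= B.
    rewrite {1}EE' le_max; apply/orP; right; rewrite (mulrC M); apply: nm_mulmx => a b.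
      by have [] := hM' w wc1 a b.
    by have [] := hM w wc a b.
  have n0 : 0 < nm (E' i i) by rewrite nm_gt0 diag_entries_neq0.
  by rewrite vE' nmV lef_pV2 // posrE.
have -> : jump_at_0 H w = invmx E' *m jump_at_0 H1 w *m E by exact: conj_quotient uH1 uE' e e'.
have hE m j : p j -> ~~ p m -> E m j = 0 by move=> a b; exact: (maskmx_diag_zero dE a b).2.
have hV i m : p i -> ~~ p m -> invmx E' i m = 0 by move=> a b; exact: (maskmx_diag_zero dV' a b).1.
rewrite (maskmx_mulR _ hE) (maskmx_mulL _ hV) 2!det_mulmx.
rewrite (nmM (\det (maskmx p (invmx E')) * _)) (nmM (\det (maskmx p (invmx E')))).
have k1 := diag_minor_lower p dV' Bv lowV; have k2 := diag_minor_lower p dE Bv lowE.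
have k3 := half w wc p.
have i0 : 0 <= 2^-1 :> R by rewrite invr_ge0.
apply: ler_pM; [by rewrite mulr_ge0 // ltW|exact: ltW| |exact: k2].
by apply: ler_pM; [exact: ltW|exact: i0|exact: k1|exact: k3].
Qed.

End Comparison.

(** * Properties of Q_U and Q_D *)

Section Conclusion.
Variables (R : realType) (n : nat) (f : prenormal_family R n) (g : geometry R) (delta : R).
Notation C := (Cplx R).
Notation gam := (g_gamma g).
Notation sa := (sin (2 * gam ^+ 2 / pi)).
Hypothesis gam0 : 0 < gam.
Hypothesis gam1 : gam * (1 + 2 * gam / pi) < pi / 2.
Hypothesis c00 : 0 < g_c0 g.
Hypothesis c01 : g_c0 g <= pi / 4 * sa.
Hypothesis h0 : 0 < g_h g.
Hypothesis k0 : 0 < g_kappa g.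
Hypothesis r0 : 0 < g_r g.
Variables (rho : R) (F H : side -> C -> C -> 'M[C]_n) (St T : sing -> C -> 'M[C]_n).
Hypothesis hgap : gap_on_sector f gam rho.
Hypothesis hF : model_solutions f g delta rho F.
Hypothesis hH : unfolded_transformations f g rho F H.
Hypothesis hS : unfolded_Stokes_matrices g rho F H St.
Hypothesis hT : forall (l : sing) (w : C), capS gam rho w ->
  diagonalizes f l St T w /\ diagonalizes f l St T (turn w).
Hypothesis hsm : forall w, sectorS gam rho w -> small g w (sa ^+ 2 / 64).
Hypothesis hsc : forall w, sectorS gam rho w -> small g w (curve_bound g (c2 g)).
Variable nu : R.
Hypothesis nu0 : 0 < nu.
Hypothesis low : forall w, capS gam rho w -> forall p : pred 'I_n,
  nu <= nm (\det (maskmx p (jump_at_0 H w))).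
Notation Q s w := (minor_quotients s (jump_at_0 H w)).

(** For minors a and b, a / b - 1 = ((a - 1) - (b - 1)) / b, where both differences are O(eps) and
    |b| >= nu. The added 1 makes the constant positive. *)
Lemma quotient_close : exists2 c : R, 0 < c & forall s w, capS gam rho w ->
  forall i j, nm (Q s w i j - (1%:M : 'M[C]_n) i j) <= c * nm (eps w).
Proof.
have [L L0 hL] := minor_close gam0 gam1 c00 c01 h0 k0 r0 hH hsm.
exists (2 * L / nu + 1); first by rewrite ltr_wpDl // divr_ge0 ?mulr_ge0 // ltW.
move=> s w wc.
have quo (p p' : pred 'I_n) : nm (\det (maskmx p (jump_at_0 H w)) / \det (maskmx p' (jump_at_0 H w)) - 1)
    <= (2 * L / nu + 1) * nm (eps w).
  have lp' := low wc p'; have a1 := hL w wc p; have a2 := hL w wc p'.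
  move: lp' a1 a2; move: (\det _) (\det _) => a b lb a1 a2.
  have b0 : b != 0 by rewrite -nm_gt0; exact: lt_le_trans lb.
  have -> : a / b - 1 = (a - 1 - (b - 1)) / b by field.
  rewrite (nmM (a - 1 - (b - 1))) nmV mulrDl mul1r.
  have e0 := nm_ge0 (eps w).
  apply: le_trans (_ : 2 * L / nu * nm (eps w) <= _); last by rewrite lerDl.
  have -> : 2 * L / nu * nm (eps w) = (L * nm (eps w) + L * nm (eps w)) / nu by ring.
  apply: ler_pM; rewrite ?nm_ge0 ?invr_ge0 ?nm_ge0 //.
    by apply: le_trans (nmB _ _) _; exact: lerD.
  by rewrite lef_pV2 // posrE // (lt_le_trans nu0).
move=> i j; rewrite !mxE; have [e|ij] := eqVneq i j; last first.
  rewrite mulr0n subrr nm0 mulr_ge0 ?nm_ge0 //.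
  by rewrite addr_ge0 // divr_ge0 ?mulr_ge0 // ltW.
by rewrite mulr1n; case: s; exact: quo.
Qed.

Theorem auto_intersection_cap : auto_intersection_relation f gam rho T.
Proof.
have rel w (wc : capS gam rho w) := relation_at gam0 gam1 c00 c01 h0 k0 r0 hgap hF hH hS wc
  (hsm wc.1) (hsc wc.1) (fun l => hT l wc).
have [c cp hc] := quotient_close.
exists (fun s w => Q s w); split; last first.
  by move=> w wc; have [_ _] := rel w wc.
move=> s; split.
- move=> w wc; have [nz uQ _] := rel w wc; split; [exact: diag_mx_is_diag|exact: uQ|].
  move=> i j; have [r rp hr] := capS_open wc; apply/near_nmP; exists r; first exact: rp.
  move=> u /hr uc; have [nzu _ _] := rel u uc.
  have hG := jump_mxcdiff gam0 gam1 c00 c01 h0 k0 r0 hH uc (hsm uc.1).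
  have [d hd] := mxcdiff_minor_quotients s hG nzu i j.
  exact: cderiv_derivable hd.
(* The limit at eps = 0 is the identity, by the estimate |Q - I| <= c |eps|. *)
- exists 1%:M; first exact: unitmx1.
  apply/cvgrPdist_lt => e e0; have [eE re0] := ofR_re_gt0 e0; rewrite eE.
  exists (re e / 2 / c); first by rewrite /= !divr_gt0.
  move=> w [wc]; rewrite /= norm_nm ofR_lt ltr_pdivlMr // => hw.
  apply: le_lt_trans (_ : ofR (re e / 2) < ofR (re e)); last by rewrite ofR_lt; lra.
  apply: mx_norm_le; first by rewrite divr_ge0 // ltW.
  move=> i j; rewrite mxE [X in _ + X]mxE nmC.
  by apply: le_trans (hc s w wc i j) _; rewrite mulrC ltW.
(* The required inequality is strict, and eps does not vanish on the covering. *)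
exists (c + 1) => w wc.
have e0 : 0 < nm (eps w) by rewrite nm_gt0 cexp_neq0.
rewrite norm_nm -ofRM; apply: le_lt_trans (_ : ofR (c * nm (eps w)) < _).
  apply: mx_norm_le; first by rewrite mulr_ge0 ?nm_ge0 // ltW.
  by move=> i j; rewrite mxE [X in _ + X]mxE; exact: hc.
by rewrite ofR_lt mulrDl mul1r ltrDl.
Qed.

End Conclusion.

Lemma theta0_le (R : realType) (n : nat) (f : prenormal_family R n) : theta0 f <= pi / 2.
Proof.
rewrite /theta0; set A := [set th : R | _].
(* The supremum of the empty set is 0 by convention. *)
have [->|/set0P[x Ax]] := eqVneq A set0; first by rewrite sup0 divr_ge0 ?pi_ge0.
apply: ge_sup; first by exists x.
by move=> y [/andP[_ /ltW]].
Qed.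

Lemma small_intro (R : realType) (g : geometry R) (w : Cplx R) (s rho : R) : 0 < s ->
  rho <= g_r g ^+ 2 / (1 + s^-1) -> `|eps w| < ofR rho -> small g w s.
Proof.
move=> s0 h; rewrite norm_nm ofR_lt => hw; have p0 : 0 < 1 + s^-1 by rewrite addr_gt0 // invr_gt0.
by rewrite /small -ltr_pdivlMr //; exact: lt_le_trans h.
Qed.

Theorem proposition4p53 (R : realType) (n : nat) (hn : (2 <= n)%N)
    (f : prenormal_family R n) (gamma : R) (gamma_gt0 : 0 < gamma)
    (gamma_small : gamma * (1 + 2 * gamma / pi) < theta0 f) :
  exists2 r0 : R, 0 < r0 & forall r : R, 0 < r < r0 ->
  forall delta : R, 0 < delta -> delta_ok f r delta ->
  exists2 mu : R, 0 < mu & forall c0 h kappa : R,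
    0 < c0 < mu -> 0 < h < mu -> h < r^-1 ->
    0 < kappa < mu -> kappa < 2^-1 ->
  exists2 rho0 : R, 0 < rho0 & forall rho : R, 0 < rho < rho0 ->
    gap_on_sector f gamma rho ->
  let g := Geometry gamma r c0 h kappa in
  forall F H : side -> Cplx R -> Cplx R -> 'M[Cplx R]_n,
    model_solutions f g delta rho F ->
    unfolded_transformations f g rho F H ->
  forall St : sing -> Cplx R -> 'M[Cplx R]_n,
    unfolded_Stokes_matrices g rho F H St ->
  forall T : sing -> Cplx R -> 'M[Cplx R]_n,
    (forall (l : sing) (w : Cplx R), capS gamma rho w ->
       diagonalizes f l St T w /\ diagonalizes f l St T (turn w)) ->
  auto_intersection_relation f gamma rho T.

Proof.
have p0 := pi_gt0 R.
have gam1 : gamma * (1 + 2 * gamma / pi) < pi / 2 := lt_le_trans gamma_small (theta0_le f).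
have sa0 : 0 < sin (2 * gamma ^+ 2 / pi) :=
  @sa_gt0 R (Geometry gamma 1 1 1 1) gamma_gt0 gam1.
exists 1; first exact: ltr01.
move=> r /andP[r0 _] delta _ _.
(* The bound on c0 that keeps sigma within L / 4 of a straight line. *)
exists (pi / 4 * sin (2 * gamma ^+ 2 / pi)); first by rewrite !mulr_gt0 // invr_gt0.
move=> c0 h kappa /andP[c00 /ltW c01] /andP[h0 _] _ /andP[k0 _] _.
pose g := Geometry gamma r c0 h kappa.
set s1 : R := sin (2 * gamma ^+ 2 / pi) ^+ 2 / 64.
have s10 : 0 < s1 by rewrite divr_gt0 // exprn_gt0.
pose s2 := curve_bound g (c2 g).
have s20 : 0 < s2 by apply: (@curve_bound_gt0 _ g) => //; exact: (@c2_gt0 _ g).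
have pos (s : R) : 0 < s -> 0 < r ^+ 2 / (1 + s^-1).
  by move=> s0; rewrite divr_gt0 ?exprn_gt0 // addr_gt0 // invr_gt0.
(* Below this radius the lower bounds for |sinh|^2 on the midlines and on the middle curves both
   give |x(t)| < r. *)
pose rg := Num.min (r ^+ 2 / (1 + s1^-1)) (r ^+ 2 / (1 + s2^-1)).
have rg0 : 0 < rg by rewrite lt_min !pos.
have hsm rho w : rho <= rg -> sectorS gamma rho w -> small g w s1.
  by rewrite le_min => /andP[h1 _] [h2 _]; exact: small_intro h2.
have hsc rho w : rho <= rg -> sectorS gamma rho w -> small g w s2.
  by rewrite le_min => /andP[_ h1] [h2 _]; exact: small_intro h2.
(* The radius has to precede F and H, whereas the estimate of the minors depends on them. If no
   transformation exists for any radius below rg, rg itself serves, vacuously. Otherwise one triple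
   (rho1, F1, H1) is fixed and supplies the radius for all others. *)
have [[rho1 [F1 [H1 [/andP[r10 r1g] hF1 hH1]]]]|none] := pselect (exists rho1 F1 H1,
    [/\ 0 < rho1 < rg, model_solutions f g delta rho1 F1 & unfolded_transformations f g rho1 F1 H1]).
  have [L L0 hL] := minor_close (g := g) gamma_gt0 gam1 c00 c01 h0 k0 r0 hH1
    (fun w => hsm rho1 w (ltW r1g)).
  have L1 : 0 < 2 * (L + 1) by rewrite mulr_gt0 // ltr_wpDl.
  (* Then L |eps| <= 1 / 2, so the minors of G for H1 have modulus at least 1 / 2, and [minor_lower]
     carries this over to every H. *)
  exists (Num.min rho1 (2 * (L + 1))^-1); first by rewrite lt_min r10 invr_gt0.
  move=> rho /andP[rho0]; rewrite lt_min => /andP[rr1 rL] hgap g' F H hF hH St hS T hT.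
  have rg' : rho <= rg by exact: ltW (lt_trans rr1 r1g).
  have half w : capS gamma rho w -> forall p : pred 'I_n,
      2^-1 <= nm (\det (maskmx p (jump_at_0 H1 w))).
    move=> [wS wS'] p.
    have wc : capS gamma rho1 w by split; exact: (sectorS_le (g := g) (ltW rr1)).
    have := hL w wc p; have [] := wS; rewrite norm_nm ofR_lt => e1 _ e2.
    have e3 : L * nm (eps w) <= 2^-1.
      have : nm (eps w) * (2 * (L + 1)) < 1 by rewrite -ltr_pdivlMr // mul1r; exact: lt_trans rL.
      by have := nm_ge0 (eps w); lra.
    by have := nmBl 1 (\det (maskmx p (jump_at_0 H1 w))); rewrite nm1 nmC; lra.
  have [nu nu0 low] := minor_lower (g := g) gamma_gt0 gam1 c00 c01 h0 k0 r0 hgap hF hH hF1 hH1 (ltW rr1)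
    (fun w => hsm rho w rg') half.
  exact: (auto_intersection_cap (g := g) gamma_gt0 gam1 c00 c01 h0 k0 r0 hgap hF hH hS hT
    (fun w => hsm rho w rg') (fun w => hsc rho w rg') nu0 low).
exists rg => // rho rho_rg hgap g' F H hF hH; exfalso; apply: none.
by exists rho, F, H.
Qed.
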